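(* Let $(M,0)$ be the germ at the origin of a smooth real hypersurface in ${\mathbb C}^n$ satisfying property {\bf PS}. If $\Delta_1^{\rm reg}(M,0)=4$, then $\Delta_1(M,0)=4$.
   Context: **Orders of contact.** Let $C^\infty_0$ denote the ring of germs at $0\in{\mathbb C}^n$ of smooth functions. Let ${\mathcal C}$ denote the collection of germs of nonconstant holomorphic maps $z:({\mathbb C},0)\to({\mathbb C}^n,0)$. For a smooth function germ or holomorphic map germ $u$ at $0$, $\nu(u)\in\{0,1,2,\dots\}\cup\{\infty\}$ denotes its order of vanishing at $0$. Let ${\mathcal C}^*\subset{\mathcal C}$ be the set of $z\in{\mathcal C}$ with $\nu(z)=1$. For a germ $h$ of a function, $z^*h$ denotes the germ $t\mapsto h(z(t))$. For an ideal $J$ in $C^\infty_0$ put $$\Delta_1(J)=\sup_{z\in{\mathcal C}}\ \inf_{h\in J}\frac{\nu(z^*h)}{\nu(z)},\qquad \Delta_1^{\rm reg}(J)=\sup_{z\in{\mathcal C}^*}\ \inf_{h\in J}\nu(z^*h).$$ For a germ $(M,0)$ of a smooth real hypersurface in ${\mathbb C}^n$, $\Delta_1(M,0):=\Delta_1(J)$ and $\Delta_1^{\rm reg}(M,0):=\Delta_1^{\rm reg}(J)$, where $J$ is the principal ideal of germs in $C^\infty_0$ vanishing on $M$. A generator $r$ of $J$ is called a defining function for $(M,0)$. It satisfies $dr(0)\neq 0$, and the infima over $h\in J$ in the definitions of $\Delta_1(J)$ and $\Delta_1^{\rm reg}(J)$ are attained at $h=r$. **Property PS for functions.** Let $g:({\mathbb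 C}^N,0)\to({\mathbb R},0)$ be the germ of a smooth function. It satisfies property {\bf PS} if, whenever $z:({\mathbb C},0)\to({\mathbb C}^N,0)$ is the germ of a holomorphic map for which the pullback $z^*g$ vanishes to finite order at $0$, this order is an even number $2k$ and the coefficient of $|t|^{2k}=t^k\overline{t}^k$ in the Taylor expansion of $z^*g$ at $0$ (in the variables $t,\overline t$) is positive. Pullbacks vanishing to infinite order are allowed and impose no condition. **Property PS for hypersurface germs.** ''Mixed terms'' means any sum of monomials (in $z,\overline z$) that are neither holomorphic nor anti-holomorphic. Write ${\bf j}_k r$ for the $k$-th order Taylor polynomial of $r$ at the origin. For a defining function $r$ of $(M,0)$ and $k\ge 2$ one can write $${\bf j}_k r=2\,{\rm Re}(h_k)+g_k,$$ where $h_k$ is a holomorphic polynomial with $h_k(0)=0$ and $dh_k(0)\neq0$, and $g_k$ is a polynomial containing only mixed terms. Let $G_k$ denote the restriction of $g_k$ to the germ at $0$ of the complex hypersurface $\{h_k=0\}$. This is a complex manifold of dimension $n-1$ near $0$, so $G_k$ is regarded as a function germ on $({\mathbb C}^{n-1},0)$ via local holomorphic coordinates. The germ $(M,0)$ satisfies property {\bf PS} if there is an integer $k_0\ge 2$ such that, for every $k\ge k_0$, there is a defining function $r=r_k$ for $(M,0)$ for which, writing ${\bf j}_k r_k=2\,{\rm Re}(h_k)+g_k$ with $h_k$ a holomorphic polynomial satisfying $h_k(0)=0$ and $dh_k(0)\neq0$ and $g_k$ a polynomial containing only mixed terms, the function $G_k$ (the restriction of $g_k$ to $\{h_k=0\}$)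 satisfies property {\bf PS}. *)

(* Defs.v *)
From HB Require Import structures.
From mathcomp Require Import all_boot all_order all_algebra.
From mathcomp Require Import all_classical all_reals all_analysis.
From mathcomp Require Import complex.
(* the notations of mpoly are incompatible with those of mathcomp-analysis *)
From mathcomp Require Import -(notations) mpoly.

Set Implicit Arguments.
Unset Strict Implicit.
Unset Printing Implicit Defensive.

Import Order.TTheory GRing.Theory Num.Theory.
Import numFieldNormedType.Exports.

Local Open Scope ring_scope.
Local Open Scope complex_scope.
Local Open Scope classical_set_scope.

(* Makes R[i] a normed space over itself, so that [differentiable] and
   [derive1n] on R[i] and 'rV[R[i]]_n are complex differentiation. *)
HB.instance Definition _ (R : realType) := NormedModule.copy R[i] R[i]^o.

(* Germs at 0 are represented by total functions; all notions about germs depend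
   only on the values near 0. *)

Section SmoothGerms.
Context {R : realType} {V : normedModType R[i]}.
Implicit Types (u : V -> R) (v p : V) (U : set V) (k m : nat).

(* Real directional derivative: [s] ranges over the reals only. *)
Definition rderive v u p : R := derive1 (fun s : R => u (p + s%:C *: v)) 0.

Fixpoint Ck_on k U u : Prop :=
  (forall p, U p -> {for p, continuous u}) /\
  match k with
  | 0%N => True
  | k'.+1 => forall v,
      (forall p, U p -> derivable (fun s : R => u (p + s%:C *: v)) 0 1) /\
      Ck_on k' U (rderive v u)
  end.

Definition smooth_germ u : Prop :=
  exists2 U, open_nbhs 0 U & forall k, Ck_on k U u.

(* The degree-m homogeneous part of the Taylor expansion of u at 0, that is
   v |-> D^m u(0)(v, ..., v) / m!. *)
Definition taylor_part m u v : R :=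
  derive1n m (fun s : R => u (s%:C *: v)) 0 / m`!%:R.

Definition jet k u v : R := \sum_(m < k.+1) taylor_part m u v.

End SmoothGerms.

Section HolomorphicGerms.
Context {R : realType} {V W : normedModType R[i]}.

Definition holomorphic_germ (f : V -> W) : Prop :=
  \forall p \near nbhs (0 : V), differentiable f p.

End HolomorphicGerms.

(* The least element of A, with value +oo when A is empty. *)
Definition least {R : realType} (A : set nat) : \bar R :=
  ereal_inf [set (m%:R)%:E | m in A].

Definition order_smooth {R : realType} {V : normedModType R[i]} (u : V -> R)
    : \bar R :=
  least [set m | exists v, taylor_part m u v != 0].

Definition order_curve {R : realType} {n} (z : R[i] -> 'rV[R[i]]_n) : \bar R :=
  least [set m | derive1n m z 0 != 0].

Section Contact.
Context {R : realType} {n : nat}.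
Notation Cn := 'rV[R[i]]_n.
Implicit Types (z : R[i] -> Cn) (h r : Cn -> R).

Definition based_curve z : Prop := z 0 = 0 /\ holomorphic_germ z.

Definition curves : set (R[i] -> Cn) :=
  [set z | based_curve z /\ ~ (\forall t \near nbhs (0 : R[i]), z t = 0)].

Definition regular_curves : set (R[i] -> Cn) :=
  [set z | curves z /\ order_curve z = 1%:E].

Definition Delta1 (J : set (Cn -> R)) : \bar R :=
  ereal_sup [set ereal_inf [set (order_smooth (h \o z) / order_curve z)%E
                           | h in J] | z in curves].

Definition Delta1_reg (J : set (Cn -> R)) : \bar R :=
  ereal_sup [set ereal_inf [set order_smooth (h \o z) | h in J]
            | z in regular_curves].

Definition real_hypersurface_germ (M : set Cn) : Prop :=
  M 0 /\ exists r, [/\ smooth_germ r, exists v, rderive v r 0 != 0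
                     & \forall x \near nbhs (0 : Cn), M x <-> r x = 0].

Definition vanishing_ideal (M : set Cn) : set (Cn -> R) :=
  [set h | smooth_germ h /\ \forall x \near nbhs (0 : Cn), M x -> h x = 0].

Definition defining_function (M : set Cn) r : Prop :=
  vanishing_ideal M r /\
  forall h, vanishing_ideal M h ->
    exists2 a, smooth_germ a & \forall x \near nbhs (0 : Cn), h x = a x * r x.

End Contact.

(* c lists the coefficients of the m-th order Taylor polynomial at 0 of u,
   written in the variables t and its conjugate. *)
Definition taylor_coefs {R : realType} (u : R[i] -> R) (m : nat)
    (c : nat -> nat -> R[i]) : Prop :=
  forall t, (jet m u t)%:C =
    \sum_(a < m.+1) \sum_(b < m.+1 | (a + b <= m)%N)
      c a b * t ^+ a * (t^*) ^+ b.

Definition PS_function {R : realType} {N : nat} (g : 'rV[R[i]]_N -> R) : Prop :=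
  forall z : R[i] -> 'rV[R[i]]_N, based_curve z ->
  forall m : nat, order_smooth (g \o z) = m%:R%:E ->
  exists k : nat, m = k.*2 /\
    exists2 c, taylor_coefs (g \o z) m c & 0 < c k k.

Section PropertyPS.
Context {R : realType} {n : nat}.
Notation Cn := 'rV[R[i]]_n.

Definition heval (h : mpoly n R[i]) (x : Cn) : R[i] :=
  meval (fun i => x 0 i) h.

(* The first n variables are evaluated at the coordinates of x, the last n
   variables at their conjugates. *)
Definition zzbar_eval (g : mpoly (n + n) R[i]) (x : Cn) : R[i] :=
  meval (fun i : 'I_(n + n) => match fintype.split i with
                  | inl j => x 0 j
                  | inr j => (x 0 j)^*
                  end) g.

Definition mixed (g : mpoly (n + n) R[i]) : Prop :=
  forall m, m \in msupp g ->
    (exists i : 'I_n, m (lshift n i) != 0%N) /\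
    (exists j : 'I_n, m (rshift n j) != 0%N).

Definition jet_decomposition k (r : Cn -> R) (h : mpoly n R[i])
    (g : mpoly (n + n) R[i]) : Prop :=
  [/\ forall x, (jet k r x)%:C = (2 * complex.Re (heval h x))%:C
                                 + zzbar_eval g x,
      heval h 0 = 0,
      exists i, heval (mderiv i h) 0 != 0
    & mixed g].

(* phi parametrizes the complex hypersurface {h = 0} near 0, and the
   restriction of psi to {h = 0} is the inverse coordinate map. *)
Definition local_coordinates (h : mpoly n R[i])
    (phi : 'rV[R[i]]_n.-1 -> Cn) (psi : Cn -> 'rV[R[i]]_n.-1) : Prop :=
  [/\ phi 0 = 0, holomorphic_germ phi, holomorphic_germ psi,
      \forall w \near nbhs (0 : 'rV[R[i]]_n.-1),
        heval h (phi w) = 0 /\ psi (phi w) = w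
    & \forall x \near nbhs (0 : Cn), heval h x = 0 -> phi (psi x) = x].

(* zzbar_eval g is real-valued here: it is a jet minus twice a real part. *)
Definition PS_hypersurface (M : set Cn) : Prop :=
  exists2 k0 : nat, (2 <= k0)%N & forall k : nat, (k0 <= k)%N ->
  exists r : Cn -> R, exists h : mpoly n R[i], exists g : mpoly (n + n) R[i],
    [/\ defining_function M r, jet_decomposition k r h g
      & exists phi, exists2 psi, local_coordinates h phi psi
          & PS_function (fun w => complex.Re (zzbar_eval g (phi w)))].

End PropertyPS.

(* Main.v *)
Require Import Defs.
From mathcomp Require Import all_boot all_order all_algebra.
From mathcomp Require Import all_classical all_reals all_analysis.
From mathcomp Require Import complex.
From mathcomp Require Import -(notations) mpoly.
From mathcomp Require Import ring lra.

(** The idea of the proof. Suppose that a curve z in the complex space, of order p, has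
    contact greater than 4p with M. Take a defining function r whose jet of
    large order k is 2 Re h + g with g mixed and with g satisfying property PS
    on the hypersurface {h = 0}. Along z, the powers of t alone (or of its
    conjugate alone) come only from 2 Re h and the mixed powers only from g.
    Since r vanishes to order greater than 4p along z, both vanish separately:
    h(z(t)) = O(t^(4p+1)), and in g(z(t)) the coefficient of every monomial in t
    and its conjugate of degree at most 4p is zero ([high_contact]).

    Write z(t) = z_p t^p + ... + z_2p t^2p + ... and compare z with the regular
    curve z_p t + z_2p t^2. A product of m coordinates of z contributes to
    t^p or t^2p only if m <= 2; the part of it in t^p or t^2p is then exactly the
    part in t or t^2 of the same product along the regular curve
    ([ramified], [zzcoef_ramified]). Hence h vanishes to order 3 along the
    regular curve, which can therefore be pushed into {h = 0} by a
    perturbation that is O(t^3) ([retract_close]); call the result G.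
    The coefficients of |t|^2 and |t|^4 in g(G(t)) are the coefficients of
    |t|^2p and |t|^4p in g(z(t)), hence zero ([regular_shadow]). But G is
    regular, so the regular type 4 says that r, equivalently g, has order at
    most 4 along G, and property PS says that this order is 2l with l <= 2 and
    that the coefficient of |t|^2l is positive ([PS_positive]): a contradiction.

    The formal computation needs the expansions of holomorphic and smooth
    germs to be available. Holomorphic germs are only assumed to be
    differentiable, so the first part proves Goursat's theorem on rectangles
    and derives from Cauchy's formula on a square that the derivative of a
    holomorphic germ is holomorphic ([hol_cd]), together with Cauchy's estimate
    ([cauchy_estimate]), which also makes the retraction onto {h = 0}
    Lipschitz. For smooth germs, whose hypotheses are on iterated directional
    derivatives, the chain rule along curves ([chain_rule]) and Taylor's formula
    uniform in the direction ([smooth_taylor]) are proved. All expansions are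
    then handled as congruences modulo O(t^m) between functions and
    polynomials, and the coefficients of a polynomial in t and its conjugate
    are recovered from its growth along real lines ([bival_uniq]). *)

Import Order.TTheory GRing.Theory Num.Theory.
Import numFieldNormedType.Exports.

Set Implicit Arguments.
Unset Strict Implicit.
Unset Printing Implicit Defensive.

Local Open Scope ring_scope.
Local Open Scope complex_scope.
Local Open Scope classical_set_scope.

Local Notation Re := complex.Re.
Local Notation Im := complex.Im.

(** * Complex modulus and complex derivatives *)

Section Modulus.
Context {R : realType}.
Local Notation C := R[i].
Implicit Types (x y z : C).

(** The norm of R[i] takes values in R[i]; its real part is used instead, so that
    all estimates are inequalities in R. *)
Definition modc x : R := Re `|x|.

Lemma normE x : `|x| = (modc x)%:C.
Proof. by rewrite /modc normc_def. Qed.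

Lemma modc_ge0 x : 0 <= modc x.
Proof. by rewrite -ler0c -normE. Qed.

Lemma modc0 : modc 0 = 0. Proof. by rewrite /modc normr0. Qed.
Lemma modc1 : modc 1 = 1. Proof. by rewrite /modc normr1. Qed.

Lemma modc_eq0 x : (modc x == 0) = (x == 0).
Proof. by rewrite -(normr_eq0 x) normE (inj_eq (@complexI R) _ 0). Qed.

Lemma modc_gt0 x : (0 < modc x) = (x != 0).
Proof. by rewrite lt_neqAle modc_ge0 andbT eq_sym modc_eq0. Qed.

Lemma modcM x y : modc (x * y) = modc x * modc y.
Proof. by apply: complexI; rewrite rmorphM /= -!normE normrM. Qed.

Lemma modcX x k : modc (x ^+ k) = modc x ^+ k.
Proof. by elim: k => [|k IH]; rewrite ?expr0 ?modc1 // !exprS modcM IH. Qed.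

Lemma modcV x : modc x^-1 = (modc x)^-1.
Proof. by apply: complexI; rewrite fmorphV /= -!normE normfV. Qed.

Lemma modcN x : modc (- x) = modc x. Proof. by rewrite /modc normrN. Qed.

Lemma modcB x y : modc (x - y) = modc (y - x).
Proof. by rewrite -modcN opprB. Qed.

Lemma ler_modcD x y : modc (x + y) <= modc x + modc y.
Proof. by rewrite -lecR rmorphD /= -!normE ler_normD. Qed.

Lemma ler_modcB x y : modc (x - y) <= modc x + modc y.
Proof. by rewrite (le_trans (ler_modcD _ _)) // modcN. Qed.

Lemma modcJ x : modc x^* = modc x.
Proof. by rewrite /modc normcJ. Qed.

Lemma modcR (a : R) : modc a%:C = `|a|.
Proof. by rewrite /modc normc_def /= expr0n /= addr0 sqrtr_sqr. Qed.

Lemma modc_ge_Re x : `|Re x| <= modc x.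
Proof. by rewrite -lecR -normE normc_ge_Re. Qed.

Lemma modc_ge_Im x : `|Im x| <= modc x.
Proof.
have := modc_ge_Re (x * 'i%C); rewrite ReiNIm normrN modcM.
by rewrite (_ : modc 'i%C = 1) ?mulr1 // /modc normc_def /= expr0n expr1n add0r sqrtr1.
Qed.

Lemma modci : modc 'i%C = 1 :> R.
Proof. by rewrite /modc normc_def /= expr0n expr1n add0r sqrtr1. Qed.

Lemma modc_le_ReIm x : modc x <= `|Re x| + `|Im x|.
Proof.
rewrite {1}[x]complexE (le_trans (ler_modcD _ _)) // modcM modci mul1r !modcR //.
Qed.

End Modulus.

Section EpsilonDelta.
Context {R : realType}.
Local Notation C := R[i].

Definition cderiv (f : C -> C) (p d : C) : Prop := forall e : R, 0 < e ->
  exists2 r : R, 0 < r & forall h, modc h < r ->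
    modc (f (p + h) - f p - d * h) <= e * modc h.

Definition ccont (f : C -> C) (p : C) : Prop := forall e : R, 0 < e ->
  exists2 r : R, 0 < r & forall h, modc h < r -> modc (f (p + h) - f p) <= e.

(** Estimates are made with explicit radii; this is the bridge to the derivative
    defined by a limit. *)
Lemma is_deriveP (f : R -> R) (x d : R) :
  (forall e, 0 < e -> exists2 r, 0 < r &
     forall h, `|h| < r -> `|f (x + h) - f x - d * h| <= e * `|h|) <->
  is_derive x 1 f d.
Proof.
split=> [H | [D <-] e e0].
  have L : h^-1 *: ((f \o shift x) (h *: 1) - f x) @[h --> 0^'] --> d.
    apply/cvgrPdist_le => /= e e0; have [r r0 Hr] := H e e0.
    near=> h; have h0 : h != 0 by near: h; exact: nbhs_dnbhs_neq.
    have hr : `|h| < r by near: h; apply: dnbhs0_lt.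
    have := Hr _ hr; rewrite /= /shift /= [h *: 1]mulr1 [_ *: _]mulrC [h + x]addrC.
    move=> le; rewrite -(ler_pM2r (x := `|h|)) ?normr_gt0 // -normrM mulrBl.
    by rewrite -mulrA mulVf // mulr1 distrC.
  apply: DeriveDef; first by apply/cvg_ex; exists d.
  by apply: cvg_lim.
have L : h^-1 *: ((f \o shift x) (h *: 1) - f x) @[h --> 0^'] --> 'D_1 f x by [].
move/cvgrPdist_le: L => /(_ e e0) /nbhs_ballP [r /= r0 Hr].
exists r => // h hr; have [->|h0] := eqVneq h 0.
  by rewrite addr0 subrr mulr0 subrr normr0 mulr0.
have := Hr h; rewrite /ball /= sub0r normrN => /(_ hr h0).
rewrite /= /shift /= [h *: 1]mulr1 [_ *: _]mulrC [h + x]addrC.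
rewrite -(ler_pM2r (x := `|h|)) ?normr_gt0 // -normrM mulrBl.
by rewrite -mulrA mulVf // mulr1 distrC.
Unshelve. all: by end_near.
Qed.

Lemma continuousP_eps (f : R -> R) (x : R) :
  (forall e, 0 < e -> exists2 r, 0 < r &
     forall h, `|h| < r -> `|f (x + h) - f x| <= e) <->
  {for x, continuous f}.
Proof.
split=> [H | H e e0].
  apply/cvgrPdist_le => /= e e0; have [r r0 Hr] := H e e0.
  apply/nbhs_ballP; exists r => // y; rewrite /ball /= distrC => yr.
  by have := Hr _ yr; rewrite addrCA subrr addr0 distrC.
move/cvgrPdist_le: H => /(_ e e0) /nbhs_ballP [r /= r0 Hr].
exists r => // h hr; rewrite distrC; apply: Hr.
by rewrite /ball /= opprD addrA subrr sub0r normrN.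
Qed.

Lemma cderiv_cont f p d : cderiv f p d -> ccont f p.
Proof.
move=> /(_ 1 ltr01) [r r0 H] e e0.
have K : 0 < 1 + modc d by rewrite ltr_pwDl // modc_ge0.
exists (Num.min r (e / (1 + modc d))); first by rewrite lt_min r0 divr_gt0.
move=> h; rewrite lt_min => /andP[hr he].
rewrite -[X in modc X](subrK (d * h)) (le_trans (ler_modcD _ _)) // modcM.
rewrite (le_trans (lerD (H _ hr) (lexx _))) //.
by rewrite -mulrDl mulrC -ler_pdivlMr // ltW.
Qed.

Lemma cderiv_uniq f p d d' : cderiv f p d -> cderiv f p d' -> d = d'.
Proof.
move=> D D'; apply/eqP; rewrite -subr_eq0 -modc_eq0 eq_le modc_ge0 andbT.
apply/ler_addgt0Pr => e e0; rewrite add0r.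
have e2 : 0 < e / 2 by rewrite divr_gt0.
have [r r0 H] := D _ e2; have [r' r'0 H'] := D' _ e2.
pose a := Num.min r r' / 2; have a0 : 0 < a by rewrite divr_gt0 // lt_min r0.
have am : a < Num.min r r'.
  by rewrite ltr_pdivrMr // mulr_natr mulr2n ltrDl lt_min r0.
have aa : modc a%:C = a by rewrite modcR gtr0_norm.
have h : modc a%:C < r by rewrite aa (lt_le_trans am) // ge_min lexx.
have h' : modc a%:C < r' by rewrite aa (lt_le_trans am) // ge_min lexx orbT.
have := lerD (H' _ h') (H _ h); rewrite aa -mulrDl -splitr => le.
rewrite -(ler_pM2r a0) (le_trans _ le) // -{1}aa -modcM.
apply: le_trans (ler_modcB _ _); rewrite le_eqVlt; apply/orP; left; apply/eqP.
by congr modc; ring.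
Qed.

Lemma ccont_eqnear f g p r : 0 < r -> (forall h, modc h < r -> f (p + h) = g (p + h)) ->
  ccont f p -> ccont g p.
Proof.
move=> r0 E H e /H [s s0 Hs]; exists (Num.min r s); first by rewrite lt_min r0.
move=> h; rewrite lt_min => /andP[hr hs].
by rewrite -E // -[X in g X]addr0 -E ?modc0 // addr0 Hs.
Qed.

Lemma cderiv_eqnear f g p d r : 0 < r -> (forall h, modc h < r -> f (p + h) = g (p + h)) ->
  cderiv f p d -> cderiv g p d.
Proof.
move=> r0 E H e /H [s s0 Hs]; exists (Num.min r s); first by rewrite lt_min r0.
move=> h; rewrite lt_min => /andP[hr hs].
by rewrite -E // -[X in _ - g X - _]addr0 -E ?modc0 // addr0 Hs.
Qed.

Lemma ccont_cst a p : ccont (fun=> a) p.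
Proof. by move=> e e0; exists 1 => // h _; rewrite subrr modc0 ltW. Qed.

Lemma ccontD f g p : ccont f p -> ccont g p -> ccont (fun t => f t + g t) p.
Proof.
move=> F G e e0; have e2 : 0 < e / 2 by rewrite divr_gt0.
have [r r0 H] := F _ e2; have [s s0 K] := G _ e2.
exists (Num.min r s); first by rewrite lt_min r0.
move=> h; rewrite lt_min => /andP[hr hs]; rewrite opprD addrACA [e]splitr.
by rewrite (le_trans (ler_modcD _ _)) // lerD ?H ?K.
Qed.

Lemma ccontM f g p : ccont f p -> ccont g p -> ccont (fun t => f t * g t) p.
Proof.
move=> F G e e0.
pose B := 1 + modc (f p) + modc (g p).
have B1 : 1 <= B by rewrite /B -addrA lerDl addr_ge0 // modc_ge0.
have B0 : 0 < B by rewrite (lt_le_trans ltr01).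
pose e' := Num.min 1 (e / (2 * B)).
have e'0 : 0 < e' by rewrite lt_min ltr01 divr_gt0 // mulr_gt0.
have [r r0 H] := F _ e'0; have [s s0 K] := G _ e'0.
exists (Num.min r s); first by rewrite lt_min r0.
move=> h; rewrite lt_min => /andP[hr hs].
have fB : modc (f (p + h)) <= B.
  rewrite -[f (p + h)](subrK (f p)) (le_trans (ler_modcD _ _)) //.
  have l1 : e' <= 1 by rewrite ge_min lexx.
  by have := H _ hr; have := modc_ge0 (g p); rewrite /B; lra.
have gB : modc (g p) <= B by rewrite /B lerDr addr_ge0 // modc_ge0.
have -> : f (p + h) * g (p + h) - f p * g p
  = f (p + h) * (g (p + h) - g p) + (f (p + h) - f p) * g p by ring.
rewrite (le_trans (ler_modcD _ _)) // !modcM.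
have le1 : modc (f (p + h)) * modc (g (p + h) - g p) <= B * e'.
  by rewrite ler_pM ?modc_ge0 // K.
have le2 : modc (f (p + h) - f p) * modc (g p) <= B * e'.
  by rewrite mulrC ler_pM ?modc_ge0 // H.
rewrite (le_trans (lerD le1 le2)) // -mulr2n -mulr_natl mulrA mulrC -ler_pdivlMr ?mulr_gt0 //.
by rewrite ge_min lexx orbT.
Qed.

Lemma cderiv_cst a p : cderiv (fun=> a) p 0.
Proof.
by move=> e e0; exists 1 => // h _; rewrite mul0r !subrr modc0 mulr_ge0 ?modc_ge0 ?ltW.
Qed.

Lemma cderiv_id p : cderiv id p 1.
Proof.
move=> e e0; exists 1 => // h _.
by rewrite /= mul1r [p + h]addrC addrK subrr modc0 mulr_ge0 ?modc_ge0 ?ltW.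
Qed.

Lemma cderivD f g p a b : cderiv f p a -> cderiv g p b ->
  cderiv (fun t => f t + g t) p (a + b).
Proof.
move=> F G e e0; have e2 : 0 < e / 2 by rewrite divr_gt0.
have [r r0 H] := F _ e2; have [s s0 K] := G _ e2.
exists (Num.min r s); first by rewrite lt_min r0.
move=> h; rewrite lt_min => /andP[hr hs].
have -> : f (p + h) + g (p + h) - (f p + g p) - (a + b) * h
 = (f (p + h) - f p - a * h) + (g (p + h) - g p - b * h) by ring.
by rewrite (le_trans (ler_modcD _ _)) // [e]splitr mulrDl lerD ?H ?K.
Qed.

Lemma cderivB_cst (z t : C) : cderiv (fun t => t - z) t 1.
Proof. by have := cderivD (cderiv_id t) (cderiv_cst (- z) t); rewrite addr0. Qed.

Lemma cderivZ f p a c : cderiv f p a -> cderiv (fun t => c * f t) p (c * a).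
Proof.
move=> F e e0; have K : 0 < 1 + modc c by rewrite ltr_pwDl // modc_ge0.
have [r r0 H] := F _ (divr_gt0 e0 K); exists r => // h hr.
have -> : c * f (p + h) - c * f p - c * a * h = c * (f (p + h) - f p - a * h) by ring.
rewrite modcM (le_trans (ler_wpM2l (modc_ge0 _) (H _ hr))) // mulrA ler_wpM2r ?modc_ge0 //.
by rewrite mulrCA ler_piMr ?ltW // ltr_pdivrMr // mul1r ltrDr.
Qed.

(** A second-order expansion of a kernel differentiates it. *)
Lemma cderiv_quadratic f p d K r : 0 < r ->
  (forall h, modc h < r -> modc (f (p + h) - f p - d * h) <= K * modc h ^+ 2) ->
  cderiv f p d.
Proof.
move=> r0 H e e0; pose K' := 1 + `|K|; have K0 : 0 < K' by rewrite ltr_pwDl.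
exists (Num.min r (e / K')); first by rewrite lt_min r0 divr_gt0.
move=> h; rewrite lt_min => /andP[hr he].
rewrite (le_trans (H _ hr)) // expr2 mulrA ler_wpM2r ?modc_ge0 //.
have KK : K <= K' by rewrite (le_trans (ler_norm _)) // lerDr.
rewrite (le_trans (ler_wpM2r (modc_ge0 _) KK)) // mulrC -ler_pdivlMr // ltW //.
Qed.

Lemma cderivM f g p a b : cderiv f p a -> cderiv g p b ->
  cderiv (fun t => f t * g t) p (a * g p + f p * b).
Proof.
move=> F G e e0.
have [s s0 Gs] := G 1 ltr01.
pose B := 1 + modc (f p) + modc (g p) + modc a + modc b.
have [p1 p2 p3 p4] : [/\ 0 <= modc (f p), 0 <= modc (g p), 0 <= modc a & 0 <= modc b].
  by split; exact: modc_ge0.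
have B1 : 1 <= B by rewrite /B; lra.
have B0 : 0 < B by rewrite (lt_le_trans ltr01).
pose e' := Num.min 1 (e / (4 * B)).
have e'0 : 0 < e' by rewrite lt_min ltr01 divr_gt0 // mulr_gt0.
have [r1 r10 H1] := F _ e'0; have [r2 r20 H2] := G _ e'0.
have [r3 r30 H3] := cderiv_cont G e'0.
exists (Num.min (Num.min r1 r2) r3); first by rewrite !lt_min r10 r20.
move=> h; rewrite !lt_min => /andP[/andP[h1 h2] h3].
have -> : f (p + h) * g (p + h) - f p * g p - (a * g p + f p * b) * h
  = (f (p + h) - f p - a * h) * (g (p + h) - g p) + (f (p + h) - f p - a * h) * g p
    + a * h * (g (p + h) - g p) + f p * (g (p + h) - g p - b * h) by ring.
have m0 := modc_ge0 h.
have l1 := H1 _ h1; have l2 := H2 _ h2; have l3 := H3 _ h3.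
have e'1 : e' <= 1 by rewrite ge_min lexx.
have e'B : 4 * (e' * B) <= e.
  by rewrite mulrCA -ler_pdivlMr ?mulr_gt0 // ge_min lexx orbT.
have le4 u v w x : modc (u + v + w + x) <= modc u + modc v + modc w + modc x :> R.
  do 3!(rewrite (le_trans (ler_modcD _ _)) // lerD2r //).
rewrite (le_trans (le4 _ _ _ _)) // !modcM.
have t1 : modc (f (p + h) - f p - a * h) * modc (g (p + h) - g p) <= e' * B * modc h.
  rewrite (le_trans (ler_pM (modc_ge0 _) (modc_ge0 _) l1 l3)) // mulrAC ler_wpM2r //.
  by rewrite ler_wpM2l ?(ltW e'0) // (le_trans e'1).
have t2 : modc (f (p + h) - f p - a * h) * modc (g p) <= e' * B * modc h.
  rewrite (le_trans (ler_pM (modc_ge0 _) (modc_ge0 _) l1 (lexx _))) // mulrAC ler_wpM2r //.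
  by rewrite ler_wpM2l ?(ltW e'0) // /B; lra.
have t3 : modc a * modc h * modc (g (p + h) - g p) <= e' * B * modc h.
  rewrite (le_trans (ler_wpM2l _ l3)) ?mulr_ge0 // mulrC mulrA ler_wpM2r //.
  by rewrite ler_wpM2l ?(ltW e'0) // /B; lra.
have t4 : modc (f p) * modc (g (p + h) - g p - b * h) <= e' * B * modc h.
  rewrite (le_trans (ler_wpM2l _ l2)) // mulrCA mulrA ler_wpM2r //.
  by rewrite ler_wpM2l ?(ltW e'0) // /B; lra.
have : 4 * (e' * B) * modc h <= e * modc h by rewrite ler_wpM2r.
lra.
Qed.

Lemma modc_ge_half (u h : C) : modc h <= modc u / 2 -> modc u / 2 <= modc (u + h).
Proof.
move=> le; have := ler_modcB (u + h) h; rewrite addrK => l2.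
by have := modc_ge0 u; lra.
Qed.

Lemma cderivV p : p != 0 -> cderiv (fun t => t^-1) p (- (p ^- 2)).
Proof.
move=> p0; have m0 : 0 < modc p by rewrite modc_gt0.
have m2 : 0 < modc p / 2 by rewrite divr_gt0.
apply: (@cderiv_quadratic _ _ _ (modc p ^- 2 * (modc p / 2)^-1) (modc p / 2)) => // h hr.
have le := modc_ge_half (ltW hr).
have ph : p + h != 0 by rewrite -modc_gt0 (lt_le_trans m2).
have -> : (p + h)^-1 - p^-1 - - p ^- 2 * h = h ^+ 2 * (p ^- 2 * (p + h)^-1).
  by field; rewrite ?ph ?p0.
rewrite modcM modcX mulrC ler_wpM2r ?exprn_ge0 ?modc_ge0 // modcM modcV modcX.
by rewrite ler_wpM2l ?invr_ge0 ?exprn_ge0 ?modc_ge0 // modcV lef_pV2 ?posrE ?modc_gt0.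
Qed.

Lemma cderiv_comp_aff g a w p d : cderiv g (a + w * p) d ->
  cderiv (fun t => g (a + w * t)) p (w * d).
Proof.
move=> G e e0; have K : 0 < 1 + modc w by rewrite ltr_pwDl // modc_ge0.
have [r r0 H] := G _ (divr_gt0 e0 K).
exists (r / (1 + modc w)); first by rewrite divr_gt0.
move=> h hr; have wh : modc (w * h) <= (1 + modc w) * modc h.
  by rewrite modcM ler_wpM2r ?modc_ge0 // lerDr.
have /H : modc (w * h) < r by rewrite (le_lt_trans wh) // mulrC -ltr_pdivlMr.
rewrite mulrDr addrA mulrA [d * w]mulrC => le; rewrite (le_trans le) //.
rewrite (le_trans (ler_wpM2l _ wh)) ?divr_ge0 ?(ltW e0) ?(ltW K) //.
by rewrite mulrA divfK ?gt_eqF.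
Qed.

(** Componentwise, because R[i] is a normed module over itself and not over R. *)
Definition rcderiv (F : R -> C) (x : R) (d : C) : Prop :=
  is_derive x 1 (fun s => Re (F s)) (Re d) /\ is_derive x 1 (fun s => Im (F s)) (Im d).

Lemma cderiv_line g a w (x : R) d : cderiv g (a + w * x%:C) d ->
  rcderiv (fun s : R => g (a + w * s%:C)) x (w * d).
Proof.
move/cderiv_comp_aff => G; split; apply/is_deriveP => e e0;
  have [r r0 H] := G e e0; exists r => // h hr.
  have := H h%:C; rewrite !modcR => /(_ hr).
  apply: le_trans; apply: le_trans (modc_ge_Re _); rewrite -rmorphD /=.
  have -> : Re (w * d) * h = Re (w * d * h%:C) by case: (w * d) => u v /=; ring.
  by rewrite !raddfB.
have := H h%:C; rewrite !modcR => /(_ hr).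
apply: le_trans; apply: le_trans (modc_ge_Im _); rewrite -rmorphD /=.
have -> : Im (w * d) * h = Im (w * d * h%:C) by case: (w * d) => u v /=; ring.
by rewrite !raddfB.
Qed.

Lemma ccont_line g a w (x : R) : ccont g (a + w * x%:C) ->
  {for x, continuous (fun s : R => Re (g (a + w * s%:C)))} /\
  {for x, continuous (fun s : R => Im (g (a + w * s%:C)))}.
Proof.
move=> G; have K : 0 < 1 + modc w by rewrite ltr_pwDl // modc_ge0.
split; apply/continuousP_eps => e e0; have [r r0 H] := G e e0;
  (exists (r / (1 + modc w)); first by rewrite divr_gt0) => h hr.
  have /H : modc (w * h%:C) < r.
    rewrite modcM modcR; rewrite ltr_pdivlMr // mulrC in hr.
    by rewrite (le_lt_trans _ hr) // ler_wpM2r // lerDr.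
  apply: le_trans; rewrite rmorphD mulrDr addrA -raddfB; exact: modc_ge_Re.
have /H : modc (w * h%:C) < r.
  rewrite modcM modcR; rewrite ltr_pdivlMr // mulrC in hr.
  by rewrite (le_lt_trans _ hr) // ler_wpM2r // lerDr.
by apply: le_trans; rewrite rmorphD mulrDr addrA -raddfB; exact: modc_ge_Im.
Qed.

End EpsilonDelta.

(** * Integrals over segments and rectangles *)

Section Primitives.
Context {R : realType}.
Local Notation C := R[i].

Lemma mean_value_ineq (F f : R -> R) (a b B : R) : a <= b ->
  (forall x : R, a <= x <= b -> is_derive x 1 F (f x)) ->
  (forall x, a <= x <= b -> `|f x| <= B) -> `|F b - F a| <= B * (b - a).
Proof.
move=> ab D bd.
have cF : {within `[a, b], continuous F}.
  apply: derivable_within_continuous => x; rewrite in_itv /= => xab.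
  exact: (ex_derive (is_derive := D _ xab)).
have dF x : x \in `]a, b[%R -> is_derive x 1 F (f x).
  by rewrite in_itv /= => /andP[/ltW ax /ltW xb]; apply: D; rewrite ax.
have [c cab ->] := MVT_segment ab dF cF.
rewrite normrM (ger0_norm (x := b - a)) ?subr_ge0 // ler_wpM2r ?subr_ge0 //.
by apply: bd; rewrite in_itv /= in cab.
Qed.

(** The domain shrinks from ]-2, 2[ to ]-3/2, 3/2[, which is still a neighbourhood of
    the interval [-1, 1] over which integrals are taken: endpoints need no care. *)
Lemma real_primitive (f : R -> R) : (forall x : R, `|x| < 2 -> {for x, continuous f}) ->
  exists F : R -> R, forall x : R, `|x| < 3 / 2 -> is_derive x 1 F (f x).
Proof.
move=> cf.
exists (fun x => \int[lebesgue_measure]_(t in `[(- (7/4) : R), x]) f t) => x.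
rewrite ltr_norml => /andP[x1 x2].
have xu : x < 7 / 4 by lra.
have ax : - (7/4) < x by lra.
have integ : lebesgue_measure.-integrable `[(- (7/4) : R), 7/4] (EFin \o f).
  apply: continuous_compact_integrable; first exact: segment_compact.
  apply: continuous_in_subspaceT => y; rewrite inE /= in_itv /= => /andP[y1 y2].
  by apply: cf; rewrite ltr_norml; apply/andP; split; lra.
have cx : {for x, continuous f} by apply: cf; rewrite ltr_norml; apply/andP; split; lra.
have FTC := @continuous_FTC1 R f (BLeft (- (7/4))) x (7/4) xu integ _ cx.
have [|d e] := FTC; first exact: ax.
exact: (DeriveDef d (etrans (esym (derive1E _ _)) e)).
Qed.

Definition primitive (F f : R -> C) : Prop :=
  forall x, `|x| < 3 / 2 -> rcderiv F x (f x).

Definition integrable_line (f : R -> C) : Prop := exists F, primitive F f.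

(** With an integral defined as a difference of values of a chosen antiderivative,
    additivity over intervals holds by definition; linearity and bounds come from
    the uniqueness of antiderivatives and the mean value inequality. *)
Definition prim (f : R -> C) : R -> C := xget (fun=> 0) [set F | primitive F f].

Definition cint (f : R -> C) (a b : R) : C := prim f b - prim f a.

Lemma prim_primitive f : integrable_line f -> primitive (prim f) f.
Proof. by case=> F Ff; rewrite /prim; case: xgetP => [G _ //|/(_ F)]. Qed.

Lemma integrable_line_continuous (f : R -> C) :
  (forall x : R, `|x| < 2 -> {for x, continuous (fun s => Re (f s))}) ->
  (forall x : R, `|x| < 2 -> {for x, continuous (fun s => Im (f s))}) ->
  integrable_line f.
Proof.
move=> /real_primitive [F HF] /real_primitive [G HG].
by exists (fun x => Complex (F x) (G x)) => x x2; split; [apply: HF | apply: HG].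
Qed.

Lemma rcderiv_bound (F f : R -> C) (a b B : R) : a <= b ->
  (forall x, a <= x <= b -> rcderiv F x (f x)) ->
  (forall x, a <= x <= b -> modc (f x) <= B) -> modc (F b - F a) <= 2 * B * (b - a).
Proof.
move=> ab D bd.
rewrite (le_trans (modc_le_ReIm _)) // mulr_natl mulrnAl mulr2n !raddfB /= lerD //.
  apply: (@mean_value_ineq (fun s => Re (F s)) (fun s => Re (f s))) => // x xab.
    by have [] := D _ xab.
  by rewrite (le_trans (modc_ge_Re _)) // bd.
apply: (@mean_value_ineq (fun s => Im (F s)) (fun s => Im (f s))) => // x xab.
  by have [] := D _ xab.
by rewrite (le_trans (modc_ge_Im _)) // bd.
Qed.

Lemma rcderivD (F G : R -> C) x c d : rcderiv F x c -> rcderiv G x d ->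
  rcderiv (fun s => F s + G s) x (c + d).
Proof.
move=> [F1 F2] [G1 G2]; split; rewrite raddfD /=.
  have -> : (fun s => Re (F s + G s)) = (fun s => Re (F s) + Re (G s)).
    by apply/funext => s; rewrite raddfD.
  exact: is_deriveD.
have -> : (fun s => Im (F s + G s)) = (fun s => Im (F s) + Im (G s)).
  by apply/funext => s; rewrite raddfD.
exact: is_deriveD.
Qed.

Lemma Re_mulc (x y : C) : Re (x * y) = Re x * Re y - Im x * Im y.
Proof. by case: x => a b; case: y => c d. Qed.
Lemma Im_mulc (x y : C) : Im (x * y) = Re x * Im y + Im x * Re y.
Proof. by case: x => a b; case: y => c d. Qed.

Lemma rcderivZ (F : R -> C) x w d : rcderiv F x d -> rcderiv (fun s => w * F s) x (w * d).
Proof.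
move=> [F1 F2]; split; rewrite ?Re_mulc ?Im_mulc.
  have -> : (fun s => Re (w * F s)) = (fun s => Re w *: Re (F s) - Im w *: Im (F s)).
    by apply/funext => s; rewrite Re_mulc.
  exact: is_deriveB.
have -> : (fun s => Im (w * F s)) = (fun s => Re w *: Im (F s) + Im w *: Re (F s)).
  by apply/funext => s; rewrite Im_mulc.
exact: is_deriveD.
Qed.

Lemma rcderivN (F : R -> C) x d : rcderiv F x d -> rcderiv (fun s => - F s) x (- d).
Proof.
move=> /(@rcderivZ _ _ (-1)); rewrite mulN1r.
by congr rcderiv; apply/funext => s; rewrite mulN1r.
Qed.

Lemma rcderiv0_const (F : R -> C) a b : (forall x, `|x| < 3 / 2 -> rcderiv F x 0) ->
  `|a| <= 1 -> `|b| <= 1 -> F a = F b.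
Proof.
move=> D; wlog ab : a b / a <= b => [W|] a1 b1.
  by have [/W|/ltW /W] := leP a b => ->.
apply/eqP; rewrite eq_sym -subr_eq0 -modc_eq0 eq_le modc_ge0 andbT.
have -> : 0 = 2 * 0 * (b - a) by rewrite mulr0 mul0r.
apply: (@rcderiv_bound _ (fun=> 0)) => // [x xab|x _]; last by rewrite modc0.
move: a1 b1 xab; rewrite !ler_norml => /andP[a1 a2] /andP[b1 b2] /andP[xa xb].
by apply: D; rewrite ltr_norml; apply/andP; split; lra.
Qed.

Lemma cint_ftc F f a b : primitive F f -> `|a| <= 1 -> `|b| <= 1 ->
  cint f a b = F b - F a.
Proof.
move=> Ff a1 b1; have If : integrable_line f by exists F.
have /(_ a b) := @rcderiv0_const (fun x => prim f x - F x).
move=> H; rewrite /cint; suff : prim f a - F a = prim f b - F b.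
  move=> E; rewrite -(subrK (F b) (prim f b)) -E; ring.
apply: H => // x x2; rewrite -[X in rcderiv _ _ X](subrr (f x)).
apply: rcderivD; first exact: prim_primitive.
by apply: rcderivN; apply: Ff.
Qed.

Lemma cintDZ f g c a b : integrable_line f -> integrable_line g ->
  `|a| <= 1 -> `|b| <= 1 ->
  cint (fun x => f x + c * g x) a b = cint f a b + c * cint g a b.
Proof.
move=> If Ig a1 b1.
rewrite (@cint_ftc (fun x => prim f x + c * prim g x)) //.
  by rewrite /cint; ring.
by move=> x x2; apply: rcderivD; [|apply: rcderivZ]; apply: prim_primitive.
Qed.

Lemma cint_bound f a b B : integrable_line f -> -1 <= a -> a <= b -> b <= 1 ->
  (forall x, a <= x <= b -> modc (f x) <= B) -> modc (cint f a b) <= 2 * B * (b - a).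
Proof.
move=> If a1 ab b1 bd; apply: rcderiv_bound bd => // x /andP[xa xb].
by apply: prim_primitive => //; rewrite ltr_norml; apply/andP; split; lra.
Qed.

End Primitives.

Section Goursat.
Context {R : realType}.
Local Notation C := R[i].

(** The path is p + w s, so that w is the factor dt/ds. *)
Definition side (q : C -> C) (p w : C) (a b : R) : C :=
  w * cint (fun s => q (p + w * s%:C)) a b.

Definition loop (q : C -> C) (x0 x1 y0 y1 : R) : C :=
  side q ('i * y0%:C) 1 x0 x1 - side q ('i * y1%:C) 1 x0 x1
  + (side q x1%:C 'i y0 y1 - side q x0%:C 'i y0 y1).

(** The region in which integrands are required to be regular; all contours lie in
    the closed square of half the size. *)
Definition square2 (t : C) : Prop := `|Re t| < 2 /\ `|Im t| < 2.

Lemma hline_Re (x y : R) : Re ('i * y%:C + 1 * x%:C) = x.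
Proof. by rewrite /=; ring. Qed.
Lemma hline_Im (x y : R) : Im ('i * y%:C + 1 * x%:C) = y.
Proof. by rewrite /=; ring. Qed.
Lemma vline_Re (x y : R) : Re (x%:C + 'i * y%:C) = x.
Proof. by rewrite /=; ring. Qed.
Lemma vline_Im (x y : R) : Im (x%:C + 'i * y%:C) = y.
Proof. by rewrite /=; ring. Qed.
Definition integrable_side q p w := integrable_line (fun s : R => q (p + w * s%:C) : C).

Lemma integrable_side_cont q p w :
  (forall s : R, `|s| < 2 -> ccont q (p + w * s%:C)) -> integrable_side q p w.
Proof.
move=> H; apply: integrable_line_continuous => x x2;
by have [] := ccont_line (H _ x2).
Qed.

(** Each side is integrable as part of a fixed line, which survives subdivision of
    the rectangle. *)
Definition integrable_loop q x0 x1 y0 y1 : Prop :=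
  [/\ integrable_side q ('i * y0%:C) 1, integrable_side q ('i * y1%:C) 1,
      integrable_side q x1%:C 'i & integrable_side q x0%:C 'i].

Definition in_box (x0 x1 y0 y1 : R) : Prop :=
  [/\ -1 <= x0, x0 <= x1 & x1 <= 1] /\ [/\ -1 <= y0, y0 <= y1 & y1 <= 1].

Lemma in_box_norm x0 x1 y0 y1 : in_box x0 x1 y0 y1 ->
  [/\ `|x0| <= 1, `|x1| <= 1, `|y0| <= 1 & `|y1| <= 1].
Proof. by move=> [[? ? ?] [? ? ?]]; split; rewrite ler_norml; apply/andP; split; lra. Qed.

Lemma loopDZ f g c x0 x1 y0 y1 : in_box x0 x1 y0 y1 ->
  integrable_loop f x0 x1 y0 y1 -> integrable_loop g x0 x1 y0 y1 ->
  loop (fun t => f t + c * g t) x0 x1 y0 y1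
  = loop f x0 x1 y0 y1 + c * loop g x0 x1 y0 y1.
Proof.
move=> /in_box_norm [? ? ? ?] [f1 f2 f3 f4] [g1 g2 g3 g4]; rewrite /loop /side.
by rewrite !cintDZ //; ring.
Qed.

Definition on_boundary (x0 x1 y0 y1 : R) (t : C) : Prop :=
  [/\ x0 <= Re t <= x1, y0 <= Im t <= y1 &
   (Re t == x0) || (Re t == x1) || (Im t == y0) || (Im t == y1)].

Lemma loop_bound q x0 x1 y0 y1 B : in_box x0 x1 y0 y1 ->
  integrable_loop q x0 x1 y0 y1 ->
  (forall t, on_boundary x0 x1 y0 y1 t -> modc (q t) <= B) ->
  modc (loop q x0 x1 y0 y1) <= 4 * B * ((x1 - x0) + (y1 - y0)).
Proof.
move=> [[x0m x01 x1M] [y0m y01 y1M]] [q1 q2 q3 q4] bd; rewrite /loop /side !mul1r.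
have h1 : modc (cint (fun s : R => q ('i * y0%:C + 1 * s%:C)) x0 x1) <= 2 * B * (x1 - x0).
  apply: cint_bound => // x xx; apply: bd; split; rewrite ?hline_Re ?hline_Im ?lexx //.
  by rewrite eqxx !orbT.
have h2 : modc (cint (fun s : R => q ('i * y1%:C + 1 * s%:C)) x0 x1) <= 2 * B * (x1 - x0).
  apply: cint_bound => // x xx; apply: bd; split; rewrite ?hline_Re ?hline_Im ?lexx ?andbT //.
  by rewrite eqxx !orbT.
have h3 : modc (cint (fun s : R => q (x1%:C + 'i * s%:C)) y0 y1) <= 2 * B * (y1 - y0).
  apply: cint_bound => // x xx; apply: bd; split; rewrite ?vline_Re ?vline_Im ?lexx ?andbT //.
  by rewrite eqxx !orbT.
have h4 : modc (cint (fun s : R => q (x0%:C + 'i * s%:C)) y0 y1) <= 2 * B * (y1 - y0).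
  apply: cint_bound => // x xx; apply: bd; split; rewrite ?vline_Re ?vline_Im ?lexx //.
  by rewrite eqxx ?orbT.
rewrite (le_trans (ler_modcD _ _)) // (le_trans (lerD (ler_modcB _ _) (ler_modcB _ _))) //.
rewrite !modcM modci !mul1r.
lra.
Qed.

(** The increments of the antiderivative along the four sides cancel at the corners. *)
Lemma loop_antiderivative (P q : C -> C) x0 x1 y0 y1 : in_box x0 x1 y0 y1 ->
  (forall t, Re t = x0 \/ Re t = x1 \/ Im t = y0 \/ Im t = y1 -> cderiv P t (q t)) ->
  loop q x0 x1 y0 y1 = 0.
Proof.
move=> /in_box_norm [x0n x1n y0n y1n] D.
have S p (w : C) a b : w != 0 -> `|a| <= 1 -> `|b| <= 1 ->
    (forall s : R, cderiv P (p + w * s%:C) (q (p + w * s%:C))) ->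
    side q p w a b = P (p + w * b%:C) - P (p + w * a%:C).
  move=> w0 a1 b1 Dw; rewrite /side (@cint_ftc _ (fun s : R => w^-1 * P (p + w * s%:C))) //.
    by rewrite -mulrBr mulrA divff ?mul1r.
  move=> x _; have := rcderivZ w^-1 (cderiv_line (Dw x)).
  by rewrite mulrA mulVf // mul1r.
have i0 : 'i%C != 0 :> C by rewrite -modc_gt0 modci.
have E (x y : R) : x%:C + 'i * y%:C = 'i * y%:C + 1 * x%:C by ring.
rewrite /loop !S ?oner_eq0 //; first by rewrite !E; ring.
- by move=> s; apply: D; left; rewrite vline_Re.
- by move=> s; apply: D; right; left; rewrite vline_Re.
- by move=> s; apply: D; right; right; right; rewrite hline_Im.
- by move=> s; apply: D; right; right; left; rewrite hline_Im.
Qed.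

Lemma loop_quarters q x0 x1 x2 y0 y1 y2 :
  loop q x0 x2 y0 y2 = loop q x0 x1 y0 y1 + loop q x1 x2 y0 y1
                     + loop q x0 x1 y1 y2 + loop q x1 x2 y1 y2.
Proof. by rewrite /loop /side /cint; ring. Qed.

Lemma loop_annulus q x0 x1 y0 y1 a b c d :
  loop q x0 x1 y0 y1 = loop q a b c d + loop q x0 a y0 y1 + loop q b x1 y0 y1
                     + loop q a b y0 c + loop q a b d y1.
Proof. by rewrite /loop /side /cint; ring. Qed.

(** Left endpoints of nested intervals increase and are bounded; their supremum lies
    in all the intervals. *)
Lemma nested_point (u : nat -> R) (w : nat -> R) :
  (forall n, u n <= u n.+1) -> (forall n, u n.+1 + w n.+1 <= u n + w n) ->
  (forall n, 0 <= w n) -> exists c, forall n, u n <= c <= u n + w n.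
Proof.
move=> u1 u2 w0.
have mono m n : (m <= n)%N -> u m <= u n /\ u n + w n <= u m + w m.
  move=> /subnK <-; elim: (n - m)%N => [|k [IH1 IH2]]; first by rewrite add0n.
  by split; rewrite addSn; [rewrite (le_trans IH1) | rewrite (le_trans _ IH2)].
have ub n : ubound (range u) (u n + w n).
  move=> _ [m _ <-]; have [/mono [le1 le2]|/ltnW /mono [le1 le2]] := leqP m n.
    by rewrite (le_trans le1) // lerDl.
  by rewrite (le_trans _ le2) // lerDl.
exists (sup (range u)) => n; apply/andP; split.
  by apply: ub_le_sup; [exists (u 0%N + w 0%N); exact: ub | exists n].
by apply: ge_sup; [exists (u 0%N); exists 0%N | exact: ub].
Qed.

End Goursat.

(** * Goursat's theorem *)

Section GoursatTheorem.
Context {R : realType}.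
Local Notation C := R[i].

Lemma in_box_integrable (q : C -> C) x0 x1 y0 y1 : in_box x0 x1 y0 y1 ->
  (forall t, square2 t -> ccont q t) -> integrable_loop q x0 x1 y0 y1.
Proof.
move=> /in_box_norm [x0n x1n y0n y1n] cq.
split; apply: integrable_side_cont => s s2; apply: cq; split;
  rewrite ?hline_Re ?hline_Im ?vline_Re ?vline_Im //; lra.
Qed.

(** Goursat's bisection. If the loop integral exceeded eta times the squared scale,
    the same would hold for one of the four quarters, and so on at every scale
    2^-n. The nested quarters close in on a point l, where q is affine up to
    o(|t - l|). The affine part has an antiderivative and integrates to zero, and
    the remainder contributes o(4^-n): a contradiction. *)
Theorem goursat (q : C -> C) x0 x1 y0 y1 : in_box x0 x1 y0 y1 ->
  (forall t, square2 t -> ccont q t) ->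
  (forall t, x0 <= Re t <= x1 -> y0 <= Im t <= y1 -> exists d, cderiv q t d) ->
  loop q x0 x1 y0 y1 = 0.
Proof.
move=> box cq dq; apply/eqP; rewrite -modc_eq0 eq_le modc_ge0 andbT leNgt.
apply/negP => L0.
have [[x0m x01 x1M] [y0m y01 y1M]] := box.
pose a := x1 - x0; pose b := y1 - y0; pose eta := modc (loop q x0 x1 y0 y1) / 2.
have a0 : 0 <= a by rewrite subr_ge0.
have b0 : 0 <= b by rewrite subr_ge0.
have eta0 : 0 < eta by rewrite divr_gt0.
pose h n : R := 2^-1 ^+ n.
have hS n : h n = h n.+1 + h n.+1 by rewrite /h exprS; lra.
have h0 n : 0 < h n by rewrite exprn_gt0 // invr_gt0.
pose P n (p : R * R) :=
  modc (loop q p.1 (p.1 + h n * a) p.2 (p.2 + h n * b)) <= eta * h n ^+ 2.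
have step (np : nat * (R * R)) : exists p' : R * R, ~ P np.1 np.2 ->
    [/\ p'.1 = np.2.1 \/ p'.1 = np.2.1 + h np.1.+1 * a,
        p'.2 = np.2.2 \/ p'.2 = np.2.2 + h np.1.+1 * b & ~ P np.1.+1 p'].
  case: np => n [x y] /=; set ha := h n.+1 * a; set hb := h n.+1 * b.
  have [p1|] := pselect (P n.+1 (x, y)); last by exists (x, y) => _; split; auto.
  have [p2|] := pselect (P n.+1 (x + ha, y)); last by exists (x + ha, y) => _; split; auto.
  have [p3|] := pselect (P n.+1 (x, y + hb)); last by exists (x, y + hb) => _; split; auto.
  have [p4|] := pselect (P n.+1 (x + ha, y + hb)); last first.
    by exists (x + ha, y + hb) => _; split; auto.
  exists (x, y) => nP; exfalso; apply: nP; rewrite /P /=.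
  have -> : x + h n * a = x + ha + ha by rewrite hS /ha; ring.
  have -> : y + h n * b = y + hb + hb by rewrite hS /hb; ring.
  rewrite (loop_quarters q x (x + ha) _ y (y + hb)).
  have -> : eta * h n ^+ 2 = eta * h n.+1 ^+ 2 + eta * h n.+1 ^+ 2
                           + eta * h n.+1 ^+ 2 + eta * h n.+1 ^+ 2 by rewrite hS; ring.
  by do 3!(rewrite (le_trans (ler_modcD _ _)) // lerD //).
have [f Hf] := choice step.
pose u := fix u n := if n is m.+1 then f (m, u m) else (x0, y0).
have nP n : ~ P n (u n).
  elim: n => [|n IH] /=; last by have [] := Hf (n, u n) IH.
  rewrite /P /h expr0 !mul1r /= expr1n mulr1 /a /b !subrKC /eta.
  by move=> le; lra.
have U n := Hf (n, u n) (nP n).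
have [c Hc] : exists c, forall n, (u n).1 <= c <= (u n).1 + h n * a.
  apply: nested_point => n /=; last by rewrite mulr_ge0 // ltW.
    have [+ _ _] := U n => /= -[] ->; first by [].
    by rewrite lerDl mulr_ge0 // ltW.
  have := mulr_ge0 (ltW (h0 n.+1)) a0.
  have [+ _ _] := U n => /= -[] ->; rewrite (hS n); lra.
have [d Hd] : exists d, forall n, (u n).2 <= d <= (u n).2 + h n * b.
  apply: nested_point => n /=; last by rewrite mulr_ge0 // ltW.
    have [_ + _] := U n => /= -[] ->; first by [].
    by rewrite lerDl mulr_ge0 // ltW.
  have := mulr_ge0 (ltW (h0 n.+1)) b0.
  have [_ + _] := U n => /= -[] ->; rewrite (hS n); lra.
have inbox n : [/\ x0 <= (u n).1, (u n).1 + h n * a <= x1,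
                   y0 <= (u n).2 & (u n).2 + h n * b <= y1].
  elim: n => [|n [i1 i2 i3 i4]] /=; first by rewrite /h expr0 !mul1r /a /b; split; lra.
  have ha := mulr_ge0 (ltW (h0 n.+1)) a0.
  have hb := mulr_ge0 (ltW (h0 n.+1)) b0.
  rewrite (hS n) mulrDl in i2; rewrite (hS n) mulrDl in i4.
  have [e1 e2 _] := U n; rewrite /= in e1 e2.
  by split; [case: e1 => -> | case: e1 => -> | case: e2 => -> | case: e2 => ->]; lra.
pose l := Complex c d.
have [D HD] : exists D, cderiv q l D.
  apply: dq => /=.
    by have := Hc 0%N; rewrite /h expr0 mul1r /= /a subrKC.
  by have := Hd 0%N; rewrite /h expr0 mul1r /= /b subrKC.
(* chosen so that 4 eps (a + b)^2 <= eta in the final estimate *)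
pose eps := eta / (4 * (1 + a + b) ^+ 2).
have ab0 : 0 < 1 + a + b by rewrite -addrA ltr_pwDl // addr_ge0.
have eps0 : 0 < eps by rewrite divr_gt0 // mulr_gt0 // exprn_gt0.
have [r r0 Hr] := HD eps eps0.
(* a rectangle small enough to lie in the disc where q is nearly affine *)
have [n hn] : exists n, h n * (1 + a + b) < r.
  have [n] := @ltr_add_invr R 0 (r / (1 + a + b)) (divr_gt0 r0 ab0).
  rewrite add0r => nr; exists n; rewrite -ltr_pdivlMr //; apply: le_lt_trans nr.
  rewrite /h exprVn lef_pV2 ?posrE ?exprn_gt0 ?ltr0n // -natrX ler_nat.
  by apply: ltn_expl.
apply: (nP n).
have [i1 i2 i3 i4] := inbox n.
have hna := mulr_ge0 (ltW (h0 n)) a0; have hnb := mulr_ge0 (ltW (h0 n)) b0.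
set X0 := (u n).1 in i1 i2; set Y0 := (u n).2 in i3 i4.
set X1 := X0 + h n * a in i2; set Y1 := Y0 + h n * b in i4.
have boxn : in_box X0 X1 Y0 Y1.
  by split; split; rewrite ?/X1 ?/Y1 ?lerDl //; rewrite -?/X1 -?/Y1; lra.
rewrite /P -/X0 -/Y0 -/X1 -/Y1.
pose lin (t : C) := q l + D * (t - l).
have clin t : ccont lin t.
  apply: ccontD; first exact: ccont_cst.
  apply: ccontM; first exact: ccont_cst.
  apply: ccontD; [apply: cderiv_cont; exact: cderiv_id | exact: ccont_cst].
have lin0 : loop lin X0 X1 Y0 Y1 = 0.
  apply: (@loop_antiderivative _ (fun t => q l * t + D * (2^-1 * ((t - l) * (t - l))))) => // t _.
  have did := cderivB_cst l t.
  have -> : lin t = q l * 1 + D * (2^-1 * (1 * (t - l) + (t - l) * 1)).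
    by rewrite /lin mul1r !mulr1; congr (_ + _ * _); field.
  apply: cderivD; apply: cderivZ; first exact: cderiv_id.
  by apply: cderivZ; apply: cderivM.
have -> : loop q X0 X1 Y0 Y1 = loop (fun t => q t + -1 * lin t) X0 X1 Y0 Y1.
  rewrite loopDZ ?lin0 ?mulr0 ?addr0 //; first exact: in_box_integrable.
  by apply: in_box_integrable => // t _.
have bd : forall t, on_boundary X0 X1 Y0 Y1 t ->
    modc (q t + -1 * lin t) <= eps * (h n * (1 + a + b)).
  move=> t [/andP[t1 t2] /andP[t3 t4] _].
  have tl : modc (t - l) <= h n * (1 + a + b).
    rewrite (le_trans (modc_le_ReIm _)) // !raddfB /=.
    have /andP[c1 c2] := Hc n; have /andP[d1 d2] := Hd n.
    have e1 : `|Re t - c| <= h n * a.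
      by rewrite ler_norml; apply/andP; split; move: t1 t2 c1 c2; rewrite /X1 -/X0; lra.
    have e2 : `|Im t - d| <= h n * b.
      by rewrite ler_norml; apply/andP; split; move: t3 t4 d1 d2; rewrite /Y1 -/Y0; lra.
    by rewrite (le_trans (lerD e1 e2)) // -mulrDr ler_wpM2l ?(ltW (h0 n)) // -[1 + a + b]addrA lerDr.
  have := Hr _ (le_lt_trans tl hn); rewrite subrKC.
  have -> : q t - q l - D * (t - l) = q t + -1 * lin t by rewrite /lin; ring.
  by move=> le; rewrite (le_trans le) // ler_wpM2l // ltW.
rewrite (le_trans (loop_bound boxn _ bd)) //.
  apply: in_box_integrable => // t t2; apply: ccontD; first exact: cq.
  by apply: ccontM => //; exact: ccont_cst.
have -> : X1 - X0 + (Y1 - Y0) = h n * (a + b) by rewrite /X1 /Y1; ring.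
have -> : eta * h n ^+ 2 = 4 * (eps * (h n * (1 + a + b))) * (h n * (1 + a + b)).
  by rewrite /eps; field; rewrite gt_eqF.
apply: ler_wpM2l.
  by apply: mulr_ge0 => //; apply: mulr_ge0 (ltW eps0) (mulr_ge0 (ltW (h0 n)) (ltW ab0)).
by rewrite ler_wpM2l ?(ltW (h0 n)) // -[1 + a + b]addrA lerDr.
Qed.

(** Four rectangles that avoid z cut the square down to a small box about z, whose
    loop integral tends to 0 with the box, as q is bounded near z. *)
Lemma goursat_punctured (q : C -> C) (z : C) :
  `|Re z| < 1 / 2 -> `|Im z| < 1 / 2 ->
  (forall t, square2 t -> ccont q t) ->
  (forall t, square2 t -> t != z -> exists d, cderiv q t d) ->
  loop q (-1) 1 (-1) 1 = 0.
Proof.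
move=> zx zy cq dq; apply/eqP; rewrite -modc_eq0 eq_le modc_ge0 andbT.
have z2 : square2 z by split; lra.
have [r r0 Hr] := cq _ z2 1 ltr01.
pose B := 1 + modc (q z).
have B0 : 0 < B by rewrite ltr_pwDl // modc_ge0.
apply/ler_addgt0Pr => e e0; rewrite add0r.
pose d := Num.min (1 / 2) (Num.min (r / 4) (e / (16 * B))).
have d0 : 0 < d by rewrite !lt_min !divr_gt0 // mulr_gt0.
have d1 : d <= 1 / 2 by rewrite ge_min lexx.
have d2 : d <= r / 4 by rewrite !ge_min lexx orbT.
have d3 : d <= e / (16 * B) by rewrite !ge_min lexx !orbT.
move: (zx) (zy); rewrite !ltr_norml => /andP[zx1 zx2] /andP[zy1 zy2].
set x := Re z in zx zx1 zx2; set y := Im z in zy zy1 zy2.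
rewrite (loop_annulus q _ _ _ _ (x - d) (x + d) (y - d) (y + d)).
have box : in_box (x - d) (x + d) (y - d) (y + d) by split; split; lra.
have sq t : -1 <= Re t <= 1 -> -1 <= Im t <= 1 -> square2 t.
  by move=> /andP[? ?] /andP[? ?]; split; rewrite ltr_norml; apply/andP; split; lra.
have nez t : Re t <> x \/ Im t <> y -> t != z.
  by move=> H; apply/eqP => tz; case: H => []; rewrite tz.
rewrite (@goursat q (-1) (x - d)) ?addr0 //; first last.
- move=> t /andP[t1 t2] /andP[t3 t4]; apply: dq; first by apply: sq; apply/andP; split; lra.
  by apply: nez; left; lra.
- by split; split; lra.
rewrite (@goursat q (x + d) 1) ?addr0 //; first last.
- move=> t /andP[t1 t2] /andP[t3 t4]; apply: dq; first by apply: sq; apply/andP; split; lra.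
  by apply: nez; left; lra.
- by split; split; lra.
rewrite (@goursat q _ _ (-1)) ?addr0 //; first last.
- move=> t /andP[t1 t2] /andP[t3 t4]; apply: dq; first by apply: sq; apply/andP; split; lra.
  by apply: nez; right; lra.
- by split; split; lra.
rewrite (@goursat q _ _ (y + d)) ?addr0 //; first last.
- move=> t /andP[t1 t2] /andP[t3 t4]; apply: dq; first by apply: sq; apply/andP; split; lra.
  by apply: nez; right; lra.
- by split; split; lra.
have bd t : on_boundary (x - d) (x + d) (y - d) (y + d) t -> modc (q t) <= B.
  move=> [/andP[t1 t2] /andP[t3 t4] _].
  have tz : modc (t - z) < r.
    rewrite (le_lt_trans (modc_le_ReIm _)) // !raddfB /= -/x -/y.
    have e1 : `|Re t - x| <= d by rewrite ler_norml; apply/andP; split; lra.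
    have e2 : `|Im t - y| <= d by rewrite ler_norml; apply/andP; split; lra.
    by lra.
  have := Hr _ tz; rewrite subrKC => le.
  by rewrite -[q t](subrK (q z)) (le_trans (ler_modcD _ _)) // lerD2r.
rewrite (le_trans (loop_bound box _ bd)) //; first exact: in_box_integrable.
move: d3; rewrite ler_pdivlMr ?mulr_gt0 //; lra.
Qed.

End GoursatTheorem.

(** * Cauchy's formula on a square *)

Section Cauchy.
Context {R : realType}.
Local Notation C := R[i].

Definition halfsq (z : C) : Prop := `|Re z| < 1 / 2 /\ `|Im z| < 1 / 2.

Definition cauchy_kernel (f : C -> C) m z (t : C) : C := f t * (t - z)^-1 ^+ m.

(** Up to a factor, the (m-1)-st derivative at z of Cauchy's integral of f. *)
Definition cauchy_loop f m z : C := loop (cauchy_kernel f m z) (-1) 1 (-1) 1.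

Definition on_lines (t : C) : Prop :=
  [\/ Re t = -1, Re t = 1, Im t = -1 | Im t = 1].

Lemma loop_ext (q q' : C -> C) : (forall t, on_lines t -> q t = q' t) ->
  loop q (-1) 1 (-1) 1 = loop q' (-1) 1 (-1) 1.
Proof.
move=> E; have S p w : (forall s : R, on_lines (p + w * s%:C)) ->
    side q p w (-1) 1 = side q' p w (-1) 1.
  by move=> L; rewrite /side; congr (_ * cint _ _ _); apply/funext => s; exact: E.
rewrite /loop; congr (_ - _ + (_ - _)); apply: S => s.
- by apply: Or43; rewrite hline_Im.
- by apply: Or44; rewrite hline_Im.
- by apply: Or42; rewrite vline_Re.
- by apply: Or41; rewrite vline_Re.
Qed.

(** Cauchy kernels are bounded on the contour, uniformly in z. *)
Lemma on_lines_far z t : halfsq z -> on_lines t -> 1 / 2 <= modc (t - z).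
Proof.
move=> [zx zy] L.
have X := modc_ge_Re (t - z); have Y := modc_ge_Im (t - z).
have N (a b : R) : `|a| < 1 / 2 -> b = -1 \/ b = 1 -> 1 / 2 <= `|b - a|.
  by move=> + [->|->]; rewrite ltr_norml lter_normr => /andP[? ?]; apply/orP; [right|left]; lra.
case: L => e; rewrite ?raddfB /= in X Y.
- by rewrite (le_trans _ X) // N //; left.
- by rewrite (le_trans _ X) // N //; right.
- by rewrite (le_trans _ Y) // N //; left.
- by rewrite (le_trans _ Y) // N //; right.
Qed.

Lemma on_lines_neq z t : halfsq z -> on_lines t -> t - z != 0.
Proof. by move=> hz /(on_lines_far hz) le; rewrite -modc_gt0; lra. Qed.

Lemma box1 : in_box (-1 : R) 1 (-1) 1. Proof. by split; split; lra. Qed.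

Lemma on_boundary_lines t : on_boundary (-1 : R) 1 (-1) 1 t -> on_lines t /\ square2 t.
Proof.
move=> [/andP[t1 t2] /andP[t3 t4] b]; split; last first.
  by split; rewrite ltr_norml; apply/andP; split; lra.
by case/orP: b => [/orP[/orP[]|]|] /eqP; [exact: Or41|exact: Or42|exact: Or43|exact: Or44].
Qed.

Lemma integrable_loop_lines (q : C -> C) :
  (forall t, on_lines t -> square2 t -> ccont q t) -> integrable_loop q (-1) 1 (-1) 1.
Proof.
move=> H; split; apply: integrable_side_cont => s s2; apply: H.
- by apply: Or43; rewrite hline_Im.
- by split; rewrite ?hline_Re ?hline_Im // normrN normr1; lra.
- by apply: Or44; rewrite hline_Im.
- by split; rewrite ?hline_Re ?hline_Im // normr1; lra.
- by apply: Or42; rewrite vline_Re.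
- by split; rewrite ?vline_Re ?vline_Im // normr1; lra.
- by apply: Or41; rewrite vline_Re.
- by split; rewrite ?vline_Re ?vline_Im // normrN normr1; lra.
Qed.

Lemma cderiv_inv_sub (z t : C) : t != z -> cderiv (fun t => (t - z)^-1) t (- (t - z) ^- 2).
Proof.
rewrite -subr_eq0 => tz.
have := @cderiv_comp_aff R (fun t => t^-1) (- z) 1 t (- (t - z) ^- 2).
rewrite mul1r [- z + t]addrC mul1r => /(_ (cderivV tz)).
by congr cderiv; apply/funext => u; rewrite mul1r addrC.
Qed.

Lemma ccontX (f : C -> C) t m : ccont f t -> ccont (fun t => f t ^+ m) t.
Proof.
move=> F; elim: m => [|m IH]; first exact: ccont_cst.
have -> : (fun t => f t ^+ m.+1) = (fun t => f t * f t ^+ m).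
  by apply/funext => u; rewrite exprS.
exact: ccontM.
Qed.

Lemma kernel_integrable f m z : halfsq z -> (forall t, square2 t -> ccont f t) ->
  integrable_loop (cauchy_kernel f m z) (-1) 1 (-1) 1.
Proof.
move=> hz cf; apply: integrable_loop_lines => t tl t2; apply: ccontM; first exact: cf.
apply: ccontX; apply: cderiv_cont; apply: cderiv_inv_sub.
by rewrite -subr_eq0; exact: on_lines_neq tl.
Qed.

Lemma cauchy_loop_bound f m z B : halfsq z -> (forall t, square2 t -> ccont f t) ->
  (forall t, square2 t -> modc (f t) <= B) ->
  modc (cauchy_loop f m z) <= 16 * 2 ^+ m * B.
Proof.
move=> hz cf bf.
have B0 : 0 <= B.
  by rewrite (le_trans (modc_ge0 (f 0))) // bf //; split; rewrite normr0; lra.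
have -> : 16 * 2 ^+ m * B = 4 * (B * 2 ^+ m) * ((1 - -1) + (1 - -1)) by ring.
apply: loop_bound; [exact: box1 | exact: kernel_integrable |].
move=> t /on_boundary_lines [tl t2]; rewrite modcM modcX modcV.
have far := on_lines_far hz tl.
rewrite ler_pM ?modc_ge0 ?exprn_ge0 ?invr_ge0 ?modc_ge0 ?bf //.
rewrite lerXn2r ?nnegrE ?invr_ge0 ?modc_ge0 //.
by rewrite -[leRHS]invrK lef_pV2 ?posrE ?invr_gt0 //; lra.
Qed.

Lemma integrable_loopDZ (f g : C -> C) c x0 x1 y0 y1 :
  integrable_loop f x0 x1 y0 y1 -> integrable_loop g x0 x1 y0 y1 ->
  integrable_loop (fun t => f t + c * g t) x0 x1 y0 y1.
Proof.
have add (F G : R -> C) : integrable_line F -> integrable_line G ->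
    integrable_line (fun x => F x + c * G x).
  move=> [F' HF] [G' HG]; exists (fun x => F' x + c * G' x) => x x2.
  by apply: rcderivD; [apply: HF | apply: rcderivZ; apply: HG].
move=> [a1 a2 a3 a4] [b1 b2 b3 b4].
split; [exact: (add _ _ a1 b1) | exact: (add _ _ a2 b2) | exact: (add _ _ a3 b3)
      | exact: (add _ _ a4 b4)].
Qed.

(** Differentiation under the integral sign: the kernel is expanded to second order
    in h, with a remainder bounded on the contour. Two derivatives of Cauchy's
    integral suffice to see that the derivative of f is again differentiable. *)
Lemma cauchy_loop_deriv f m z B : (m <= 1)%N -> halfsq z ->
  (forall t, square2 t -> ccont f t) -> (forall t, square2 t -> modc (f t) <= B) ->
  cderiv (cauchy_loop f m.+1) z (m.+1%:R * cauchy_loop f m.+2 z).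
Proof.
move=> m1 hz cf bf.
have [r [r0 r1 hr]] : exists r : R, [/\ 0 < r, r <= 1 / 4 &
    forall h, modc h < r -> halfsq (z + h)].
  case: hz => zx zy.
  pose r := Num.min (1 / 4) (Num.min (1 / 2 - `|Re z|) (1 / 2 - `|Im z|)).
  exists r; split; first by rewrite !lt_min; apply/and3P; split; lra.
    by rewrite ge_min lexx.
  move=> h; rewrite !lt_min => /and3P[_ h1 h2].
  have X := modc_ge_Re h; have Y := modc_ge_Im h.
  by split; rewrite raddfD (le_lt_trans (ler_normD _ _)) //; lra.
have B0 : 0 <= B.
  by rewrite (le_trans (modc_ge0 (f 0))) // bf //; split; rewrite normr0; lra.
apply: (@cderiv_quadratic _ _ _ _ (4 * (B * 128) * 4) r) => // h hlt.
have zh := hr _ hlt.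
(* the second-order remainder of the kernel *)
pose E t := cauchy_kernel f m.+1 (z + h) t + (-1) * cauchy_kernel f m.+1 z t
            + (- (m.+1%:R * h)) * cauchy_kernel f m.+2 z t.
have I1 := kernel_integrable m.+1 zh cf.
have I2 := kernel_integrable m.+1 hz cf.
have I3 := kernel_integrable m.+2 hz cf.
have cE t : on_lines t -> square2 t -> ccont E t.
  move=> tl t2.
  have ck k w : halfsq w -> ccont (cauchy_kernel f k w) t.
    move=> hw; apply: ccontM; first exact: cf.
    apply: ccontX; apply: cderiv_cont; apply: cderiv_inv_sub.
    by rewrite -subr_eq0; exact: on_lines_neq tl.
  apply: ccontD; first (apply: ccontD; first exact: ck).
    by apply: ccontM; [exact: ccont_cst | exact: ck].
  by apply: ccontM; [exact: ccont_cst | exact: ck].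
have I12 : integrable_loop (fun t => cauchy_kernel f m.+1 (z + h) t
    + (-1) * cauchy_kernel f m.+1 z t) (-1) 1 (-1) 1.
  exact: integrable_loopDZ.
have -> : cauchy_loop f m.+1 (z + h) - cauchy_loop f m.+1 z - m.+1%:R * cauchy_loop f m.+2 z * h
  = loop E (-1) 1 (-1) 1.
  rewrite /E (loopDZ (- (m.+1%:R * h)) box1 I12 I3) (loopDZ (-1) box1 I1 I2).
  by rewrite mulN1r mulNr mulrAC.
have -> : 4 * (B * 128) * 4 * modc h ^+ 2
    = 4 * (B * (128 * modc h ^+ 2)) * ((1 - -1) + (1 - -1)) by ring.
apply: loop_bound; [exact: box1 | exact: integrable_loop_lines |].
move=> t /on_boundary_lines [tl t2].
have far := on_lines_far hz tl.
have u0 := on_lines_neq hz tl.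
have v0 := on_lines_neq zh tl.
rewrite /E /cauchy_kernel.
set u := t - z in far u0 *.
have vE : t - (z + h) = u - h by rewrite /u; ring.
rewrite vE in v0 *.
have far2 : 1 / 4 <= modc (u - h).
  have := ler_modcD (u - h) h; rewrite subrK => le.
  lra.
have iu : modc u^-1 <= 2.
  by rewrite modcV -[leRHS]invrK lef_pV2 ?posrE ?invr_gt0 //; lra.
have iv : modc (u - h)^-1 <= 4.
  by rewrite modcV -[leRHS]invrK lef_pV2 ?posrE ?invr_gt0 //; lra.
have -> : f t * (u - h)^-1 ^+ m.+1 + -1 * (f t * u^-1 ^+ m.+1)
   + - (m.+1%:R * h) * (f t * u^-1 ^+ m.+2)
   = f t * (((u - h)^-1 ^+ m.+1 - u^-1 ^+ m.+1) - m.+1%:R * h * u^-1 ^+ m.+2) by ring.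
rewrite modcM ler_pM ?modc_ge0 ?bf //.
have p1 := modc_ge0 u^-1; have p2 := modc_ge0 (u - h)^-1.
case: m m1 {E cE I1 I2 I3 I12} => [|[|//]] _.
  have -> : (u - h)^-1 ^+ 1 - u^-1 ^+ 1 - 1 * h * u^-1 ^+ 2
     = h ^+ 2 * (u^-1 ^+ 2 * (u - h)^-1) by field; rewrite u0 v0.
  rewrite modcM modcX mulrC ler_wpM2r ?exprn_ge0 ?modc_ge0 //.
  rewrite modcM modcX (@le_trans _ _ (2 ^+ 2 * 4)) ?ler_pM ?exprn_ge0 ?lerXn2r ?nnegrE //.
  by lra.
have -> : (u - h)^-1 ^+ 2 - u^-1 ^+ 2 - 2 * h * u^-1 ^+ 3
   = h ^+ 2 * (u^-1 ^+ 2 * (u - h)^-1 ^+ 2 + 2 * (u^-1 ^+ 3 * (u - h)^-1)).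
  by field; rewrite u0 v0.
rewrite modcM modcX mulrC ler_wpM2r ?exprn_ge0 ?modc_ge0 //.
rewrite (le_trans (ler_modcD _ _)) // [modc (2 * _)]modcM.
rewrite [modc (u^-1 ^+ 2 * _)]modcM [modc (u^-1 ^+ 3 * _)]modcM !modcX.
have -> : modc (2 : C) = 2 by rewrite -[2](@rmorph_nat _ _ (real_complex R)) modcR ger0_norm.
rewrite (@le_trans _ _ (2 ^+ 2 * 4 ^+ 2 + 2 * (2 ^+ 3 * 4))) //; last by lra.
have iuX k : 0 <= modc u^-1 ^+ k <= 2 ^+ k.
  by rewrite exprn_ge0 // lerXn2r ?nnegrE.
have ivX k : 0 <= modc (u - h)^-1 ^+ k <= 4 ^+ k.
  by rewrite exprn_ge0 // lerXn2r ?nnegrE.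
have /andP[u2 u2'] := iuX 2%N; have /andP[u3 u3'] := iuX 3%N; have /andP[v2 v2'] := ivX 2%N.
apply: lerD; first exact: ler_pM.
by rewrite ler_pM2l //; exact: ler_pM.
Qed.

(** Goursat's theorem for the difference quotient (f t - f z) / (t - z), which extends
    continuously over t = z. *)
Lemma cauchy_formula f z : halfsq z ->
  (forall t, square2 t -> exists d, cderiv f t d) ->
  cauchy_loop f 1 z = f z * cauchy_loop (fun=> 1) 1 z.
Proof.
move=> hz df; have [zx zy] := hz.
have z2 : square2 z by split; lra.
have cf t : square2 t -> ccont f t by move=> /df [d]; exact: cderiv_cont.
have [d Hd] := df _ z2.
pose q t := if t == z then d else (f t - f z) * (t - z)^-1.
have q0 : loop q (-1) 1 (-1) 1 = 0.
  apply: (@goursat_punctured _ _ z) => // t t2.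
    have [->|tz] := eqVneq t z.
      move=> e e0; have [r r0 Hr] := Hd e e0; exists r => // h hr.
      have [->|h0] := eqVneq h 0; first by rewrite addr0 subrr modc0 ltW.
      rewrite /q eqxx -subr_eq0 [z + h]addrC addrK (negbTE h0).
      have := Hr h hr; rewrite [z + h]addrC => le.
      rewrite -(ler_pM2r (x := modc h)) ?modc_gt0 // -modcM mulrBl.
      by rewrite -mulrA mulVf // mulr1.
    have r0 : 0 < modc (t - z) by rewrite modc_gt0 subr_eq0.
    apply: (@ccont_eqnear _ (fun t => (f t - f z) * (t - z)^-1) _ _ _ r0).
      move=> h hr; rewrite /q ifF //; apply: contraTF hr => /eqP E.
      by rewrite -leNgt -E opprD addrA subrr sub0r modcN.
    apply: ccontM; first by apply: ccontD; [exact: cf | exact: ccont_cst].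
    by apply: cderiv_cont; exact: cderiv_inv_sub.
  move=> tz; have [d' Hd'] := df _ t2.
  have r0 : 0 < modc (t - z) by rewrite modc_gt0 subr_eq0.
  have D := cderivM (cderivD Hd' (cderiv_cst (- f z) t)) (cderiv_inv_sub tz).
  eexists; apply: (@cderiv_eqnear _ (fun t => (f t - f z) * (t - z)^-1) _ _ _ _ r0); last exact: D.
  move=> h hr; rewrite /q ifF //; apply: contraTF hr => /eqP E.
  by rewrite -leNgt -E opprD addrA subrr sub0r modcN.
have := q0; rewrite (@loop_ext _ (fun t => cauchy_kernel f 1 z t
      + (- f z) * cauchy_kernel (fun=> 1) 1 z t)).
  rewrite loopDZ ?mulNr; first by move/eqP; rewrite subr_eq0 => /eqP.
  - exact: box1.
  - exact: kernel_integrable.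
  - by apply: kernel_integrable => // t _; exact: ccont_cst.
move=> t tl; rewrite /q ifF; last first.
  by apply/negbTE; rewrite -subr_eq0; exact: on_lines_neq tl.
by rewrite /cauchy_kernel !expr1 mul1r mulrBl mulNr.
Qed.

(** Its value is 2 pi i. *)
Definition winding : C := cauchy_loop (fun=> 1) 1 0.

(** The derivative in z is the loop integral of (t - z)^-2, which has an
    antiderivative on the contour. *)
Lemma winding_const z : halfsq z -> cauchy_loop (fun=> 1) 1 z = winding.
Proof.
move=> [zx zy].
have c1 t : square2 t -> ccont (fun=> 1 : C) t by move=> _; exact: ccont_cst.
have b1 (t : C) : square2 t -> modc ((fun=> 1 : C) t) <= 1 by rewrite modc1.
have D w : halfsq w -> cderiv (cauchy_loop (fun=> 1) 1) w 0.
  move=> hw; have := @cauchy_loop_deriv (fun=> 1) 0 w 1 isT hw c1 b1.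
  suff -> : cauchy_loop (fun=> 1) 2 w = 0 by rewrite mulr0.
  apply: (@loop_antiderivative _ (fun t => -1 * (t - w)^-1)); first exact: box1.
  move=> t tl; have -> : cauchy_kernel (fun=> 1) 2 w t = -1 * - (t - w) ^- 2.
    by rewrite /cauchy_kernel mul1r exprVn mulN1r opprK.
  apply: cderivZ; apply: cderiv_inv_sub.
  rewrite -subr_eq0; apply: on_lines_neq => //.
  by case: tl => [|[|[]]] e; [exact: Or41|exact: Or42|exact: Or43|exact: Or44].
apply/eqP; rewrite -subr_eq0 -modc_eq0 eq_le modc_ge0 andbT.
pose F (s : R) := cauchy_loop (fun=> 1) 1 (0 + z * s%:C).
have E : cauchy_loop (fun=> 1) 1 z - winding = F 1 - F 0.
  by rewrite /F rmorph1 rmorph0 mulr1 mulr0 !add0r.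
have B : (0 : R) = 2 * 0 * (1 - 0) by rewrite mulr0 mul0r.
rewrite E [leRHS]B.
apply: (@rcderiv_bound _ F (fun=> 0)) => // [x /andP[x0 x1]|x _]; last by rewrite modc0.
rewrite -[X in rcderiv _ _ X](mulr0 z).
apply: cderiv_line; apply: D.
have nx : `|x| <= 1 by rewrite ger0_norm.
rewrite add0r; split.
  have -> : Re (z * x%:C) = Re z * x by rewrite Re_mulc /=; ring.
  by rewrite normrM (le_lt_trans _ zx) // ler_piMr.
have -> : Im (z * x%:C) = Im z * x by rewrite Im_mulc /=; ring.
by rewrite normrM (le_lt_trans _ zy) // ler_piMr.
Qed.

(** The integrand lies between 1/2 and 1 on [-1, 1]; the antiderivative is compared
    with the line of slope 3/4. *)
Lemma Im_cint_ge1 (f : R -> C) w : integrable_line f ->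
  (forall x, `|x| <= 1 -> Im (w * f x) = (1 + x ^+ 2)^-1) ->
  1 <= Im (w * cint f (-1) 1).
Proof.
move=> If fE.
pose F x := Im (w * prim f x) - 3 / 4 * x.
have D (x : R) : -1 <= x <= 1 -> is_derive x 1 F ((1 + x ^+ 2)^-1 - 3 / 4).
  move=> /andP[x1 x2].
  have xn : `|x| <= 1 by rewrite ler_norml x1.
  have [_ D1] : rcderiv (fun s => w * prim f s) x (w * f x).
    by apply: rcderivZ; apply: prim_primitive => //; lra.
  rewrite -fE //.
  have : is_derive x 1 (fun s : R => 3 / 4 *: s) (3 / 4 *: 1).
    exact: is_deriveZ.
  by rewrite [_ *: 1]mulr1 => D2; exact: is_deriveB.
have : `|F 1 - F (-1)| <= 1 / 4 * (1 - -1).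
  apply: (mean_value_ineq _ D); first by lra.
  move=> x /andP[x1 x2].
  have p1 : 0 <= 1 - x by rewrite subr_ge0.
  have p2 : 0 <= 1 + x by lra.
  have /andP[q1 q2] : 0 <= x ^+ 2 <= 1.
    by rewrite sqr_ge0 -subr_ge0 -{1}(expr1n _ 2) subr_sqr mulr_ge0.
  have u : (1 + x ^+ 2)^-1 <= 1.
    by rewrite invf_le1; lra.
  have l : 1 / 2 <= (1 + x ^+ 2)^-1.
    by rewrite -[1 / 2]invrK lef_pV2 ?posrE ?invr_gt0; lra.
  by rewrite ler_norml; apply/andP; split; lra.
have -> : Im (w * cint f (-1) 1) = Im (w * prim f 1) - Im (w * prim f (-1)).
  by rewrite /cint mulrBr raddfB.
by rewrite ler_norml => /andP[+ _]; rewrite /F; lra.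
Qed.

(** On each side of the square the imaginary part of dt/t is ds/(1 + s^2). *)
Lemma winding_neq0 : winding != 0.
Proof.
have h0 : halfsq 0 by split; rewrite normr0; lra.
have [|I1 I2 I3 I4] := @kernel_integrable (fun=> 1) 1 0 h0.
  by move=> t _; exact: ccont_cst.
suff H : 4 <= Im winding.
  by apply/eqP => E; move: H; rewrite E /= {E}; lra.
have inv (a b : R) : (Complex a b)^-1 = Complex (a / (a ^+ 2 + b ^+ 2)) (- (b / (a ^+ 2 + b ^+ 2))).
  by [].
have pt (p w t : C) : p + w * t = Complex (Re (p + w * t)) (Im (p + w * t)).
  by case: (p + w * t).
have bot : 1 <= Im (side (cauchy_kernel (fun=> 1) 1 0) ('i * (-1)%:C) 1 (-1) 1).
  apply: Im_cint_ge1 => // x _.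
  rewrite /cauchy_kernel mul1r subr0 expr1 pt hline_Re hline_Im inv mul1r /=.
  by rewrite mulN1r opprK sqrrN expr1n addrC.
have top : 1 <= Im (- side (cauchy_kernel (fun=> 1) 1 0) ('i * 1%:C) 1 (-1) 1).
  rewrite /side mul1r -[X in Im X]mulN1r; apply: Im_cint_ge1 => // x _.
  rewrite /cauchy_kernel mul1r subr0 expr1 pt hline_Re hline_Im inv mulN1r /=.
  by rewrite mul1r opprK expr1n addrC.
have right : 1 <= Im (side (cauchy_kernel (fun=> 1) 1 0) 1%:C 'i (-1) 1).
  apply: Im_cint_ge1 => // x _.
  rewrite /cauchy_kernel mul1r subr0 expr1 pt vline_Re vline_Im inv /=.
  by rewrite mul0r add0r !mul1r expr1n.
have left : 1 <= Im (- side (cauchy_kernel (fun=> 1) 1 0) (-1)%:C 'i (-1) 1).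
  rewrite /side -mulNr; apply: Im_cint_ge1 => // x _.
  rewrite /cauchy_kernel mul1r subr0 expr1 pt vline_Re vline_Im inv /=.
  by rewrite oppr0 mul0r add0r sqrrN expr1n mulrA mulrNN !mul1r.
rewrite /winding /cauchy_loop /loop.
by move: bot top right left; rewrite !raddfD !raddfN /=; lra.
Qed.


End Cauchy.

(** * Holomorphic germs of one variable *)

Section Holomorphy.
Context {R : realType}.
Local Notation C := R[i].
Implicit Types (f g F G : C -> C) (t z : C).

(** The constant K does not depend on f, since it only involves the contour and the
    winding integral. *)
Theorem holo_regular : exists2 K : R, 0 < K & forall (f : C -> C) B,
  (forall t, square2 t -> exists d, cderiv f t d) ->
  (forall t, square2 t -> modc (f t) <= B) ->
  exists f1 f2, forall z, halfsq z ->
    [/\ cderiv f z (f1 z), cderiv f1 z (f2 z) & modc (f1 z) <= K * B].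
Proof.
have W0 := @winding_neq0 R.
exists (64 / modc (@winding R)); first by rewrite divr_gt0 // modc_gt0.
move=> f B df bf.
have cf t : square2 t -> ccont f t by move=> /df [d]; exact: cderiv_cont.
exists (fun z => winding^-1 * (1%:R * cauchy_loop f 2 z)).
exists (fun z => winding^-1 * (1%:R * (2%:R * cauchy_loop f 3 z))).
move=> z hz; split.
- have [zx zy] := hz.
  have r0 : 0 < Num.min (1 / 2 - `|Re z|) (1 / 2 - `|Im z|) by rewrite lt_min; apply/andP; split; lra.
  apply: (@cderiv_eqnear _ (fun z => winding^-1 * cauchy_loop f 1 z) _ _ _ _ r0).
    move=> h; rewrite lt_min => /andP[h1 h2].
    have X := modc_ge_Re h; have Y := modc_ge_Im h.
    have hzh : halfsq (z + h).
      by split; rewrite raddfD (le_lt_trans (ler_normD _ _)) //; lra.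
    by rewrite cauchy_formula // winding_const // mulrC mulfK.
  by apply: cderivZ; exact: cauchy_loop_deriv bf.
- by apply: cderivZ; apply: cderivZ; exact: cauchy_loop_deriv bf.
rewrite mul1r modcM modcV mulrC mulrAC ler_wpM2r ?invr_ge0 ?modc_ge0 //.
have -> : 64 * B = 16 * 2 ^+ 2 * B by ring.
exact: cauchy_loop_bound.
Qed.

Definition near0 (P : C -> Prop) : Prop :=
  exists2 r : R, 0 < r & forall t, modc t < r -> P t.

Lemma near0_and P Q : near0 P -> near0 Q -> near0 (fun t => P t /\ Q t).
Proof.
move=> [r r0 HP] [s s0 HQ]; exists (Num.min r s); first by rewrite lt_min r0.
by move=> t; rewrite lt_min => /andP[/HP ? /HQ ?].
Qed.

Lemma near0_imp (P Q : C -> Prop) : (forall t, P t -> Q t) -> near0 P -> near0 Q.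
Proof. by move=> I [r r0 H]; exists r => // t /H /I. Qed.

Lemma near0_here P : near0 P -> P 0.
Proof. by move=> [r r0 H]; apply: H; rewrite modc0. Qed.

Lemma near0_near P : near0 P -> near0 (fun t => exists2 r : R, 0 < r &
  forall h, modc h < r -> P (t + h)).
Proof.
move=> [r r0 H]; exists r => // t tr; exists (r - modc t); first by rewrite subr_gt0.
by move=> h hr; apply: H; rewrite (le_lt_trans (ler_modcD _ _)) // addrC -ltrBrDr.
Qed.

Definition hol (f : C -> C) : Prop := near0 (fun t => exists d, cderiv f t d).

(** A total derivative operator, so that iterated derivatives can be written with
    [iter]; it is meaningful where f is differentiable. *)
Definition cderive (f : C -> C) (t : C) : C := xget 0 [set d | cderiv f t d].

Lemma cd_eq f t d : cderiv f t d -> cderive f t = d.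
Proof.
by move=> D; rewrite /cderive; case: xgetP => [d' _ D'|/(_ d)//]; exact: cderiv_uniq D' D.
Qed.

Lemma cderiv_cd f t : (exists d, cderiv f t d) -> cderiv f t (cderive f t).
Proof. by move=> [d D]; rewrite (cd_eq D). Qed.

Lemma modc_natR (a : R) : 0 <= a -> modc a%:C = a.
Proof. by move=> a0; rewrite modcR ger0_norm. Qed.

Lemma square2_modc t : square2 t -> modc t < 4.
Proof. by move=> [x y]; rewrite (le_lt_trans (modc_le_ReIm _)) //; lra. Qed.

Lemma modc_halfsq t : modc t < 1 / 2 -> halfsq t.
Proof.
move=> h; split; [apply: le_lt_trans (modc_ge_Re _) h | apply: le_lt_trans (modc_ge_Im _) h].
Qed.

(** The unit-scale statement, transported to a disc of radius rho by rescaling. *)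
Theorem cauchy_estimate : exists2 K : R, 0 < K & forall (f : C -> C) B rho, 0 < rho ->
  (forall t, modc t < rho -> exists d, cderiv f t d) ->
  (forall t, modc t < rho -> modc (f t) <= B) ->
  exists f1 f2, forall z, modc z < rho / 8 ->
    [/\ cderiv f z (f1 z), cderiv f1 z (f2 z) & modc (f1 z) <= K * B / rho].
Proof.
have [K K0 HK] := holo_regular; exists (4 * K); first by rewrite mulr_gt0.
move=> f B rho rho0 df bf.
pose c : R := rho / 4; have c0 : 0 < c by rewrite divr_gt0.
have cC : c%:C != 0 by rewrite -modc_gt0 modc_natR // ltW.
have inn t : square2 t -> modc (c%:C * t) < rho.
  move=> /square2_modc t4; rewrite modcM modc_natR ?(ltW c0) // mulrC -ltr_pdivlMr //.
  by rewrite /c (lt_le_trans t4) // invf_div mulrA mulrAC divff ?mul1r ?gt_eqF.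
have [|| g1 [g2 Hg]] := HK (fun t => f (0 + c%:C * t)) B.
- move=> t t2; have [|d D] := df (0 + c%:C * t); first by rewrite add0r inn.
  by exists (c%:C * d); exact: cderiv_comp_aff.
- by move=> t t2; rewrite add0r; apply: bf; exact: inn.
exists (fun z => c%:C^-1 * g1 (0 + c%:C^-1 * z)).
exists (fun z => c%:C^-1 * (c%:C^-1 * g2 (0 + c%:C^-1 * z))).
move=> z hz.
have hz' : halfsq (0 + c%:C^-1 * z).
  apply: modc_halfsq; rewrite add0r modcM modcV modc_natR ?(ltW c0) // mulrC ltr_pdivrMr //.
  by rewrite /c (lt_le_trans hz) //; lra.
have [D1 D2 b1] := Hg _ hz'.
split.
- have := cderiv_comp_aff D1; congr cderiv; apply/funext => t.
  by rewrite !add0r mulrA divff // mul1r.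
- by apply: cderivZ; exact: cderiv_comp_aff D2.
rewrite modcM modcV modc_natR ?(ltW c0) // (le_trans (ler_wpM2l _ b1)) ?invr_ge0 ?(ltW c0) //.
by rewrite le_eqVlt /c; apply/orP; left; apply/eqP; field; rewrite gt_eqF.
Qed.

Lemma cd_near f g : near0 (fun t => cderiv f t (g t)) -> near0 (fun t => cderive f t = g t).
Proof. by apply: near0_imp => t; exact: cd_eq. Qed.

(** Near 0 the derivative of f is a Cauchy integral, hence differentiable. *)
Lemma hol_cd f : hol f -> hol (cderive f) /\ near0 (fun t => cderiv f t (cderive f t)).
Proof.
move=> hf; have Dcd : near0 (fun t => cderiv f t (cderive f t)).
  by move: hf; apply: near0_imp => t; exact: cderiv_cd.
split=> //.
have [r r0 df] := hf; have [K K0 HK] := cauchy_estimate.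
have [d0 D0] := near0_here hf; have [s s0 Hs] := cderiv_cont D0 ltr01.
pose rho := Num.min r s; have rho0 : 0 < rho by rewrite lt_min r0.
have [|| f1 [f2 H]] := HK f (1 + modc (f 0)) rho rho0.
- by move=> t; rewrite lt_min => /andP[tr _]; exact: df.
- move=> t; rewrite lt_min => /andP[_ ts]; have := Hs _ ts; rewrite add0r => le.
  by rewrite -[f t](subrK (f 0)) (le_trans (ler_modcD _ _)) // lerD2r.
have n1 : near0 (fun t => [/\ cderiv f t (f1 t), cderiv f1 t (f2 t) &
    modc (f1 t) <= K * (1 + modc (f 0)) / rho]).
  by exists (rho / 8) => //; rewrite divr_gt0.
have n2 : near0 (fun t => cderive f t = f1 t) by apply: cd_near; apply: near0_imp n1 => t [].
apply: near0_imp (near0_and n1 (near0_near n2)) => t [[_ D2 _] [u u0 E]].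
by exists (f2 t); apply: (cderiv_eqnear u0 _ D2) => h /E.
Qed.

Lemma hol_iter f k : hol f -> hol (iter k cderive f).
Proof. by move=> hf; elim: k => [//|k IH] /=; have [] := hol_cd IH. Qed.

Lemma cderiv_horner (p : {poly C}) t : cderiv (horner p) t p^`().[t].
Proof.
elim/poly_ind: p => [|p c IH].
  have -> : horner (0 : {poly C}) = fun=> 0 by apply/funext => u; rewrite horner0.
  by rewrite deriv0 horner0; exact: cderiv_cst.
have -> : horner (p * 'X + c%:P) = fun u => p.[u] * u + c.
  by apply/funext => u; rewrite hornerMXaddC.
have -> : (p * 'X + c%:P)^`().[t] = p^`().[t] * t + p.[t] * 1 + 0.
  by rewrite derivD derivM derivX derivC hornerD hornerD !hornerM hornerX hornerC horner0.
by apply: cderivD (cderiv_cst _ _); exact: cderivM IH (cderiv_id t).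
Qed.

(** The mean value inequality on the segment from 0 to t, applied to real and
    imaginary parts, whence the factor 2. *)
Lemma cderiv_mean_value F G (r B : R) t : modc t < r ->
  (forall u, modc u < r -> cderiv F u (G u)) ->
  (forall u, modc u <= modc t -> modc (G u) <= B) ->
  modc (F t - F 0) <= 2 * B * modc t.
Proof.
move=> tr D bG.
have H s : 0 <= s <= 1 -> modc (t * s%:C) <= modc t.
  by move=> /andP[s0 s1]; rewrite modcM modc_natR // ler_piMr ?modc_ge0.
have := @rcderiv_bound R (fun s : R => F (0 + t * s%:C)) (fun s => t * G (t * s%:C))
  0 1 (modc t * B) ler01.
rewrite rmorph1 rmorph0 mulr1 mulr0 !add0r subr0 mulr1 => H'.
rewrite -mulrA [B * _]mulrC; apply: H' => s s01.
  rewrite -[t * s%:C]add0r; apply: cderiv_line; apply: D.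
  by rewrite add0r (le_lt_trans (H _ s01)).
by rewrite modcM ler_wpM2l ?modc_ge0 // bG // H.
Qed.

Definition bigOC m (F : C -> C) : Prop :=
  exists B : R, near0 (fun t => modc (F t) <= B * modc t ^+ m).

Lemma bigO_antideriv m F G : near0 (fun t => cderiv F t (G t)) -> F 0 = 0 ->
  bigOC m G -> bigOC m.+1 F.
Proof.
move=> D F0 [B BG]; exists (2 * `|B|); have [r r0 H] := near0_and D BG.
exists r => // t tr; have := @cderiv_mean_value F G r (`|B| * modc t ^+ m) t tr.
rewrite F0 subr0 exprSr !mulrA; apply; first by move=> u /H [].
move=> u ut; have [_ le] := H _ (le_lt_trans ut tr).
rewrite (le_trans le) // (le_trans (ler_wpM2r _ (ler_norm B))) ?exprn_ge0 ?modc_ge0 //.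
by rewrite ler_wpM2l // lerXn2r ?nnegrE ?modc_ge0.
Qed.

Definition tpoly (f : C -> C) m : {poly C} := \poly_(j < m) (iter j cderive f 0 / j`!%:R).

(** The expansion of f is the antiderivative of the expansion of its derivative. *)
Lemma hol_taylor f m : hol f -> bigOC m (fun t => f t - (tpoly f m).[t]).
Proof.
elim: m f => [|m IH] f hf.
  have [d0 D0] := near0_here hf; have [s s0 Hs] := cderiv_cont D0 ltr01.
  exists (1 + modc (f 0)); exists s => // t ts.
  have -> : tpoly f 0 = 0 by apply/polyP => i; rewrite coef_poly coef0.
  rewrite horner0 subr0 expr0 mulr1; have := Hs _ ts; rewrite add0r => le.
  by rewrite -[f t](subrK (f 0)) (le_trans (ler_modcD _ _)) // lerD2r.
have [hcd Dcd] := hol_cd hf.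
have E : deriv (tpoly f m.+1) = tpoly (cderive f) m.
  apply/polyP => i; rewrite coef_deriv !coef_poly ltnS; case: ifP => _; last by rewrite mul0rn.
  rewrite -iterSr factS natrM -mulr_natr; field.
  by rewrite !pnatr_eq0 -lt0n fact_gt0 /= addrC natr1 pnatr_eq0.
apply: (@bigO_antideriv _ _ (fun t => cderive f t - (tpoly (cderive f) m).[t])) (IH _ hcd).
  apply: near0_imp Dcd => t D; rewrite -E.
  rewrite -mulN1r; have -> : (fun u => f u - (tpoly f m.+1).[u]) = (fun u => f u + -1 * (tpoly f m.+1).[u]).
    by apply/funext => u; rewrite mulN1r.
  by apply: cderivD => //; apply: cderivZ; exact: cderiv_horner.
by rewrite horner_coef0 coef_poly /= fact0 divr1 subrr.
Qed.

End Holomorphy.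

(** * Vector-valued germs *)

Section VectorGerms.
Context {R : realType}.
Local Notation C := R[i].
Implicit Types (t : C).

Lemma normr_lt_modc (t : C) (r : R) : (`|t| < r%:C) = (modc t < r).
Proof. by rewrite normE ltcR. Qed.

Lemma gt0_complexP (e : C) : 0 < e -> exists2 r : R, 0 < r & e = r%:C.
Proof.
case: e => a b; rewrite ltcE /= => /andP[/eqP b0 a0]; exists a => //.
by rewrite b0.
Qed.

Lemma nbhs0_near0 (P : set C) : nbhs (0 : C) P <-> near0 P.
Proof.
split=> [/nbhs_ballP [e /= /gt0_complexP [r r0 ->] H] | [r r0 H]].
  by exists r => // t tr; apply: H; rewrite -ball_normE /ball_ /= sub0r normrN normr_lt_modc.
apply/nbhs_ballP; exists r%:C => /=; first by rewrite (ltcR 0).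
by move=> t; rewrite -ball_normE /ball_ /= sub0r normrN normr_lt_modc; exact: H.
Qed.

Section RowVectors.
Context (n : nat).
Local Notation Cn := 'rV[C]_n.

Definition vlt (x : Cn) (r : R) : Prop := forall j, modc (x 0 j) < r.

Definition nearV (P : Cn -> Prop) : Prop := exists2 r : R, 0 < r & forall x, vlt x r -> P x.

Lemma vnorm_lt (x : Cn) (r : R) : 0 < r -> `|x| < r%:C <-> vlt x r.
Proof.
move=> r0; have E : `|x| < r%:C <-> ball (0 : Cn) r%:C x.
  by rewrite -ball_normE /ball_ /= sub0r normrN.
rewrite E; split=> [[_ H] j | H].
  by have := H 0 j; rewrite -ball_normE /ball_ /= mxE sub0r normrN normr_lt_modc.
split=> [|i j]; first by rewrite (ltcR 0).
by rewrite -ball_normE /ball_ /= mxE sub0r normrN normr_lt_modc (ord1 i).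
Qed.

Lemma nbhs0_nearV (P : set Cn) : nbhs (0 : Cn) P <-> nearV P.
Proof.
split=> [/nbhs_ballP [e /= /gt0_complexP [r r0 ->] H] | [r r0 H]].
  exists r => // x /(vnorm_lt x r0) xr; apply: H.
  by rewrite -ball_normE /ball_ /= sub0r normrN.
apply/nbhs_ballP; exists r%:C => /=; first by rewrite (ltcR 0).
move=> x; rewrite -ball_normE /ball_ /= sub0r normrN => /(vnorm_lt x r0); exact: H.
Qed.

Definition coordf (z : C -> Cn) j : C -> C := fun t => z t 0 j.

(** The norm on row vectors is the maximum of the moduli of the coordinates, so
    vector-valued derivatives are computed coordinatewise. *)
Lemma diff_quotient_cvg (z : C -> Cn) p (l : Cn) :
  (h^-1 *: ((z \o shift p) (h *: 1) - z p) @[h --> 0^'] --> l) <->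
  (forall j, cderiv (coordf z j) p (l 0 j)).
Proof.
split=> [L j e e0 | D].
  have e0' : 0 < e%:C :> C by rewrite (ltcR 0).
  move/cvgrPdist_lt: L => /(_ _ e0') /nbhs_ballP [d /= /gt0_complexP [r r0 ->] H].
  exists r => // h hr; have [->|h0] := eqVneq h 0.
    by rewrite addr0 subrr mulr0 subrr modc0 mulr0.
  have := H h; rewrite -ball_normE /ball_ /= sub0r normrN normr_lt_modc => /(_ hr h0).
  move/(vnorm_lt _ e0) => /(_ j); rewrite !mxE /= /shift /= [h *: 1]mulr1 [h + p]addrC => le.
  have -> : coordf z j (p + h) - coordf z j p - l 0 j * h
    = - ((l 0 j - h^-1 * (z (p + h) 0 j - z p 0 j)) * h).
    by rewrite /coordf; field.
  by rewrite modcN modcM ler_wpM2r ?modc_ge0 // ltW.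
apply/cvgrPdist_lt => e /gt0_complexP [r r0 ->].
have r2 : 0 < r / 2 by rewrite divr_gt0.
have /choice [d Hd] : forall j, exists d : R, 0 < d /\ forall h, modc h < d ->
    modc (coordf z j (p + h) - coordf z j p - l 0 j * h) <= r / 2 * modc h.
  by move=> j; have [d d0 H] := D j _ r2; exists d.
pose m := \big[Num.min/1]_j d j.
have m0 : 0 < m by apply: lt_bigmin => // j _; have [] := Hd j.
apply/nbhs_ballP; exists m%:C => /=; first by rewrite (ltcR 0).
move=> h; rewrite -ball_normE /ball_ /= sub0r normrN normr_lt_modc => hm h0.
apply/(vnorm_lt _ r0) => j; rewrite !mxE /= /shift /= [h *: 1]mulr1 [h + p]addrC.
have hd : modc h < d j by rewrite (lt_le_trans hm) // bigmin_le_cond.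
have [_ /(_ _ hd) le] := Hd j.
have h1 : 0 < modc h by rewrite modc_gt0.
rewrite -(ltr_pM2r h1) -modcM -modcN.
have -> : - ((l 0 j - h^-1 * (z (p + h) 0 j - z p 0 j)) * h)
   = coordf z j (p + h) - coordf z j p - l 0 j * h.
  by rewrite /coordf; field.
by rewrite (le_lt_trans le) // ltr_pM2r // ltr_pdivrMr // ltr_pMr // ltr1n.
Qed.

Lemma derive1_comp (z : C -> Cn) p (l : Cn) :
  (forall j, cderiv (coordf z j) p (l 0 j)) -> derive1 z p = l.
Proof.
move/diff_quotient_cvg => L.
have E : (fun h => h^-1 *: (z (h + p) - z p)) = (fun h => h^-1 *: ((z \o shift p) (h *: 1) - z p)).
  by apply/funext => h; rewrite /= /shift /= [h *: 1]mulr1.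
rewrite -E in L; exact: (cvg_lim (@norm_hausdorff _ _) L).
Qed.

Lemma differentiable_compP (z : C -> Cn) p :
  differentiable z p <-> forall j, exists d, cderiv (coordf z j) p d.
Proof.
split=> [/derivable1_diffP /cvg_ex [l /diff_quotient_cvg H] j | H].
  by exists (l 0 j).
apply/derivable1_diffP; apply/cvg_ex; have [d Hd] := choice H.
by exists (\row_j d j); apply/diff_quotient_cvg => j; rewrite mxE.
Qed.

Lemma near0_forall (P : 'I_n -> C -> Prop) :
  (forall j, near0 (P j)) -> near0 (fun t => forall j, P j t).
Proof.
move=> H; have /choice [d Hd] : forall j, exists d : R, 0 < d /\ forall h, modc h < d -> P j h.
  by move=> j; have [d d0 H'] := H j; exists d.
exists (\big[Num.min/1]_j d j).
  by apply: lt_bigmin => // j _; have [] := Hd j.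
by move=> h hm j; have [_] := Hd j; apply; rewrite (lt_le_trans hm) // bigmin_le_cond.
Qed.

Lemma holomorphic_compP (z : C -> Cn) : holomorphic_germ z <-> forall j, hol (coordf z j).
Proof.
rewrite /holomorphic_germ; split=> [/nbhs0_near0 H j | H].
  by apply: near0_imp H => t /differentiable_compP.
by apply/nbhs0_near0; apply: near0_imp (near0_forall H) => t Ht; apply/differentiable_compP.
Qed.

(** Iterated derivatives are compared near 0, and not only at 0, so that the next
    derivative can be taken. *)
Lemma derive1n_comp (z : C -> Cn) m : holomorphic_germ z ->
  near0 (fun t => forall j, derive1n m z t 0 j = iter m cderive (coordf z j) t).
Proof.
move=> /holomorphic_compP hz; elim: m => [|m IH]; first by exists 1.
have D : near0 (fun t => forall j, cderiv (iter m cderive (coordf z j)) t (iter m.+1 cderive (coordf z j) t)).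
  by apply: near0_forall => j; have [] := hol_cd (hol_iter m (hz j)).
apply: near0_imp (near0_and D (near0_near IH)) => t [Dt [r r0 Ht]] j.
rewrite /derive1n iterS (@derive1_comp _ _ (\row_j iter m.+1 cderive (coordf z j) t)) ?mxE //.
move=> k; rewrite mxE; apply: (cderiv_eqnear r0 _ (Dt k)) => h hr.
exact: esym (Ht h hr k).
Qed.

End RowVectors.
End VectorGerms.

(** * Differentiable germs on the real line *)

Section RealGerms.
Context {R : realType}.
Local Notation C := R[i].
Implicit Types (f g : R -> R) (s : R) (m : nat).

Definition near0R (P : R -> Prop) : Prop :=
  exists2 r : R, 0 < r & forall s, `|s| < r -> P s.

Lemma near0R_and P Q : near0R P -> near0R Q -> near0R (fun s => P s /\ Q s).
Proof.
move=> [r r0 HP] [r' r'0 HQ]; exists (Num.min r r'); first by rewrite lt_min r0.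
by move=> t; rewrite lt_min => /andP[/HP ? /HQ ?].
Qed.

Lemma near0R_imp (P Q : R -> Prop) : (forall s, P s -> Q s) -> near0R P -> near0R Q.
Proof. by move=> I [r r0 H]; exists r => // t /H /I. Qed.

Lemma near0R_near P : near0R P -> near0R (fun s => exists2 r : R, 0 < r &
  forall h, `|h| < r -> P (s + h)).
Proof.
move=> [r r0 H]; exists r => // t tr; exists (r - `|t|); first by rewrite subr_gt0.
by move=> h hr; apply: H; rewrite (le_lt_trans (ler_normD _ _)) // addrC -ltrBrDr.
Qed.

Lemma near0_line (P : C -> Prop) (v : C) : near0 P -> near0R (fun s => P (s%:C * v)).
Proof.
move=> [r r0 H]; have K : 0 < 1 + modc v by rewrite ltr_pwDl // modc_ge0.
exists (r / (1 + modc v)); first by rewrite divr_gt0.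
move=> s; rewrite ltr_pdivlMr // => hs; apply: H; rewrite modcM modcR.
by apply: le_lt_trans hs; rewrite ler_wpM2l // lerDr.
Qed.

Lemma is_derive_eqnear f g (x d r : R) : 0 < r -> (forall h, `|h| < r -> f (x + h) = g (x + h)) ->
  is_derive x 1 f d -> is_derive x 1 g d.
Proof.
move=> r0 E /is_deriveP H; apply/is_deriveP => e /H [s s0 Hs].
exists (Num.min r s); first by rewrite lt_min r0.
move=> h; rewrite lt_min => /andP[hr hs].
by rewrite -E // -[X in _ - g X - _]addr0 -E ?normr0 // addr0 Hs.
Qed.

(** Being m times differentiable near 0: the neighbourhood may shrink with m. *)
Fixpoint Cm m f : Prop := if m is m'.+1 then
  exists g, near0R (fun s => is_derive s 1 f (g s)) /\ Cm m' g else True.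

Lemma Cm_eqnear m f g : near0R (fun s => f s = g s) -> Cm m f -> Cm m g.
Proof.
case: m => // m E [f' [D Cf']]; exists f'; split=> //.
apply: near0R_imp (near0R_and D (near0R_near E)) => s [Ds [r r0 Es]].
exact: is_derive_eqnear r0 Es Ds.
Qed.

Lemma Cm_S m f : Cm m.+1 f -> Cm m f.
Proof. by elim: m f => // m IH f [f' [D Cf']]; exists f'; split=> //; exact: IH. Qed.

Lemma Cm_cst m a : Cm m (fun=> a).
Proof.
elim: m a => // m IH a; exists (fun=> 0); split=> //.
by exists 1 => // s _; exact: is_derive_cst.
Qed.

Lemma CmD m f g : Cm m f -> Cm m g -> Cm m (fun s => f s + g s).
Proof.
elim: m f g => // m IH f g [f' [Df Cf]] [g' [Dg Cg]].
exists (fun s => f' s + g' s); split; last exact: IH.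
by apply: near0R_imp (near0R_and Df Dg) => s [? ?]; exact: is_deriveD.
Qed.

Lemma CmM m f g : Cm m f -> Cm m g -> Cm m (fun s => f s * g s).
Proof.
elim: m f g => // m IH f g F G; have F' := Cm_S F; have G' := Cm_S G.
case: F => [f' [Df Cf]]; case: G => [g' [Dg Cg]].
exists (fun s => f s * g' s + g s * f' s); split.
  by apply: near0R_imp (near0R_and Df Dg) => s [? ?]; exact: is_deriveM.
by apply: CmD; exact: IH.
Qed.

Lemma Cm_sum (I : Type) (r : seq I) m (F : I -> R -> R) :
  (forall i, Cm m (F i)) -> Cm m (fun s => \sum_(i <- r) F i s).
Proof.
move=> H; elim: r => [|i r IH].
  by apply: Cm_eqnear (Cm_cst m 0); exists 1 => // s _; rewrite big_nil.
apply: Cm_eqnear (CmD (H i) IH); exists 1 => // s _; by rewrite big_cons.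
Qed.

Definition Cinf f : Prop := forall m, Cm m f.

Lemma derive1_val f (x d : R) : is_derive x 1 f d -> derive1 f x = d.
Proof. by move=> [_ <-]; rewrite derive1E. Qed.

Lemma Cm_derive1 m f : Cm m.+1 f ->
  Cm m (derive1 f) /\ near0R (fun s => is_derive s 1 f (derive1 f s)).
Proof.
move=> [g [D Cg]]; split.
  by apply: Cm_eqnear Cg; apply: near0R_imp D => s /derive1_val.
by apply: near0R_imp D => s Ds; rewrite (derive1_val Ds).
Qed.

Lemma Cinf_derive1 f : Cinf f ->
  Cinf (derive1 f) /\ near0R (fun s => is_derive s 1 f (derive1 f s)).
Proof.
by move=> F; split=> [m|]; [have [] := Cm_derive1 (F m.+1) | have [] := Cm_derive1 (F 1%N)].
Qed.

Definition bigOR m f : Prop := exists B : R, near0R (fun s => `|f s| <= B * `|s| ^+ m).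

Lemma bigOR_eqnear m f g : near0R (fun s => f s = g s) -> bigOR m f -> bigOR m g.
Proof.
move=> E [B H]; exists B; apply: near0R_imp (near0R_and E H) => s [<-]; exact.
Qed.

Lemma bigORD m f g : bigOR m f -> bigOR m g -> bigOR m (fun s => f s + g s).
Proof.
move=> [A HA] [B HB]; exists (A + B); apply: near0R_imp (near0R_and HA HB) => s [a b].
by rewrite mulrDl (le_trans (ler_normD _ _)) // lerD.
Qed.

Lemma bigORZ m c f : bigOR m f -> bigOR m (fun s => c * f s).
Proof.
move=> [A HA]; exists (`|c| * A); apply: near0R_imp HA => s a.
by rewrite normrM -mulrA ler_wpM2l.
Qed.

Lemma bigOR_sum (I : Type) (r : seq I) m (F : I -> R -> R) :
  (forall i, bigOR m (F i)) -> bigOR m (fun s => \sum_(i <- r) F i s).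
Proof.
move=> H; elim: r => [|i r IH].
  exists 0; exists 1 => // s _; by rewrite big_nil mul0r normr0.
apply: bigOR_eqnear (bigORD (H i) IH); exists 1 => // s _; by rewrite big_cons.
Qed.

(** The real counterpart of [bigO_antideriv]. *)
Lemma bigOR_antideriv m f g : near0R (fun s => is_derive s 1 f (g s)) -> f 0 = 0 ->
  bigOR m g -> bigOR m.+1 f.
Proof.
move=> D f0 [B BG]; exists `|B|; have [r r0 H] := near0R_and D BG.
exists r => // t tr.
have P s : `|s| <= `|t| -> is_derive s 1 f (g s) /\ `|g s| <= `|B| * `|t| ^+ m.
  move=> st; have [D' le] := H _ (le_lt_trans st tr); split=> //.
  rewrite (le_trans le) // (le_trans (ler_wpM2r _ (ler_norm B))) ?exprn_ge0 //.
  by rewrite ler_wpM2l // lerXn2r ?nnegrE.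
have K : 0 <= `|B| * `|t| ^+ m by rewrite mulr_ge0 // exprn_ge0.
rewrite exprSr mulrA; have [t0|t0] := leP 0 t.
  have : `|f t - f 0| <= `|B| * `|t| ^+ m * (t - 0).
    apply: (@mean_value_ineq _ f g) => // s /andP[s0 st]; have [] // := P s;
      by rewrite !ger0_norm.
  by rewrite f0 !subr0 => le; rewrite (le_trans le) // ler_wpM2l // ler_norm.
have : `|f 0 - f t| <= `|B| * `|t| ^+ m * (0 - t).
  apply: (@mean_value_ineq _ f g) => [|s /andP[ts s0]|s /andP[ts s0]]; first exact: ltW;
    by have [] // := P s; rewrite (ltr0_norm t0) ler0_norm // lerN2.
by rewrite f0 !sub0r normrN => le; rewrite (le_trans le) // ler_wpM2l // -normrN ler_norm.
Qed.

Lemma Cinf_taylor f m : Cinf f ->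
  bigOR m (fun s => f s - \sum_(j < m) derive1n j f 0 / j`!%:R * s ^+ j).
Proof.
elim: m f => [|m IH] f Cf.
  have [_ [r r0 D]] := Cinf_derive1 Cf.
  have D0 : is_derive (0 : R) 1 f (derive1 f 0) by apply: D; rewrite normr0.
  have /continuousP_eps /(_ 1 ltr01) [e e0 He] : {for (0 : R), continuous f}.
    by apply: differentiable_continuous; apply/derivable1_diffP; exact: (ex_derive (is_derive := D0)).
  exists (1 + `|f 0|); exists e => // s se.
  rewrite big_ord0 subr0 expr0 mulr1 -[f s](subrK (f 0)) (le_trans (ler_normD _ _)) //.
  by rewrite lerD2r; have := He _ se; rewrite add0r.
have [Cf' D] := Cinf_derive1 Cf.
apply: bigOR_antideriv (IH _ Cf').
  apply: near0R_imp D => s Ds; apply: is_deriveB.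
  have -> : (fun s : R => \sum_(j < m.+1) derive1n j f 0 / j`!%:R * s ^+ j) =
     (fun s => (\poly_(j < m.+1) (derive1n j f 0 / j`!%:R)).[s]).
    by apply/funext => u; rewrite horner_poly.
  have -> : \sum_(j < m) derive1n j (derive1 f) 0 / j`!%:R * s ^+ j
    = (deriv (\poly_(j < m.+1) (derive1n j f 0 / j`!%:R))).[s].
    have -> : \sum_(j < m) derive1n j (derive1 f) 0 / j`!%:R * s ^+ j
      = (\poly_(j < m) (derive1n j (derive1 f) 0 / j`!%:R)).[s] by rewrite horner_poly.
    congr (_.[s]); apply/polyP => i.
    rewrite coef_deriv !coef_poly ltnS; case: ifP => _; last by rewrite mul0rn.
    rewrite /derive1n -iterSr factS natrM -mulr_natr; field.
    by rewrite !pnatr_eq0 -lt0n fact_gt0 /= addrC natr1 pnatr_eq0.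
  exact: is_derive_poly.
rewrite big_ord_recl /= fact0 divr1 mulr1 big1 ?addr0 ?subrr // => i _.
by rewrite expr0n mulr0.
Qed.

(** Letting s tend to 0 kills the constant term, and dividing by s lowers m by one. *)
Lemma poly_bigO (p : {poly C}) m B (r : R) : 0 < r ->
  (forall s : R, 0 < s < r -> modc p.[s%:C] <= B * s ^+ m) ->
  forall j, (j < m)%N -> p`_j = 0.
Proof.
elim: m p => // m IH p r0 H.
have p0 : p.[0] = 0.
  apply/eqP; rewrite -modc_eq0 eq_le modc_ge0 andbT; apply/ler_addgt0Pr => e e0; rewrite add0r.
  have e2 : 0 < e / 2 by rewrite divr_gt0.
  have [d d0 Hd] := cderiv_cont (cderiv_horner p 0) e2.
  pose s := Num.min (Num.min (r / 2) (d / 2)) (Num.min 1 (e / (2 * (1 + `|B|)))).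
  have B1 : 0 < 1 + `|B| by rewrite ltr_pwDl.
  have s0 : 0 < s by rewrite !lt_min ltr01 !divr_gt0 ?mulr_gt0.
  have sr : s <= r / 2 by rewrite !ge_min lexx.
  have sd : s <= d / 2 by rewrite !ge_min lexx !orbT.
  have s1 : s <= 1 by rewrite !ge_min lexx !orbT.
  have se : s <= e / (2 * (1 + `|B|)) by rewrite !ge_min lexx !orbT.
  have l1 : modc p.[s%:C] <= e / 2.
    have sr' : 0 < s < r by rewrite s0 (le_lt_trans sr) // ltr_pdivrMr // ltr_pMr // ltr1n.
    rewrite (le_trans (H s sr')) // (@le_trans _ _ ((1 + `|B|) * s)) //.
      rewrite (@le_trans _ _ ((1 + `|B|) * s ^+ m.+1)) //.
        by rewrite ler_wpM2r ?exprn_ge0 ?(ltW s0) // (le_trans (ler_norm B)) // lerDr.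
      by rewrite ler_wpM2l ?(ltW B1) // exprS ler_piMr ?(ltW s0) // exprn_ile1 ?(ltW s0).
    rewrite mulrC -ler_pdivlMr //; apply: le_trans se _.
    by rewrite le_eqVlt; apply/orP; left; apply/eqP; field; rewrite gt_eqF.
  have sd' : modc s%:C < d.
    by rewrite modc_natR ?(ltW s0) // (le_lt_trans sd) // ltr_pdivrMr // ltr_pMr // ltr1n.
  have := Hd _ sd'; rewrite add0r modcB => l2.
  by rewrite -[p.[0]](subrK p.[s%:C]) (le_trans (ler_modcD _ _)) // [e]splitr lerD.
have /factor_theorem [q pq] : root p 0 by rewrite rootE p0.
rewrite subr0 in pq.
have Hq (s : R) : 0 < s < r -> modc q.[s%:C] <= B * s ^+ m.
  move=> sr; have /andP[s0 _] := sr; have := H _ sr.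
  by rewrite pq hornerM hornerX modcM (modc_natR (ltW s0)) exprSr mulrA ler_pM2r.
case=> [_|j jm]; first by rewrite -horner_coef0.
by rewrite pq coefMX /=; exact: IH Hq j jm.
Qed.

Lemma bigOR_poly0 m (a : nat -> R) : bigOR m (fun s => \sum_(j < m) a j * s ^+ j) ->
  forall j, (j < m)%N -> a j = 0.
Proof.
move=> [B [r r0 H]] j jm; apply: complexI.
have := @poly_bigO (\poly_(j < m) (a j)%:C) m B r r0 _ j jm.
rewrite coef_poly jm; apply=> s /andP[s0 sr].
have sn : `|s| = s by rewrite ger0_norm // ltW.
have := H s; rewrite sn => /(_ sr); apply: le_trans.
rewrite -modcR horner_poly rmorph_sum /= le_eqVlt; apply/orP; left; apply/eqP.
by congr modc; apply: eq_bigr => i _; rewrite rmorphM rmorphXn.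
Qed.

(** Two polynomial expansions to the same order differ by a polynomial that is
    O(s^m), which must vanish. This is how all Taylor coefficients are computed. *)
Lemma Cinf_coef f m (b : nat -> R) : Cinf f ->
  bigOR m (fun s => f s - \sum_(j < m) b j * s ^+ j) ->
  forall j, (j < m)%N -> derive1n j f 0 / j`!%:R = b j.
Proof.
move=> Cf H j jm; apply/eqP; rewrite -subr_eq0; apply/eqP.
apply: (@bigOR_poly0 m (fun j => derive1n j f 0 / j`!%:R - b j)) jm.
apply: bigOR_eqnear (bigORD H (bigORZ (-1) (Cinf_taylor m Cf))).
exists 1 => // s _; under [RHS]eq_bigr do rewrite mulrBl.
by rewrite sumrB; ring.
Qed.

Lemma Cinf_bigOR f m : Cinf f -> bigOR m f ->
  forall j, (j < m)%N -> derive1n j f 0 / j`!%:R = 0.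
Proof.
move=> Cf H; apply: (@Cinf_coef f m (fun=> 0)) => //.
apply: bigOR_eqnear H; exists 1 => // s _.
by rewrite big1 ?subr0 // => i _; rewrite mul0r.
Qed.

(** The factor w absorbs the powers of v that the chain rule produces; taking w = -i
    turns real parts into imaginary parts. *)
Lemma Cm_hol_line m (F : C -> C) w v : hol F -> Cm m (fun s : R => Re (w * F (s%:C * v))).
Proof.
elim: m F w => // m IH F w hF; have [hcd D] := hol_cd hF.
exists (fun s => Re ((w * v) * cderive F (s%:C * v))); split; last exact: IH.
apply: near0R_imp (near0_line v D) => s Ds.
rewrite mulrC -[v * _]add0r in Ds.
have [+ _] := rcderivZ w (cderiv_line Ds); rewrite mulrA add0r [v * _]mulrC.
by congr is_derive; apply/funext => u; rewrite add0r [v * _]mulrC.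
Qed.

End RealGerms.

(** * Smooth functions of several variables: the chain rule *)

Section SmoothFunctions.
Context {R : realType} {n : nat}.
Local Notation C := R[i].
Local Notation Cn := 'rV[C]_n.
Implicit Types (u : Cn -> R) (x p v : Cn) (rho : R).

Lemma vltD x y r s : vlt x r -> vlt y s -> vlt (x + y) (r + s).
Proof.
by move=> X Y j; rewrite mxE (le_lt_trans (ler_modcD _ _)) // ltrD.
Qed.

Lemma vltZ (s : R) x r b : `|s| <= b -> 0 < b -> vlt x r -> vlt (s%:C *: x) (b * r).
Proof.
move=> sb b0 X j; rewrite mxE modcM modcR.
rewrite (le_lt_trans (ler_wpM2r (modc_ge0 _) sb)) // ltr_pM2l //.
Qed.

Lemma vlt_le x r s : r <= s -> vlt x r -> vlt x s.
Proof. by move=> rs X j; apply: lt_le_trans rs. Qed.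

Lemma vlt0 r : 0 < r -> vlt (0 : Cn) r.
Proof. by move=> r0 j; rewrite mxE modc0. Qed.

Lemma vlt_exists x : exists2 r : R, 0 < r & vlt x r.
Proof.
exists (1 + \sum_j modc (x 0 j)).
  by rewrite ltr_pwDl // sumr_ge0 // => j _; exact: modc_ge0.
move=> j; rewrite (bigD1 j) //= addrCA ltrDl ltr_pwDl // sumr_ge0 // => k _.
exact: modc_ge0.
Qed.

Lemma continuousV_eps u p e : {for p, continuous u} -> 0 < e ->
  exists2 r : R, 0 < r & forall y, vlt y r -> `|u (p + y) - u p| < e.
Proof.
move=> cu e0.
move/cvgrPdist_lt: cu => /(_ _ e0) /nbhs_ballP [d /= /gt0_complexP [r r0 ->] H].
exists r => // y /(vnorm_lt _ r0) yr; rewrite distrC; apply: H.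
by rewrite -ball_normE /ball_ /= opprD addrA subrr sub0r normrN.
Qed.

(** A polydisc instead of an arbitrary open set: it is stable under the rays and
    segments from the origin used in Taylor's formula. *)
Definition smooth_on rho u : Prop := forall k, Ck_on k (fun x => vlt x rho) u.

Lemma Ck_on_sub k (A B : set Cn) u : (forall x, A x -> B x) -> Ck_on k B u -> Ck_on k A u.
Proof.
move=> AB; elim: k u => [|k IH] u [cu H]; split=> //; try by move=> p /AB /cu.
by move=> v; have [D Ck] := H v; split; [move=> p /AB; exact: D | exact: IH].
Qed.

Lemma smooth_germP u : smooth_germ u -> exists2 rho, 0 < rho & smooth_on rho u.
Proof.
move=> [U Unbhs H]; have /nbhs0_nearV [r r0 rU] : nbhs (0 : Cn) U by exact: open_nbhs_nbhs.
by exists r => // k; apply: Ck_on_sub (H k).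
Qed.

Lemma smooth_on_rderive rho u v : smooth_on rho u -> smooth_on rho (rderive v u).
Proof. by move=> H k; have [_ /(_ v) []] := H k.+1. Qed.

Lemma smooth_on_cont rho u p e : smooth_on rho u -> vlt p rho -> 0 < e ->
  exists2 r : R, 0 < r & forall y, vlt y r -> `|u (p + y) - u p| < e.
Proof. by move=> H pr; apply: continuousV_eps; have [+ _] := H 0%N; exact. Qed.

Lemma smooth_on_line rho u v q (s : R) : smooth_on rho u -> vlt (q + s%:C *: v) rho ->
  is_derive s 1 (fun s : R => u (q + s%:C *: v)) (rderive v u (q + s%:C *: v)).
Proof.
move=> H qs; have [_ /(_ v) [/(_ _ qs) D _]] := H 1%N.
have D0 : is_derive (0 : R) 1 (fun s0 : R => u (q + s%:C *: v + s0%:C *: v)) (rderive v u (q + s%:C *: v)).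
  exact: (DeriveDef D (esym (derive1E _ _))).
apply: (is_deriveP _ _ _).1 => e e0.
have [r r0 Hr] := (is_deriveP (fun t : R => u (q + s%:C *: v + t%:C *: v)) 0 _).2 D0 e e0; exists r => // h hr.
have := Hr h hr; rewrite add0r rmorph0 scale0r addr0.
by rewrite rmorphD scalerDl addrA.
Qed.

(** The directions are changed one at a time; each change is estimated by the mean
    value inequality and the continuity of the corresponding directional
    derivative. *)
Lemma smooth_on_frechet (I : Type) (l : seq I) (v : I -> Cn) rho u p :
  smooth_on rho u -> vlt p rho -> forall e : R, 0 < e ->
  exists2 d : R, 0 < d & forall a : I -> R, (forall i, `|a i| < d) ->
    `|u (p + \sum_(i <- l) (a i)%:C *: v i) - u p - \sum_(i <- l) a i * rderive (v i) u p|
      <= e * \sum_(i <- l) `|a i|.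
Proof.
move=> Hu pr; elim: l => [|i l IH] e e0.
  by exists 1 => // a _; rewrite !big_nil addr0 subrr subr0 normr0 mulr0.
have [d d0 Hd] := IH e e0.
have Hvi := smooth_on_rderive (v i) Hu.
have [d1 d10 Hd1] := smooth_on_cont Hvi pr e0.
have [b b0 Hb] : exists2 b : R, 0 < b & forall y, vlt y b -> vlt (p + y) rho.
  pose b := \big[Num.min/1]_j (rho - modc (p 0 j)).
  exists b; first by apply: lt_bigmin => // j _; rewrite subr_gt0.
  move=> y yb j; rewrite mxE (le_lt_trans (ler_modcD _ _)) // -ltrBrDl.
  by rewrite (lt_le_trans (yb j)) // bigmin_le_cond.
pose r0 := Num.min d1 b.
have r00 : 0 < r0 by rewrite lt_min d10.
have [c c0 Hc] : exists2 c : R, 0 < c & forall a : I -> R, (forall i, `|a i| < c) ->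
    vlt (\sum_(i <- l) (a i)%:C *: v i) (r0 / 2).
  elim: (l) (r0 / 2) (divr_gt0 r00 (@ltr0n R 2)) => [|k l' IH'] t t0.
    by exists 1 => // a _; rewrite big_nil; exact: vlt0.
  have t2 : 0 < t / 2 by rewrite divr_gt0.
  have [c c0 Hc] := IH' _ t2; have [w w0 Hw] := vlt_exists (v k).
  exists (Num.min c (t / 2 / w)); first by rewrite lt_min c0 divr_gt0.
  move=> a ac; rewrite big_cons [t]splitr; apply: vltD; last first.
    by apply: Hc => j; have := ac j; rewrite lt_min => /andP[].
  have tw : 0 < t / 2 / w by rewrite divr_gt0.
  have -> : t / 2 = t / 2 / w * w by rewrite divfK ?gt_eqF.
  by apply: vltZ => //; have := ac k; rewrite lt_min => /andP[_ /ltW].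
have [w w0 Hw] := vlt_exists (v i).
have wr : 0 < r0 / 2 / w by rewrite !divr_gt0.
exists (Num.min (Num.min d c) (r0 / 2 / w)); first by rewrite !lt_min d0 c0.
move=> a ha; have had j : `|a j| < d by have := ha j; rewrite !lt_min => /andP[/andP[]].
have hac j : `|a j| < c by have := ha j; rewrite !lt_min => /andP[/andP[]].
have haw : `|a i| < r0 / 2 / w by have := ha i; rewrite !lt_min => /andP[_].
rewrite !big_cons; set y := \sum_(j <- l) _.
have yr : vlt y (r0 / 2) := Hc _ hac.
have inr (s : R) : `|s| <= `|a i| -> vlt (y + s%:C *: v i) r0.
  move=> sa; rewrite [r0]splitr; apply: vltD => //.
  have -> : r0 / 2 = r0 / 2 / w * w by rewrite divfK ?gt_eqF.
  by apply: vltZ => //; exact: ltW (le_lt_trans sa haw).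
pose F (s : R) := u (p + y + s%:C *: v i) - s * rderive (v i) u p.
have DF (s : R) : `|s| <= `|a i| -> is_derive s 1 F
    (rderive (v i) u (p + y + s%:C *: v i) - rderive (v i) u p).
  move=> sa; have D2 : is_derive s 1 (fun s : R => s * rderive (v i) u p) (rderive (v i) u p).
    apply/is_deriveP => e' e'0; exists 1 => // h _.
    have -> : (s + h) * rderive (v i) u p - s * rderive (v i) u p - rderive (v i) u p * h = 0 by ring.
    by rewrite normr0 mulr_ge0 // ltW.
  apply: is_deriveB; apply: smooth_on_line Hu _.
  by rewrite -addrA; apply: Hb; apply: vlt_le (inr _ sa); rewrite ge_min lexx orbT.
have bF (s : R) : `|s| <= `|a i| ->
    `|rderive (v i) u (p + y + s%:C *: v i) - rderive (v i) u p| <= e.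
  move=> sa; rewrite -addrA ltW // Hd1 //.
  by apply: vlt_le (inr _ sa); rewrite ge_min lexx.
have main : `|F (a i) - F 0| <= e * `|a i|.
  have [a0|a0] := leP 0 (a i).
    have -> : e * `|a i| = e * (a i - 0) by rewrite subr0 ger0_norm.
    apply: (mean_value_ineq a0) => s /andP[s0 sa]; [apply: DF | apply: bF];
      by rewrite !ger0_norm.
  rewrite distrC; have -> : e * `|a i| = e * (0 - a i) by rewrite sub0r ltr0_norm.
  apply: (mean_value_ineq (ltW a0)) => s /andP[s0 sa]; [apply: DF | apply: bF];
    by rewrite (ltr0_norm a0) ler0_norm // lerN2.
have -> : u (p + ((a i)%:C *: v i + y)) - u p -
    (a i * rderive (v i) u p + \sum_(j <- l) a j * rderive (v j) u p)
  = (F (a i) - F 0) + (u (p + y) - u p - \sum_(j <- l) a j * rderive (v j) u p).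
  rewrite /F rmorph0 scale0r addr0 mul0r subr0 -[p + y + _]addrA [y + _]addrC; ring.
rewrite mulrDr (le_trans (ler_normD _ _)) // lerD //; exact: Hd had.
Qed.

Definition basis_vec (i : 'I_n * bool) : Cn := (if i.2 then 'i else 1) *: delta_mx 0 i.1.

Definition rcoord (i : 'I_n * bool) (x : Cn) : R := if i.2 then Im (x 0 i.1) else Re (x 0 i.1).

Lemma rcoord_sum x : x = \sum_i (rcoord i x)%:C *: basis_vec i.
Proof.
rewrite -(pair_bigA _ (fun j b => (rcoord (j, b) x)%:C *: basis_vec (j, b))) /=.
rewrite {1}[x]row_sum_delta; apply: eq_bigr => j _.
rewrite big_bool /rcoord /basis_vec /= !scalerA -scalerDl; congr (_ *: _).
by rewrite {1}[x 0 j]complexE mulr1 addrC mulrC.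
Qed.

Lemma rcoordB i x y : rcoord i (x - y) = rcoord i x - rcoord i y.
Proof. by rewrite /rcoord !mxE; case: i.2; rewrite raddfB. Qed.

Lemma rcoord_le i x r : vlt x r -> `|rcoord i x| < r.
Proof.
move=> xr; rewrite /rcoord; case: i.2; apply: le_lt_trans (xr i.1);
  [exact: modc_ge_Im | exact: modc_ge_Re].
Qed.

(** Fréchet differentiability in the real coordinates, with the coordinates of the
    curve expanded to first order. *)
Lemma chain_rule rho u (c : R -> Cn) (s0 : R) (d : 'I_n * bool -> R) :
  smooth_on rho u -> vlt (c s0) rho ->
  (forall i, is_derive s0 1 (fun s => rcoord i (c s)) (d i)) ->
  is_derive s0 1 (fun s => u (c s)) (\sum_i d i * rderive (basis_vec i) u (c s0)).
Proof.
move=> Hu cr Dc; apply/is_deriveP => e e0.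
set p := c s0; pose S := \sum_i (`|d i| + 1); pose T := \sum_i `|rderive (basis_vec i) u p|.
have S0 : 0 <= S by rewrite sumr_ge0 // => i _; rewrite addr_ge0.
have T0 : 0 <= T by rewrite sumr_ge0.
pose e1 := e / (2 * (1 + S)); have e10 : 0 < e1.
  by rewrite divr_gt0 // mulr_gt0 // ltr_pwDl.
pose e2 := Num.min 1 (e / (2 * (1 + T))); have e20 : 0 < e2.
  by rewrite lt_min ltr01 divr_gt0 // mulr_gt0 // ltr_pwDl.
have frac (w : R) : 0 <= w -> e / (2 * (1 + w)) * w <= e / 2.
  move=> w0; have w1 : 0 < 1 + w by rewrite ltr_pwDl.
  have -> : e / (2 * (1 + w)) * w = e / 2 * (w / (1 + w)) by field; rewrite gt_eqF.
  by rewrite ler_piMr ?divr_ge0 ?(ltW e0) // ler_pdivrMr // mul1r lerDr.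
have [r r0 Hr] := smooth_on_frechet (index_enum _) basis_vec Hu cr e10.
have /choice [q Hq] : forall i, exists q : R, 0 < q /\ forall h, `|h| < q ->
    `|rcoord i (c (s0 + h)) - rcoord i p - d i * h| <= e2 * `|h|.
  by move=> i; have /is_deriveP /(_ _ e20) [q q0 H] := Dc i; exists q.
pose m := \big[Num.min/1]_i (Num.min (q i) (r / (`|d i| + 1))).
have dpos i : 0 < `|d i| + 1 by rewrite ltr_wpDl.
exists m.
  by apply: lt_bigmin => // i _; rewrite lt_min divr_gt0 // andbT; have [] := Hq i.
move=> h hm; pose a i := rcoord i (c (s0 + h)) - rcoord i p.
have hi i : `|h| < q i /\ `|h| < r / (`|d i| + 1).
  have : `|h| < Num.min (q i) (r / (`|d i| + 1)).
    by rewrite (lt_le_trans hm) // (bigmin_le_cond _ (fun i => Num.min (q i) (r / (`|d i| + 1)))).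
  by rewrite lt_min => /andP[].
have a1 i : `|a i - d i * h| <= e2 * `|h| by have [_] := Hq i; apply; have [] := hi i.
have a2 i : `|a i| <= (`|d i| + 1) * `|h|.
  rewrite -[a i](subrK (d i * h)) (le_trans (ler_normD _ _)) // normrM.
  rewrite mulrDl mul1r addrC lerD2l (le_trans (a1 i)) // ler_piMl //.
  by rewrite ge_min lexx.
have a3 i : `|a i| < r.
  by rewrite (le_lt_trans (a2 i)) // mulrC -ltr_pdivlMr //; have [] := hi i.
have cE : c (s0 + h) = p + \sum_i (a i)%:C *: basis_vec i.
  rewrite -[LHS](subrK p) addrC; congr (_ + _); rewrite [LHS]rcoord_sum.
  by apply: eq_bigr => i _; rewrite rcoordB.
have := Hr a a3; rewrite -cE => le1.
have -> : u (c (s0 + h)) - u p - (\sum_i d i * rderive (basis_vec i) u p) * h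
  = (u (c (s0 + h)) - u p - \sum_i a i * rderive (basis_vec i) u p)
    + \sum_i (a i - d i * h) * rderive (basis_vec i) u p.
  under [X in _ = _ + X]eq_bigr do rewrite mulrBl.
  rewrite sumrB mulr_suml.
  under [X in _ = _ + (_ - X)]eq_bigr do rewrite mulrAC.
  by ring.
rewrite (le_trans (ler_normD _ _)) // [e]splitr mulrDl lerD //.
  rewrite (le_trans le1) // (@le_trans _ _ (e1 * (S * `|h|))) //.
    rewrite ler_wpM2l ?(ltW e10) // mulr_suml; apply: ler_sum => i _; exact: a2.
  by rewrite mulrA ler_wpM2r // frac.
rewrite (le_trans (ler_norm_sum _ _ _)) // (@le_trans _ _ (e2 * `|h| * T)) //.
  rewrite mulr_sumr; apply: ler_sum => i _; rewrite normrM ler_wpM2r //.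
rewrite mulrAC ler_wpM2r //.
have le2 : e2 <= e / (2 * (1 + T)) by rewrite ge_min lexx orbT.
by rewrite (le_trans (ler_wpM2r T0 le2)) // frac.
Qed.

End SmoothFunctions.

(** * Smooth functions of several variables: Taylor's formula *)

Section SmoothTaylor.
Context {R : realType} {n : nat}.
Local Notation C := R[i].
Local Notation Cn := 'rV[C]_n.
Implicit Types (u : Cn -> R) (x p v : Cn) (rho : R).

(** Each derivative of u along c is, by the chain rule, a combination of the same
    kind of function for the partial derivatives of u; hence the induction. *)
Lemma Cm_comp m rho u (c : R -> Cn) : smooth_on rho u ->
  near0R (fun s => vlt (c s) rho) -> (forall i, Cm m (fun s => rcoord i (c s))) ->
  Cm m (fun s => u (c s)).
Proof.
elim: m u => // m IH u Hu Hc Cc; have [d Hd] := choice Cc.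
have D : near0R (fun s => forall i, is_derive s 1 (fun s => rcoord i (c s)) (d i s)).
  have /choice [q Hq] : forall i, exists q : R, 0 < q /\ forall s : R, `|s| < q ->
      is_derive s 1 (fun s => rcoord i (c s)) (d i s).
    by move=> i; have [[q q0 H] _] := Hd i; exists q.
  exists (\big[Num.min/1]_i q i).
    by apply: lt_bigmin => // i _; have [] := Hq i.
  by move=> s sm i; have [_] := Hq i; apply; rewrite (lt_le_trans sm) // bigmin_le_cond.
exists (fun s => \sum_i d i s * rderive (basis_vec i) u (c s)); split.
  by apply: near0R_imp (near0R_and Hc D) => s [cs Ds]; exact: (chain_rule (d := fun i => d i s) Hu cs).
apply: Cm_sum => i; apply: CmM; first by have [] := Hd i.
by apply: IH => //; [exact: smooth_on_rderive | move=> j; exact: Cm_S].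
Qed.

Lemma rcoordZ i (s : R) x : rcoord i (s%:C *: x) = s * rcoord i x.
Proof. by rewrite /rcoord mxE; case: i.2; case: (x 0 i.1) => a b /=; ring. Qed.

Lemma is_derive_mulr (a s : R) : is_derive s 1 (fun s => s * a) a.
Proof.
apply: (is_deriveP _ _ _).1 => e e0; exists 1 => // h _.
have -> : (s + h) * a - s * a - a * h = 0 by ring.
by rewrite normr0 mulr_ge0 // ltW.
Qed.

Lemma Cm_mulr m (a : R) : Cm m (fun s => s * a).
Proof.
case: m => // m; exists (fun=> a); split; last exact: Cm_cst.
by exists 1 => // s _; exact: is_derive_mulr.
Qed.

Lemma near0R_ray rho x : 0 < rho -> near0R (fun s => vlt (s%:C *: x) rho).
Proof.
move=> rho0; have [w w0 xw] := vlt_exists x.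
have b0 : 0 < rho / w by rewrite divr_gt0.
exists (rho / w) => // s sr; have -> : rho = rho / w * w by rewrite divfK ?gt_eqF.
by apply: vltZ => //; exact: ltW.
Qed.

Lemma Cinf_ray rho u x : 0 < rho -> smooth_on rho u -> Cinf (fun s => u (s%:C *: x)).
Proof.
move=> rho0 Hu m; apply: (Cm_comp Hu); first exact: near0R_ray.
move=> i; apply: Cm_eqnear (Cm_mulr m (rcoord i x)); exists 1 => // s _.
by rewrite rcoordZ.
Qed.

Lemma taylor_part0 u x : taylor_part 0 u x = u 0.
Proof. by rewrite /taylor_part /= rmorph0 scale0r fact0 divr1. Qed.

(** Both sides are coefficients of the same expansion, of t |-> u(t s x). *)
Lemma taylor_part_scale (V : normedModType C) (u : V -> R) m (s : R) (x : V) :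
  (forall y, Cinf (fun t : R => u (t%:C *: y))) ->
  taylor_part m u (s%:C *: x) = s ^+ m * taylor_part m u x.
Proof.
move=> Hu; rewrite /taylor_part.
apply: (@Cinf_coef _ _ m.+1 (fun j => s ^+ j * taylor_part j u x)) => //.
have [B [r r0 H]] := Cinf_taylor m.+1 (Hu x).
exists (B * `|s| ^+ m.+1); exists (r / (1 + `|s|)); first by rewrite divr_gt0 // ltr_pwDl.
move=> t; rewrite ltr_pdivlMr ?ltr_pwDl // => tr.
have ts : `|t * s| < r.
  by rewrite normrM (le_lt_trans _ tr) // ler_wpM2l // lerDr.
have := H _ ts; rewrite normrM exprMn -mulrA [`|t| ^+ _ * _]mulrC; apply: le_trans.
rewrite le_eqVlt; apply/orP; left; apply/eqP; congr (`| _ - _ |).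
  by rewrite scalerA rmorphM.
by apply: eq_bigr => j _; rewrite /taylor_part exprMn mulrCA mulrA [_ ^+ j * s ^+ j]mulrC; ring.
Qed.

Lemma chain_ray rho u x (s : R) : smooth_on rho u -> vlt (s%:C *: x) rho ->
  is_derive s 1 (fun s => u (s%:C *: x))
    (\sum_i rcoord i x * rderive (basis_vec i) u (s%:C *: x)).
Proof.
move=> Hu sx; apply: (chain_rule (c := fun s => s%:C *: x) (d := fun i => rcoord i x) Hu sx) => i.
have -> : (fun s : R => rcoord i (s%:C *: x)) = (fun s => s * rcoord i x).
  by apply/funext => t; rewrite rcoordZ.
exact: is_derive_mulr.
Qed.

(** The expansion of s |-> u(s x) is differentiated by the chain rule. *)
Lemma taylor_part_rec rho u m x : 0 < rho -> smooth_on rho u ->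
  m.+1%:R * taylor_part m.+1 u x =
  \sum_i rcoord i x * taylor_part m (rderive (basis_vec i) u) x.
Proof.
move=> rho0 Hu; set f := fun s : R => u (s%:C *: x).
have Cf : Cinf f := Cinf_ray x rho0 Hu.
have [Cf' Df] := Cinf_derive1 Cf.
have -> : m.+1%:R * taylor_part m.+1 u x = derive1n m (derive1 f) 0 / m`!%:R.
  have E : derive1n m.+1 f = derive1n m (derive1 f) by rewrite /derive1n iterSr.
  rewrite /taylor_part -/f E factS natrM.
  by field; rewrite !pnatr_eq0 -lt0n fact_gt0 /= addrC natr1 pnatr_eq0.
apply: (@Cinf_coef _ _ m.+1 (fun j => \sum_i rcoord i x * taylor_part j (rderive (basis_vec i) u) x)) => //.
have H i := bigORZ (rcoord i x)
  (Cinf_taylor m.+1 (Cinf_ray x rho0 (smooth_on_rderive (basis_vec i) Hu))).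
apply: bigOR_eqnear (bigOR_sum (index_enum _) H).
apply: near0R_imp (near0R_and Df (near0R_ray x rho0)) => s [Ds sx].
have -> : derive1 f s = \sum_i rcoord i x * rderive (basis_vec i) u (s%:C *: x).
  by apply: derive1_val; exact: chain_ray Hu sx.
under eq_bigr do rewrite mulrBr.
rewrite sumrB; congr (_ - _).
under eq_bigr do rewrite mulr_sumr.
rewrite exchange_big /=; apply: eq_bigr => j _; rewrite mulr_suml.
by apply: eq_bigr => i _; rewrite mulrA.
Qed.

(** By [taylor_part_rec], the s-derivative of the remainder at s x is the combination,
    with coefficients the coordinates of x, of the remainders of the partial
    derivatives. These are of order k by induction, and integrating over [0, 1]
    gives order k + 1. *)
Lemma smooth_taylor rho u k : 0 < rho -> smooth_on rho u ->
  exists B d : R, 0 < d /\ forall r x, r <= d -> vlt x r ->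
    `|u x - \sum_(m < k) taylor_part m u x| <= B * r ^+ k.
Proof.
move=> rho0; elim: k u => [|k IH] u Hu.
  have [d d0 Hd] := smooth_on_cont Hu (vlt0 rho0) ltr01.
  exists (1 + `|u 0|), d; split=> // r x rd xr; rewrite big_ord0 subr0 expr0 mulr1.
  rewrite -[u x](subrK (u 0)) (le_trans (ler_normD _ _)) // lerD2r.
  by have := Hd _ (vlt_le rd xr); rewrite add0r => /ltW.
have Hw i := smooth_on_rderive (basis_vec i) Hu.
have /choice [b Hb] : forall i, exists b : R * R, 0 < b.2 /\ forall r x, r <= b.2 -> vlt x r ->
    `|rderive (basis_vec i) u x - \sum_(m < k) taylor_part m (rderive (basis_vec i) u) x|
      <= b.1 * r ^+ k.
  by move=> i; have [B [d H]] := IH _ (Hw i); exists (B, d).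
exists (\sum_i `|(b i).1|), (\big[Num.min/rho]_i (b i).2); split.
  by apply: lt_bigmin => // i _; have [] := Hb i.
move=> r x rd xr.
have rrho : r <= rho by rewrite (le_trans rd) // bigmin_le_id.
have rb i : r <= (b i).2 by rewrite (le_trans rd) // (bigmin_le_cond _ (fun i => (b i).2)).
pose p : {poly R} := \poly_(m < k.+1) taylor_part m u x.
pose F (s : R) := u (s%:C *: x) - p.[s].
pose G (s : R) := \sum_i rcoord i x * (rderive (basis_vec i) u (s%:C *: x)
   - \sum_(m < k) taylor_part m (rderive (basis_vec i) u) (s%:C *: x)).
have sx (s : R) : 0 <= s <= 1 -> vlt (s%:C *: x) r.
  move=> /andP[s0 s1] j; rewrite mxE modcM modc_natR //.
  by rewrite (le_lt_trans _ (xr j)) // ler_piMl ?modc_ge0.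
have DF (s : R) : 0 <= s <= 1 -> is_derive s 1 F (G s).
  move=> s01; have -> : G s = \sum_i rcoord i x * rderive (basis_vec i) u (s%:C *: x)
      - (deriv p).[s].
    rewrite /G; under eq_bigr do rewrite mulrBr.
    rewrite sumrB; congr (_ - _).
    have -> : deriv p = \poly_(m < k) (m.+1%:R * taylor_part m.+1 u x).
      apply/polyP => j; rewrite coef_deriv !coef_poly ltnS.
      by case: ifP => _; rewrite ?mul0rn // mulr_natl.
    rewrite horner_poly; under eq_bigr do rewrite mulr_sumr.
    rewrite exchange_big /=; apply: eq_bigr => m _.
    rewrite (taylor_part_rec m x rho0 Hu) mulr_suml; apply: eq_bigr => i _.
    by rewrite (taylor_part_scale m s x (fun y => Cinf_ray y rho0 (Hw i))) -mulrA [_ * s ^+ m]mulrC.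
  have D1 := chain_ray Hu (vlt_le rrho (sx _ s01)).
  have D2 : is_derive s 1 (fun s => p.[s]) (deriv p).[s] by exact: is_derive_poly.
  exact: is_deriveB.
have bG (s : R) : 0 <= s <= 1 -> `|G s| <= (\sum_i `|(b i).1|) * r ^+ k.+1.
  move=> s01; rewrite (le_trans (ler_norm_sum _ _ _)) // mulr_suml.
  apply: ler_sum => i _; have [_ Hi] := Hb i.
  rewrite normrM exprS mulrCA; apply: ler_pM => //; first exact: ltW (rcoord_le i xr).
  have r0 : 0 <= r by rewrite (le_trans (normr_ge0 (rcoord i x))) // ltW // rcoord_le.
  by rewrite (le_trans (Hi _ _ (rb i) (sx _ s01))) // ler_wpM2r ?exprn_ge0 // ler_norm.
have := mean_value_ineq ler01 DF bG.
rewrite subr0 mulr1 /F rmorph1 rmorph0 scale1r scale0r horner_coef0 coef_poly /= taylor_part0.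
rewrite subrr subr0; have -> // : p.[1] = \sum_(m < k.+1) taylor_part m u x.
by rewrite horner_poly; apply: eq_bigr => m _; rewrite expr1n mulr1.
Qed.

Lemma hol_cont0 (F : C -> C) (e : R) : hol F -> F 0 = 0 -> 0 < e -> near0 (fun t => modc (F t) < e).
Proof.
move=> hF F0 e0; have [d D] := near0_here hF.
have [r r0 Hr] := cderiv_cont D (divr_gt0 e0 (@ltr0n R 2)).
exists r => // t /Hr; rewrite add0r F0 subr0 => le; rewrite (le_lt_trans le) //.
by rewrite ltr_pdivrMr // ltr_pMr // ltr1n.
Qed.

Lemma curve_near (z : C -> Cn) rho : based_curve z -> 0 < rho -> near0 (fun t => vlt (z t) rho).
Proof.
move=> [z0 /holomorphic_compP hz] rho0.
apply: near0_forall => j; have F0 : coordf z j 0 = 0 by rewrite /coordf z0 mxE.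
exact: hol_cont0 (hz j) F0 rho0.
Qed.

Lemma Cinf_curve u (z : C -> Cn) (v : C) : smooth_germ u -> based_curve z ->
  Cinf (fun s : R => u (z (s%:C *: v))).
Proof.
move=> /smooth_germP [rho rho0 Hu] bz m; apply: (Cm_comp Hu).
  exact: (near0_line v (curve_near bz rho0)).
have [_ /holomorphic_compP hz] := bz.
move=> [j b]; case: b.
  apply: Cm_eqnear (Cm_hol_line m (- 'i%C) v (hz j)); exists 1 => // s _.
  by rewrite /rcoord /coordf /=; case: (z _ 0 j) => a c /=; ring.
apply: Cm_eqnear (Cm_hol_line m 1 v (hz j)); exists 1 => // s _.
by rewrite /rcoord /coordf /= mul1r.
Qed.

End SmoothTaylor.

(** * Expansions modulo powers of t, and polynomials in t and its conjugate *)

Section Congruence.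
Context {R : realType}.
Local Notation C := R[i].
Implicit Types (F G : C -> C).

(** Restated for [conjc], so that they apply without the conjugation of the closed
    field R[i] appearing in its place. *)
Lemma conjcM (x y : C) : conjc (x * y) = conjc x * conjc y. Proof. exact: rmorphM. Qed.
Lemma conjcB (x y : C) : conjc (x - y) = conjc x - conjc y. Proof. exact: rmorphB. Qed.
Lemma conjcX (x : C) k : conjc (x ^+ k) = conjc x ^+ k. Proof. exact: rmorphXn. Qed.
Lemma conjc_sum (I : Type) (r : seq I) (F : I -> C) :
  conjc (\sum_(i <- r) F i) = \sum_(i <- r) conjc (F i).
Proof. exact: rmorph_sum. Qed.
Lemma conjc_prod (I : Type) (r : seq I) (F : I -> C) :
  conjc (\prod_(i <- r) F i) = \prod_(i <- r) conjc (F i).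
Proof. exact: rmorph_prod. Qed.
Lemma conjcR (s : R) : conjc (s%:C : C) = s%:C. Proof. exact: conjc_real. Qed.


Lemma bigO_ext m F G : (forall t, F t = G t) -> bigOC m F -> bigOC m G.
Proof. by move=> E; congr bigOC; apply/funext. Qed.

Lemma bigO_eqnear m F G : near0 (fun t => F t = G t) -> bigOC m F -> bigOC m G.
Proof. by move=> E [B H]; exists B; apply: near0_imp (near0_and E H) => t [<-]. Qed.

Lemma bigOD m F G : bigOC m F -> bigOC m G -> bigOC m (fun t => F t + G t).
Proof.
move=> [A HA] [B HB]; exists (A + B); apply: near0_imp (near0_and HA HB) => t [a b].
by rewrite mulrDl (le_trans (ler_modcD _ _)) // lerD.
Qed.

Lemma bigOM m k F G : bigOC m F -> bigOC k G -> bigOC (m + k) (fun t => F t * G t).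
Proof.
move=> [A HA] [B HB]; exists (A * B); apply: near0_imp (near0_and HA HB) => t [a b].
rewrite modcM (le_trans (ler_pM (modc_ge0 _) (modc_ge0 _) a b)) // exprD.
by rewrite mulrACA.
Qed.

Lemma bigO_conj m F : bigOC m F -> bigOC m (fun t => conjc (F t)).
Proof. by move=> [A HA]; exists A; apply: near0_imp HA => t; rewrite modcJ. Qed.

Lemma bigOW m k F : (m <= k)%N -> bigOC k F -> bigOC m F.
Proof.
move=> mk [A HA]; exists `|A|.
have n1 : near0 (fun t : C => modc t <= 1) by exists 1 => // t /ltW.
apply: near0_imp (near0_and HA n1) => t [a t1]; rewrite (le_trans a) //.
rewrite (le_trans (ler_wpM2r _ (ler_norm A))) ?exprn_ge0 ?modc_ge0 //.
by rewrite ler_wpM2l // -(subnK mk) exprD ler_piMl ?exprn_ge0 ?modc_ge0 // exprn_ile1 ?modc_ge0.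
Qed.

Lemma bigO_cst c : bigOC 0 (fun=> c : C).
Proof. by exists (modc c); exists 1 => // t _; rewrite expr0 mulr1. Qed.

Lemma bigO_cont F : ccont F 0 -> bigOC 0 F.
Proof.
move=> /(_ 1 ltr01) [r r0 Hr]; exists (1 + modc (F 0)); exists r => // t tr.
rewrite expr0 mulr1 -[F t](subrK (F 0)) (le_trans (ler_modcD _ _)) // lerD2r.
by have := Hr _ tr; rewrite add0r.
Qed.

Lemma bigO_horner (p : {poly C}) : bigOC 0 (horner p).
Proof. exact: bigO_cont (cderiv_cont (cderiv_horner p 0)). Qed.

Lemma bigO_hol F : hol F -> bigOC 0 F.
Proof. by move=> /near0_here [d D]; exact: bigO_cont (cderiv_cont D). Qed.

Lemma bigO_coef0 (p : {poly C}) m : (forall j, (j < m)%N -> p`_j = 0) -> bigOC m (horner p).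
Proof.
elim: m p => [|m IH] p H; first exact: bigO_horner.
have /factor_theorem [q pq] : root p 0 by rewrite rootE horner_coef0 H.
rewrite subr0 in pq.
have Hq : bigOC m (horner q) by apply: IH => j jm; have := H j.+1 jm; rewrite pq coefMX.
have H1 : bigOC 1 (id : C -> C) by exists 1; exists 1 => // t _; rewrite expr1 mul1r.
rewrite -addn1; apply: bigO_ext (bigOM Hq H1) => t.
by rewrite pq hornerM hornerX.
Qed.

(** Boundedness of both sides is included to make the relation compatible with
    products. *)
Definition cong m F G := [/\ bigOC m (fun t => F t - G t), bigOC 0 F & bigOC 0 G].

Lemma cong_cst m (c : C) : cong m (fun=> c) (fun=> c).
Proof.
split; try exact: bigO_cst.
by exists 0; exists 1 => // t _; rewrite subrr modc0 mul0r.
Qed.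

Lemma congD m F F' G G' : cong m F F' -> cong m G G' ->
  cong m (fun t => F t + G t) (fun t => F' t + G' t).
Proof.
move=> [a1 a2 a3] [b1 b2 b3]; split; [|exact: (bigOD (m := 0))|exact: (bigOD (m := 0))].
by apply: bigO_ext (bigOD a1 b1) => t; ring.
Qed.

Lemma congM m F F' G G' : cong m F F' -> cong m G G' ->
  cong m (fun t => F t * G t) (fun t => F' t * G' t).
Proof.
move=> [a1 a2 a3] [b1 b2 b3].
split; [|exact: (bigOM (m := 0) (k := 0))|exact: (bigOM (m := 0) (k := 0))].
have c1 := bigOM a2 b1; have c2 := bigOM a1 b3; rewrite add0n in c1; rewrite addn0 in c2.
by apply: bigO_ext (bigOD c1 c2) => t; ring.
Qed.

Lemma cong_conj m F F' : cong m F F' -> cong m (fun t => conjc (F t)) (fun t => conjc (F' t)).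
Proof.
move=> [a1 a2 a3]; split; try exact: bigO_conj.
by apply: bigO_ext (bigO_conj a1) => t; rewrite conjcB.
Qed.

Lemma congX m F F' k : cong m F F' -> cong m (fun t => F t ^+ k) (fun t => F' t ^+ k).
Proof.
move=> H; elim: k => [|k IH]; first exact: cong_cst.
have E (W : C -> C) : (fun t => W t ^+ k.+1) = (fun t => W t * W t ^+ k).
  by apply/funext => t; rewrite exprS.
by rewrite !E; exact: congM.
Qed.

Lemma cong_prod (I : Type) (r : seq I) m (F F' : I -> C -> C) :
  (forall i, cong m (F i) (F' i)) ->
  cong m (fun t => \prod_(i <- r) F i t) (fun t => \prod_(i <- r) F' i t).
Proof.
move=> H; elim: r => [|i r IH].
  have E (W : I -> C -> C) : (fun t => \prod_(i <- [::]) W i t) = (fun=> 1).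
    by apply/funext => t; rewrite big_nil.
  by rewrite !E; exact: cong_cst.
have E (W : I -> C -> C) : (fun t => \prod_(j <- i :: r) W j t)
    = (fun t => W i t * \prod_(j <- r) W j t).
  by apply/funext => t; rewrite big_cons.
by rewrite !E; exact: congM.
Qed.

Lemma cong_sum (I : Type) (r : seq I) m (F F' : I -> C -> C) :
  (forall i, cong m (F i) (F' i)) ->
  cong m (fun t => \sum_(i <- r) F i t) (fun t => \sum_(i <- r) F' i t).
Proof.
move=> H; elim: r => [|i r IH].
  have E (W : I -> C -> C) : (fun t => \sum_(i <- [::]) W i t) = (fun=> 0).
    by apply/funext => t; rewrite big_nil.
  by rewrite !E; exact: cong_cst.
have E (W : I -> C -> C) : (fun t => \sum_(j <- i :: r) W j t)
    = (fun t => W i t + \sum_(j <- r) W j t).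
  by apply/funext => t; rewrite big_cons.
by rewrite !E; exact: congD.
Qed.

Lemma cong_taylor F m : hol F -> cong m F (horner (tpoly F m)).
Proof.
by move=> hF; split; [exact: hol_taylor | exact: bigO_hol | exact: bigO_horner].
Qed.

Section TwoVariablePolynomials.
Context (I : Type) (r : seq I) (c : I -> C) (A B : I -> {poly C}).

(** A polynomial in t and its conjugate is kept as a sum of products of a holomorphic
    and an antiholomorphic factor, the form in which substitution produces it. *)
Definition bival (t : C) : C := \sum_(i <- r) c i * (A i).[t] * conjc (B i).[t].

Definition bicoef a b : C := \sum_(i <- r) c i * (A i)`_a * conjc (B i)`_b.

Definition bigO_lines m (F : C -> C) : Prop := forall v, exists K : R,
  near0R (fun s => modc (F (s%:C * v)) <= K * `|s| ^+ m).

Lemma real_poly0 (p : {poly C}) (e : R) : 0 < e ->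
  (forall s : R, 0 < s < e -> p.[s%:C] = 0) -> p = 0.
Proof.
move=> e0 H; apply/polyP => j; rewrite coef0.
apply: (@poly_bigO R p j.+1 0 e) => // s /H ->.
by rewrite modc0 mul0r.
Qed.

(** On the line v = 1 + i y the sum is a polynomial in y with infinitely many zeros,
    so it also vanishes at the complex y for which 1 + i y and 1 - i y are in the
    ratio w, for arbitrary w. This leaves the polynomial with coefficients W a,
    evaluated at w. *)
Lemma homogeneous_uniq (W : nat -> C) j :
  (forall v : C, \sum_(a < j.+1) W a * v ^+ a * conjc v ^+ (j - a) = 0) ->
  forall a, (a <= j)%N -> W a = 0.
Proof.
move=> H.
pose q : {poly C} := \sum_(a < j.+1)
  (W a)%:P * (1 + 'i%:P * 'X) ^+ a * (1 - 'i%:P * 'X) ^+ (j - a).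
have q0 : q = 0.
  apply: (@real_poly0 _ 1) => // s _; rewrite -[RHS](H (Complex 1 s)) /q.
  have v1 : 1 + 'i * s%:C = Complex 1 s :> C.
    by apply/eqP; rewrite eq_complex /=; apply/andP; split; apply/eqP; ring.
  have v2 : 1 - 'i * s%:C = conjc (Complex 1 s) :> C.
    by apply/eqP; rewrite eq_complex /=; apply/andP; split; apply/eqP; ring.
  rewrite horner_sum; apply: eq_bigr => a _.
  rewrite !hornerM !horner_exp !(hornerD, hornerN, hornerM, hornerX, hornerC).
  by rewrite v1 v2.
have w0 : (\poly_(a < j.+1) W a) = 0.
  apply: (@real_poly0 _ 1) => // s /andP[s0 _].
  pose w := s%:C; have w1 : w + 1 != 0.
    by rewrite -(rmorph1 (real_complex R)) -rmorphD -modc_gt0 modcR normr_gt0 lt0r_neq0 // addr_gt0.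
  (* the parameter y at which (1 + i y) / (1 - i y) = w *)
  have : q.['i * - ((w - 1) / (w + 1))] = 0 by rewrite q0 horner0.
  rewrite /q horner_sum => E.
  have f0 : (2 / (w + 1)) ^+ j != 0 by rewrite expf_neq0 // mulf_neq0 ?invr_neq0 // pnatr_eq0.
  apply: (mulfI f0); rewrite mulr0 -[RHS]E horner_poly mulr_sumr; apply: eq_bigr => a _.
  rewrite !hornerM !horner_exp !(hornerD, hornerN, hornerM, hornerX, hornerC).
  have i2 (x : C) : 'i * ('i * x) = - x by rewrite mulrA -expr2 sqr_i mulN1r.
  rewrite i2 opprK.
  have -> : 1 + (w - 1) / (w + 1) = w * (2 / (w + 1)) by field.
  have -> : 1 - (w - 1) / (w + 1) = 2 / (w + 1) by field.
  have aj : (a <= j)%N by rewrite -ltnS.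
  have fj : (2 / (w + 1)) ^+ j = (2 / (w + 1)) ^+ a * (2 / (w + 1)) ^+ (j - a).
    by rewrite -exprD subnKC.
  rewrite fj [(w * _) ^+ a]exprMn.
  by move: (W a) (w ^+ a) ((2 / (w + 1)) ^+ a) ((2 / (w + 1)) ^+ (j - a)) => x y z u; ring.
by move=> a aj; have := coef_poly j.+1 W a; rewrite w0 coef0 ltnS aj.
Qed.

(** Along the real line through v the function is a polynomial in s whose coefficient
    of s^j is the part of bidegree (a, j - a), summed over a, at v. *)
Lemma bival_uniq m : bigO_lines m bival -> forall a b, (a + b < m)%N -> bicoef a b = 0.
Proof.
move=> H a b ab; pose j := (a + b)%N.
suff : forall a, (a <= j)%N -> bicoef a (j - a) = 0.
  by move=> /(_ a (leq_addr _ _)); rewrite /j addKn.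
apply: homogeneous_uniq => v; have [K [e e0 HK]] := H v.
pose sA i : {poly C} := \poly_(k < size (A i)) ((A i)`_k * v ^+ k).
pose sB i : {poly C} := \poly_(k < size (B i)) (conjc (B i)`_k * conjc v ^+ k).
pose p := \sum_(i <- r) (c i)%:P * sA i * sB i.
have pE (s : R) : p.[s%:C] = bival (s%:C * v).
  rewrite /p /bival horner_sum; apply: eq_bigr => i _.
  rewrite !hornerM hornerC !horner_poly !horner_coef; congr (_ * _ * _).
    by apply: eq_bigr => k _; rewrite exprMn mulrAC mulrA.
  rewrite conjc_sum; apply: eq_bigr => k _.
  by rewrite !(conjcM, conjcX) conjcR exprMn mulrAC mulrA.
have := @poly_bigO R p m K e e0 _ j ab.
have -> : p`_j = \sum_(a0 < j.+1) bicoef a0 (j - a0) * v ^+ a0 * conjc v ^+ (j - a0).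
  rewrite /p coef_sum; under eq_bigr do rewrite -mulrA coefCM coefM mulr_sumr.
  rewrite exchange_big /=; apply: eq_bigr => k _; rewrite /bicoef !mulr_suml.
  apply: eq_bigr => i _.
  have cA l : (sA i)`_l = (A i)`_l * v ^+ l.
    by rewrite coef_poly; case: ltnP => // h; rewrite nth_default ?mul0r.
  have cB l : (sB i)`_l = conjc (B i)`_l * conjc v ^+ l.
    by rewrite coef_poly; case: ltnP => // h; rewrite nth_default ?conjc0 ?mul0r.
  by rewrite cA cB; ring.
apply=> s /andP[s0 se].
have sn : `|s| = s by rewrite ger0_norm // ltW.
by have := HK s; rewrite sn pE => /(_ se).
Qed.

End TwoVariablePolynomials.

Lemma bigO_lines_of m F : bigOC m F -> bigO_lines m F.
Proof.
move=> [K HK] v; exists (K * modc v ^+ m).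
apply: near0R_imp (near0_line v HK) => s.
by rewrite modcM modcR exprMn [_ ^+ m * _]mulrC mulrA.
Qed.

Lemma bigO_linesD m F G : bigO_lines m F -> bigO_lines m G -> bigO_lines m (fun t => F t + G t).
Proof.
move=> HF HG v; have [A a] := HF v; have [B b] := HG v; exists (A + B).
apply: near0R_imp (near0R_and a b) => s [x y].
by rewrite mulrDl (le_trans (ler_modcD _ _)) // lerD.
Qed.

Lemma bigO_lines_ext m F G : (forall t, F t = G t) -> bigO_lines m F -> bigO_lines m G.
Proof. by move=> E; congr bigO_lines; apply/funext. Qed.

(** A is a series in t^p up to t^2p as far as products can see: in a product of such
    series, terms strictly between t^p and t^2p never contribute to t^p or t^2p,
    because the cofactor has no term strictly between 1 and t^p. *)
Definition ramified p (A B : {poly C}) : Prop :=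
  [/\ A`_0 = B`_0, A`_p = B`_1, A`_(p + p) = B`_2 & forall l, (0 < l < p)%N -> A`_l = 0].

Lemma ramifiedC p c : (0 < p)%N -> ramified p c%:P c%:P.
Proof.
move=> p0; split=> // [||l /andP[l0 _]]; rewrite !coefC /=.
- by rewrite gtn_eqF.
- by rewrite gtn_eqF // addn_gt0 p0.
- by rewrite gtn_eqF.
Qed.

Lemma ramifiedD p A B A' B' : ramified p A B -> ramified p A' B' -> ramified p (A + A') (B + B').
Proof.
move=> [a0 a1 a2 a3] [b0 b1 b2 b3]; split; rewrite ?coefD ?a0 ?a1 ?a2 ?b0 ?b1 ?b2 // => l lp.
by rewrite coefD a3 // b3 // addr0.
Qed.

Lemma ramifiedM p A B A' B' : (0 < p)%N ->
  ramified p A B -> ramified p A' B' -> ramified p (A * A') (B * B').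
Proof.
move=> p0 [a0 a1 a2 a3] [b0 b1 b2 b3]; split.
- by rewrite !coefM !big_ord1 a0 b0.
- rewrite coefM (bigD1 ord0) //= (bigD1 ord_max) /=; last by rewrite -val_eqE /= -lt0n.
  rewrite subn0 subnn big1 ?addr0 => [|k /andP[k0 kp]].
    by rewrite coefM !big_ord_recl big_ord0 /= a0 a1 b0 b1 addr0.
  rewrite a3 ?mul0r // lt0n k0 /= ltn_neqAle kp /= -ltnS; exact: ltn_ord.
- have h1 : (p < (p + p).+1)%N by rewrite ltnS leq_addr.
  rewrite coefM (bigD1 ord0) //= (bigD1 (Ordinal h1)) /=; last by rewrite -val_eqE /= -lt0n.
  rewrite (bigD1 ord_max) /=; last first.
    by rewrite -!val_eqE /= -lt0n addn_gt0 p0 /= -[X in _ != X]addn0 eqn_add2l -lt0n.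
  rewrite subn0 subnn addnK big1 ?addr0 => [|k /andP[/andP[k0 kp] k2]].
    by rewrite coefM !big_ord_recl big_ord0 /= a0 a1 a2 b0 b1 b2 addr0.
  have k0' : (0 < k)%N by rewrite lt0n.
  have [kltp|] := ltnP k p; first by rewrite a3 ?mul0r // k0'.
  rewrite leq_eqVlt => /orP[/eqP E|pk]; first by rewrite -val_eqE /= -E eqxx in kp.
  have k2' : (k < p + p)%N.
    by rewrite ltn_neqAle -ltnS ltn_ord andbT; move: k2; rewrite -val_eqE.
  by rewrite [X in _ * X]b3 ?mulr0 // subn_gt0 k2' /= ltn_subLR ?ltn_add2r // ltnW.
move=> l /andP[l0 lp]; rewrite coefM big1 // => k _.
have [k0|k0] := posnP k; last by rewrite a3 ?mul0r // k0 (leq_ltn_trans _ lp) // -ltnS.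
by rewrite [X in _ * X]b3 ?mulr0 // k0 subn0 l0.
Qed.

End Congruence.

(** * Evaluation of polynomials along polynomial curves *)

Section PolynomialEvaluation.
Context {R : realType} {n : nat}.
Local Notation C := R[i].
Local Notation Cn := 'rV[C]_n.
Implicit Types (h : mpoly n C) (g : mpoly (n + n) C) (P Q : 'I_n -> {poly C}).

Definition evalp h P : {poly C} := mmap polyC P h.

Definition pcurve P (t : C) : Cn := \row_j (P j).[t].

Lemma evalp_horner h P t : (evalp h P).[t] = heval h (pcurve P t).
Proof.
rewrite /evalp /heval /meval /mmap horner_sum; apply: eq_bigr => m _.
rewrite hornerM hornerC /mmap1 horner_prod; congr (_ * _); apply: eq_bigr => j _.
by rewrite horner_exp mxE.
Qed.

Lemma heval_cong M h (z : C -> Cn) P : (forall j, cong M (coordf z j) (horner (P j))) ->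
  cong M (fun t => heval h (z t)) (horner (evalp h P)).
Proof.
move=> H.
have -> : horner (evalp h P) = fun t => \sum_(m <- msupp h) mcoeff m h * \prod_j (P j).[t] ^+ m j.
  apply/funext => t; rewrite evalp_horner /heval mevalE; apply: eq_bigr => m _.
  by congr (_ * _); apply: eq_bigr => j _; rewrite mxE.
have -> : (fun t => heval h (z t)) =
    fun t => \sum_(m <- msupp h) mcoeff m h * \prod_j coordf z j t ^+ m j.
  by apply/funext => t; rewrite /heval mevalE.
apply: cong_sum => m; apply: congM; first exact: cong_cst.
by apply: cong_prod => j; exact: congX.
Qed.

Lemma ramifiedX p (A B : {poly C}) k : (0 < p)%N -> ramified p A B -> ramified p (A ^+ k) (B ^+ k).
Proof.
move=> p0 H; elim: k => [|k IH]; first by rewrite !expr0 -polyC1; exact: ramifiedC.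
by rewrite !exprS; exact: ramifiedM.
Qed.

Lemma ramified_prod (I : Type) (r : seq I) p (F F' : I -> {poly C}) : (0 < p)%N ->
  (forall i, ramified p (F i) (F' i)) ->
  ramified p (\prod_(i <- r) F i) (\prod_(i <- r) F' i).
Proof.
move=> p0 H; elim: r => [|i r IH]; first by rewrite !big_nil -polyC1; exact: ramifiedC.
by rewrite !big_cons; exact: ramifiedM.
Qed.

Lemma ramified_sum (I : Type) (r : seq I) p (F F' : I -> {poly C}) : (0 < p)%N ->
  (forall i, ramified p (F i) (F' i)) ->
  ramified p (\sum_(i <- r) F i) (\sum_(i <- r) F' i).
Proof.
move=> p0 H; elim: r => [|i r IH]; first by rewrite !big_nil -polyC0; exact: ramifiedC.
by rewrite !big_cons; exact: ramifiedD.
Qed.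

Lemma evalp_ramified p h P Q : (0 < p)%N -> (forall j, ramified p (P j) (Q j)) ->
  ramified p (evalp h P) (evalp h Q).
Proof.
move=> p0 H; apply: ramified_sum => // m; apply: ramifiedM => //; first exact: ramifiedC.
by apply: ramified_prod => // j; exact: ramifiedX.
Qed.

Definition holp P (m : multinom (n + n)) : {poly C} := \prod_j P j ^+ m (lshift n j).
Definition antip P (m : multinom (n + n)) : {poly C} := \prod_j P j ^+ m (rshift n j).

Lemma zzbar_evalE g (x : Cn) : zzbar_eval g x = \sum_(m <- msupp g)
  mcoeff m g * (\prod_j x 0 j ^+ m (lshift n j)) * conjc (\prod_j x 0 j ^+ m (rshift n j)).
Proof.
rewrite /zzbar_eval mevalE; apply: eq_bigr => m _; rewrite -mulrA big_split_ord /=.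
congr (_ * (_ * _)); first by apply: eq_bigr => j _; rewrite (unsplitK (inl j)).
rewrite conjc_prod; apply: eq_bigr => j _.
by rewrite (unsplitK (inr j)) conjcX.
Qed.

Definition zzval g P := bival (msupp g) (fun m => mcoeff m g) (holp P) (antip P).
Definition zzcoef g P := bicoef (msupp g) (fun m => mcoeff m g) (holp P) (antip P).

Lemma zzbar_cong M g (z : C -> Cn) P : (forall j, cong M (coordf z j) (horner (P j))) ->
  cong M (fun t => zzbar_eval g (z t)) (zzval g P).
Proof.
move=> H.
have -> : (fun t => zzbar_eval g (z t)) = fun t => \sum_(m <- msupp g)
    mcoeff m g * (\prod_j coordf z j t ^+ m (lshift n j))
      * conjc (\prod_j coordf z j t ^+ m (rshift n j)).
  by apply/funext => t; rewrite zzbar_evalE.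
have -> : zzval g P = fun t => \sum_(m <- msupp g)
    mcoeff m g * (\prod_j (P j).[t] ^+ m (lshift n j))
      * conjc (\prod_j (P j).[t] ^+ m (rshift n j)).
  apply/funext => t; apply: eq_bigr => m _; rewrite !horner_prod.
  by congr (_ * _ * conjc _); apply: eq_bigr => j _; rewrite horner_exp.
apply: cong_sum => m; apply: congM; first apply: congM; first exact: cong_cst.
  by apply: cong_prod => j; exact: congX.
by apply: cong_conj; apply: cong_prod => j; exact: congX.
Qed.

Lemma prod_coef0 P (e : 'I_n -> nat) i : (forall j, (P j)`_0 = 0) -> e i != 0%N ->
  (\prod_j P j ^+ e j)`_0 = 0.
Proof.
move=> P0 ei; rewrite -horner_coef0 horner_prod (bigD1 i) //= horner_exp horner_coef0 P0.
by rewrite expr0n (negbTE ei) mul0r.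
Qed.

(** Each of the two factors of a mixed monomial contains at least one coordinate. *)
Lemma mixed_coef0 g P m : mixed g -> (forall j, (P j)`_0 = 0) -> m \in msupp g ->
  (holp P m)`_0 = 0 /\ (antip P m)`_0 = 0.
Proof. by move=> mg P0 /mg [[i mi] [j mj]]; split; apply: prod_coef0; eassumption. Qed.

(** The coefficient of bidegree (i, j) only involves the coefficients of t^i and t^j of
    the two factors of each monomial. *)
Lemma zzcoef_ramified g p P Q i j : (0 < p)%N -> (forall k, ramified p (P k) (Q k)) ->
  (i <= 2)%N -> (j <= 2)%N -> zzcoef g P (p * i) (p * j) = zzcoef g Q i j.
Proof.
move=> p0 H i2 j2; apply: eq_bigr => m _.
have S (A B : {poly C}) l : ramified p A B -> (l <= 2)%N -> A`_(p * l) = B`_l.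
  move=> [a0 a1 a2 _]; case: l => [|[|[|//]]] _; rewrite ?muln0 ?muln1 ?a0 //.
  by rewrite muln2 -addnn a2.
rewrite (S (holp P m) (holp Q m)) ?(S (antip P m) (antip Q m)) //;
  by apply: ramified_prod => // k; exact: ramifiedX.
Qed.

Definition linep (x : Cn) i (j : 'I_n) : {poly C} := (x 0 j)%:P + (j == i)%:R *: 'X.

Lemma linep_curve x i s : pcurve (linep x i) s = x + s *: delta_mx 0 i.
Proof.
apply/rowP => j; rewrite !mxE hornerD hornerC hornerZ hornerX eqxx andTb.
by rewrite mulrC eq_sym.
Qed.

Lemma linep_deriv x i j : deriv (linep x i j) = (j == i)%:R.
Proof. by rewrite derivD derivC derivZ derivX add0r scaler_nat. Qed.

(** Uniform in x, so that [small_root] applies with one constant. *)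
Lemma size_line_bound h i : exists D : nat, forall x, (size (evalp h (linep x i)) <= D)%N.
Proof.
have sM (p q : {poly C}) a b : (size p <= a -> size q <= b -> size (p * q)%R <= a + b)%N.
  by move=> pa qb; rewrite (leq_trans (size_polyMleq _ _)) // (leq_trans (leq_pred _)) // leq_add.
have sP k : exists D : nat, forall x j, (size (linep x i j ^+ k) <= D)%N.
  elim: k => [|k [D HD]]; first by exists 1%N => x j; rewrite expr0 size_poly1.
  exists (2 + D)%N => x j; rewrite exprS; apply: sM => //.
  rewrite (leq_trans (size_polyD _ _)) // geq_max (leq_trans (size_polyC_leq1 _)) //.
  by rewrite (leq_trans (size_scale_leq _ _)) // size_polyX.
have sm (m : multinom n) : exists D : nat, forall x, (size (mmap1 (linep x i) m) <= D)%N.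
  rewrite /mmap1; elim: (index_enum _) => [|j r [D HD]].
    by exists 1%N => x; rewrite big_nil size_poly1.
  by have [E HE] := sP (m j); exists (E + D)%N => x; rewrite big_cons; exact: sM.
rewrite /evalp /mmap; elim: (msupp h) => [|m r [D HD]].
  by exists 0%N => x; rewrite big_nil size_poly0.
have [E HE] := sm m; exists (maxn (1 + E) D) => x; rewrite big_cons.
rewrite (leq_trans (size_polyD _ _)) // geq_max !leq_max HD orbT andbT.
by rewrite sM // size_polyC_leq1.
Qed.

Lemma evalp_line_deriv h x i : (deriv (evalp h (linep x i))).[0] = heval (mderiv i h) x.
Proof.
have x0 : pcurve (linep x i) 0 = x by rewrite linep_curve scale0r addr0.
rewrite -{2}x0 -evalp_horner; congr (_.[0]).
have L (r : seq (multinom n)) (F : multinom n -> mpoly n C) :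
    mmap polyC (linep x i) (\sum_(m <- r) F m) = \sum_(m <- r) mmap polyC (linep x i) (F m).
  by rewrite raddf_sum.
have dh : mderiv i h = \sum_(m <- msupp h) ((m i)%:R * mcoeff m h) *: mpolyX C (mnm_sub m (mnm1 i)).
  by [].
rewrite dh /evalp L {1}/mmap raddf_sum; apply: eq_bigr => m _.
rewrite mmapZ mmapX /= derivM derivC mul0r add0r polyCM [_%:P * _%:P]mulrC -mulrA; congr (_ * _).
rewrite /mmap1 (bigD1 i) //= derivM.
have -> : deriv (\prod_(j < n | j != i) linep x i j ^+ m j) = 0.
  rewrite (_ : \prod_(j < n | j != i) _ = (\prod_(j < n | j != i) x 0 j ^+ m j)%:P) ?derivC //.
  rewrite rmorph_prod; apply: eq_bigr => j /negbTE ji.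
  by rewrite /linep ji scale0r addr0 rmorphXn.
rewrite mulr0 addr0 deriv_exp linep_deriv eqxx mul1r.
rewrite [in RHS](bigD1 i) //= mnmBE mnm1E eqxx subn1 mulrA; congr (_ * _).
  by rewrite -mulr_natl polyC_natr.
by apply: eq_bigr => j ji; rewrite mnmBE mnm1E eq_sym (negbTE ji) subn0.
Qed.

End PolynomialEvaluation.

Section SmallRoot.
Context {R : realType}.
Local Notation C := R[i].

(** P'/P is the sum of the 1 / (X - z) over the roots z. *)
Lemma log_deriv_bound (r : seq C) : (forall z, z \in r -> z != 0) ->
  modc (deriv (\prod_(z <- r) ('X - z%:P))).[0]
    <= modc (\prod_(z <- r) ('X - z%:P)).[0] * \sum_(z <- r) (modc z)^-1.
Proof.
elim: r => [|z r IH] H; first by rewrite !big_nil -polyC1 derivC horner0 modc0 mulr0.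
have z0 : z != 0 by rewrite H // mem_head.
have := IH (fun w wr => H w (mem_behead (s := z :: r) wr)).
rewrite !big_cons derivM derivB derivX derivC subr0 mul1r.
set Q := \prod_(w <- r) _; set S := \sum_(w <- r) _ => le.
rewrite hornerD !hornerM hornerD hornerN hornerX hornerC sub0r.
rewrite (le_trans (ler_modcD _ _)) // !modcM modcN mulrDr lerD //.
  by rewrite mulrAC divff ?mul1r // modc_eq0.
by rewrite -mulrA ler_wpM2l ?modc_ge0.
Qed.

(** If all roots were larger, the logarithmic derivative at 0, the sum of at most D
    terms 1/|z|, would be smaller than |P'(0)| / |P(0)|. *)
Lemma small_root (P : {poly C}) (D : nat) : (size P <= D)%N -> (deriv P).[0] != 0 ->
  exists2 s, P.[s] = 0 & modc s * modc (deriv P).[0] <= 2 * D%:R * modc P.[0].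
Proof.
move=> sP d0; have [P0|P0] := eqVneq P.[0] 0.
  by exists 0 => //; rewrite P0 modc0 mul0r mulr0.
have Pn0 : P != 0 by apply: contraNneq P0 => ->; rewrite horner0.
have [r Pr] := closed_field_poly_normal P.
have lc : lead_coef P != 0 by rewrite lead_coef_eq0.
have rootr z : z \in r -> P.[z] = 0.
  move=> zr; apply/rootP; rewrite Pr rootZ // root_prod_XsubC //.
have rn0 z : z \in r -> z != 0.
  by move=> /rootr E; apply: contraNneq P0 => z0; rewrite z0 in E; rewrite E.
have szr : (size r < size P)%N by rewrite Pr size_scale // size_prod_XsubC.
set a := modc P.[0]; set b := modc (deriv P).[0].
have a0 : 0 < a by rewrite modc_gt0.
have b0 : 0 < b by rewrite modc_gt0.
have D0 : 0 < D%:R :> R by rewrite ltr0n (leq_trans _ sP) // (leq_trans _ szr).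
case: (boolP (has (fun z => modc z * b <= 2 * D%:R * a) r)) => [/hasP [z zr le]|/hasPn H].
  by exists z => //; exact: rootr.
have bS : b <= a * \sum_(z <- r) (modc z)^-1.
  rewrite /a /b Pr derivZ !hornerZ !modcM -mulrA ler_wpM2l ?modc_ge0 //.
  exact: log_deriv_bound.
have Sle : \sum_(z <- r) (modc z)^-1 <= (size r)%:R * (b / (2 * D%:R * a)).
  have k0 z : z \in r -> (modc z)^-1 <= b / (2 * D%:R * a).
    move=> zr; have := H z zr; rewrite -ltNge => lt.
    have z0 : 0 < modc z by rewrite modc_gt0 rn0.
    rewrite ler_pdivlMr ?mulr_gt0 // mulrC ler_pdivrMr // [b * _]mulrC; exact: ltW.
  elim: (r) k0 => [|z r' IH'] k0; first by rewrite big_nil mul0r.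
  rewrite big_cons /= -natr1 mulrDl mul1r addrC lerD //; last by rewrite k0 // mem_head.
  by apply: IH' => w wr; rewrite k0 // in_cons wr orbT.
have : a * ((size r)%:R * (b / (2 * D%:R * a))) <= b / 2.
  have -> : a * ((size r)%:R * (b / (2 * D%:R * a))) = b / 2 * ((size r)%:R / D%:R).
    by field; rewrite !gt_eqF.
  rewrite ler_piMr ?divr_ge0 ?(ltW b0) // ler_pdivrMr // mul1r ler_nat.
  by rewrite (leq_trans (ltnW szr)).
move=> le2; have := le_trans bS (le_trans (ler_wpM2l (ltW a0) Sle) le2).
lra.
Qed.

End SmallRoot.

(** * Retraction of curves onto a complex hypersurface *)

Section Retraction.
Context {R : realType}.
Local Notation C := R[i].

Lemma differentiable_near (m k : nat) (f : 'rV[C]_m -> 'rV[C]_k) : holomorphic_germ f ->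
  nearV (fun x => differentiable f x).
Proof. by rewrite /holomorphic_germ => /nbhs0_nearV. Qed.

Lemma continuous_near (m k : nat) (f : 'rV[C]_m -> 'rV[C]_k) (e : R) : holomorphic_germ f ->
  0 < e -> nearV (fun x => vlt (f x - f 0) e).
Proof.
move=> /differentiable_near [r r0 df] e0.
have /differentiable_continuous c0 : differentiable f 0 by apply: df; exact: vlt0.
have e0' : 0 < e%:C :> C by rewrite (ltcR 0).
move/cvgrPdist_lt: c0 => /(_ _ e0') /nbhs0_nearV; case=> s s0 H.
by exists s => // x /H; rewrite distrC => /(vnorm_lt _ e0).
Qed.

Lemma based_comp (m k : nat) (f : 'rV[C]_m -> 'rV[C]_k) (z : C -> 'rV[C]_m) :
  f 0 = 0 -> holomorphic_germ f -> based_curve z -> based_curve (f \o z).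
Proof.
move=> f0 hf bz; have [z0 hz] := bz; split; first by rewrite /= z0.
have [r r0 df] := differentiable_near hf.
apply/nbhs0_near0; move/nbhs0_near0: hz => hz.
apply: near0_imp (near0_and hz (curve_near bz r0)) => t [dz zr].
by apply: differentiable_comp => //; exact: df.
Qed.

Lemma based_pcurve (n : nat) (Q : 'I_n -> {poly C}) : (forall j, (Q j)`_0 = 0) ->
  based_curve (pcurve Q).
Proof.
move=> Q0; split; first by apply/rowP => j; rewrite !mxE horner_coef0 Q0.
apply/holomorphic_compP => j; exists 1 => // t _; exists (deriv (Q j)).[t].
have -> : coordf (pcurve Q) j = horner (Q j) by apply/funext => u; rewrite /coordf mxE.
exact: cderiv_horner.
Qed.

(** Cauchy's estimate on each complex line; a differentiable map need not a priori
    be Lipschitz. *)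
Lemma holomorphic_lipschitz (n : nat) (F : 'rV[C]_n -> 'rV[C]_n) (rho B : R) : 0 < rho ->
  (forall x, vlt x (rho + rho) -> differentiable F x) ->
  (forall x j, vlt x (rho + rho) -> modc (F x 0 j) <= B) ->
  exists K : R, forall x i s j, vlt x rho -> modc s < rho / 8 ->
    modc (F (x + s *: delta_mx 0 i) 0 j - F x 0 j) <= K * modc s.
Proof.
move=> rho0 dF bF; have [K K0 HK] := @cauchy_estimate R.
exists (2 * (K * B / rho)) => x i s j xr sr.
have inr t : modc t < rho -> vlt (x + t *: delta_mx 0 i) (rho + rho).
  move=> tr; apply: vltD => // k; rewrite !mxE eqxx /= modcM.
  have le1 : modc ((k == i)%:R : C) <= 1 by case: (k == i); rewrite ?modc1 ?modc0.
  by rewrite (le_lt_trans _ tr) // ler_piMr ?modc_ge0.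
pose d : 'rV[C]_n := delta_mx 0 i.
pose l (t : C) : 'rV[C]_n := x + t *: d.
have dl t : differentiable l t.
  apply/differentiable_compP => k; exists (1 * d 0 k).
  have -> : coordf l k = (fun u => u * d 0 k + x 0 k).
    by apply/funext => u; rewrite /coordf /l !mxE addrC.
  rewrite -[X in cderiv _ _ X]addr0; apply: cderivD; last exact: cderiv_cst.
  have := cderivM (cderiv_id t) (cderiv_cst (d 0 k) t).
  by rewrite mulr0 addr0.
pose f t := F (l t) 0 j.
have [|| f1 [f2 H]] := HK f B rho rho0.
- move=> t tr; have dFl : differentiable (F \o l) t.
    by apply: differentiable_comp => //; apply: dF; exact: inr.
  by have /differentiable_compP /(_ j) := dFl.
- by move=> t tr; apply: bF; exact: inr.
have := @cderiv_mean_value _ f f1 (rho / 8) (K * B / rho) s sr.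
rewrite /f /l scale0r addr0; apply; first by move=> u /H [].
by move=> u us; have [] := H _ (le_lt_trans us sr).
Qed.

Section OnHypersurface.
Context (n : nat) (h : mpoly n C).
Context (phi : 'rV[C]_n.-1 -> 'rV[C]_n) (psi : 'rV[C]_n -> 'rV[C]_n.-1).
Context (coords : local_coordinates h phi psi).

Lemma psi0 : psi 0 = 0.
Proof.
have [phi0 _ _ H _] := coords; have /nbhs0_nearV [r r0 Hr] := H.
by have [_] := Hr _ (vlt0 r0); rewrite phi0.
Qed.

Lemma heval_phi : nearV (fun w => heval h (phi w) = 0).
Proof.
by have [_ _ _ /nbhs0_nearV [r r0 Hr] _] := coords; exists r => // w /Hr [].
Qed.

Lemma retract_fixes : nearV (fun x => heval h x = 0 -> phi (psi x) = x).
Proof. by have [_ _ _ _ /nbhs0_nearV H] := coords. Qed.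

Lemma retract_holomorphic : holomorphic_germ (phi \o psi).
Proof.
have [_ hphi hpsi _ _] := coords.
have [r r0 dphi] := differentiable_near hphi.
have [s s0 dpsi] := differentiable_near hpsi.
have [q q0 cpsi] := continuous_near hpsi r0.
apply/nbhs0_nearV; exists (Num.min s q); first by rewrite lt_min s0.
move=> x xr; have xs : vlt x s by apply: vlt_le xr; rewrite ge_min lexx.
have xq : vlt x q by apply: vlt_le xr; rewrite ge_min lexx orbT.
apply: differentiable_comp; first exact: dpsi.
by apply: dphi; have := cpsi _ xq; rewrite psi0 subr0.
Qed.

(** Some point of {h = 0} lies within O(t^k) of the curve: it is found on the line
    in the direction e_i, as a small root of the restriction of h. The retraction
    fixes this point and is Lipschitz, so it moves the curve by O(t^k). *)
Lemma retract_close (Q : 'I_n -> {poly C}) k i : (forall j, (Q j)`_0 = 0) ->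
  heval (mderiv i h) 0 != 0 -> (0 < k)%N ->
  (forall l, (l < k)%N -> (evalp h Q)`_l = 0) ->
  forall j, bigOC k (fun t => coordf ((phi \o psi) \o pcurve Q) j t - (Q j).[t]).
Proof.
move=> Q0 dh k0 hQ j; set F := phi \o psi.
have hF : holomorphic_germ F := retract_holomorphic.
have F0 : F 0 = 0 by rewrite /F /= psi0; have [] := coords.
have [r1 r10 dF] := differentiable_near hF.
have [r2 r20 cF] := continuous_near hF ltr01.
have [r3 r30 fixF] := retract_fixes.
pose rho := Num.min (Num.min r1 r2) r3 / 2.
have rho0 : 0 < rho by rewrite divr_gt0 // !lt_min r10 r20.
have rr : rho + rho = Num.min (Num.min r1 r2) r3 by rewrite /rho -splitr.
have [K HK] : exists K : R, forall x i s j, vlt x rho -> modc s < rho / 8 ->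
    modc (F (x + s *: delta_mx 0 i) 0 j - F x 0 j) <= K * modc s.
  apply: (@holomorphic_lipschitz _ _ _ 1 rho0) => [x|x l].
    by rewrite rr => xr; apply: dF; apply: vlt_le xr; rewrite !ge_min lexx.
  rewrite rr => xr; have /cF : vlt x r2 by apply: vlt_le xr; rewrite !ge_min lexx orbT.
  by rewrite F0 subr0 => /(_ l) /ltW.
have [D HD] := size_line_bound h i.
have bQ := based_pcurve Q0.
pose c := modc (heval (mderiv i h) 0).
have c0 : 0 < c by rewrite modc_gt0.
have c2 : 0 < c / 2 by rewrite divr_gt0.
have hO : bigOC k (fun t => heval h (pcurve Q t)).
  by apply: bigO_ext (bigO_coef0 hQ) => t; rewrite evalp_horner.
have Q00 : pcurve Q 0 = 0 by have [] := bQ.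
have dnear : near0 (fun t => c / 2 <= modc (heval (mderiv i h) (pcurve Q t))).
  have [r r0 Hr] := cderiv_cont (cderiv_horner (evalp (mderiv i h) Q) 0) c2.
  exists r => // t tr; have := Hr _ tr; rewrite add0r !evalp_horner Q00 => le.
  have := ler_modcB (heval (mderiv i h) (pcurve Q t))
    (heval (mderiv i h) (pcurve Q t) - heval (mderiv i h) 0).
  by rewrite opprB addrC subrK -/c; lra.
have [B HB] := hO.
(* bounds |s| / |t|^k for the small root s *)
pose M := 2 * D%:R * `|B| / (c / 2).
have M0 : 0 <= M by rewrite !mulr_ge0 ?invr_ge0 ?(ltW c2).
have snear : near0 (fun t => exists s, heval h (pcurve Q t + s *: delta_mx 0 i) = 0 /\
    modc s <= M * modc t ^+ k).
  apply: near0_imp (near0_and dnear HB) => t [dt Bt].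
  have d0 : (deriv (evalp h (linep (pcurve Q t) i))).[0] != 0.
    by rewrite evalp_line_deriv -modc_gt0 (lt_le_trans c2).
  have [s s0 sle] := small_root (HD (pcurve Q t)) d0.
  exists s; split; first by rewrite -linep_curve -evalp_horner.
  rewrite evalp_line_deriv evalp_horner linep_curve scale0r addr0 in sle.
  rewrite /M mulrAC ler_pdivlMr // (le_trans (ler_wpM2l (modc_ge0 s) dt)) //.
  rewrite (le_trans sle) // -!mulrA ler_wpM2l // ler_wpM2l //.
  by rewrite (le_trans Bt) // ler_wpM2r ?exprn_ge0 ?modc_ge0 // ler_norm.
have tsmall : near0 (fun t => M * modc t ^+ k < rho / 8).
  pose e := rho / 8 / (1 + M); have M1 : 0 < 1 + M by rewrite ltr_pwDl.
  have e0 : 0 < e by do 2!apply: divr_gt0 => //.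
  exists (Num.min 1 e); first by rewrite lt_min ltr01.
  move=> t; rewrite lt_min => /andP[t1 te].
  rewrite ltr_pdivlMr // in te; apply: le_lt_trans te.
  rewrite mulrC; apply: ler_pM; rewrite ?exprn_ge0 ?modc_ge0 ?lerDr //.
  by rewrite -(prednK k0) exprS ler_piMr ?modc_ge0 // exprn_ile1 ?modc_ge0 // ltW.
exists ((`|K| + 1) * M).
apply: near0_imp (near0_and snear (near0_and tsmall (curve_near bQ rho0))) => t.
move=> [[s [hs sle]] [ts Qt]].
have sr : modc s < rho / 8 by exact: le_lt_trans ts.
set x := pcurve Q t in hs Qt *; set y := x + s *: delta_mx 0 i in hs *.
have yr : vlt y (rho + rho).
  apply: vltD => // l; rewrite !mxE eqxx /= modcM.
  have le1 : modc ((l == i)%:R : C) <= 1 by case: (l == i); rewrite ?modc1 ?modc0.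
  rewrite (@le_lt_trans _ _ (modc s)) ?ler_piMr ?modc_ge0 //.
  by rewrite (lt_le_trans sr) // ler_pdivrMr // ler_peMr ?(ltW rho0) // ler1n.
have Fy : F y = y.
  by apply: fixF => //; apply: vlt_le yr; rewrite rr ge_min lexx orbT.
have l1 : modc (y 0 j - F x 0 j) <= `|K| * modc s.
  rewrite -{1}Fy; apply: le_trans (HK x i s j Qt sr) _.
  by rewrite ler_wpM2r ?modc_ge0 // ler_norm.
have E : coordf (F \o pcurve Q) j t - (Q j).[t] = (y 0 j - x 0 j) - (y 0 j - F x 0 j).
  have xj : x 0 j = (Q j).[t] by rewrite /x mxE.
  by rewrite /coordf -xj opprB [RHS]addrC addrA subrK.
rewrite E (le_trans (ler_modcB _ _)) //.
have l2 : modc (y 0 j - x 0 j) <= modc s.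
  have -> : y 0 j - x 0 j = s * (j == i)%:R by rewrite /y !mxE eqxx /= addrC addKr.
  have le1 : modc ((j == i)%:R : C) <= 1 by case: (j == i); rewrite ?modc1 ?modc0.
  by rewrite modcM ler_piMr ?modc_ge0.
rewrite (le_trans (lerD l2 l1)) // -[X in X + _]mul1r -mulrDl [1 + _]addrC -mulrA.
by rewrite ler_wpM2l // addr_ge0.
Qed.

End OnHypersurface.
End Retraction.

(** * Orders of vanishing along curves *)

Section Orders.
Context {R : realType}.
Local Notation C := R[i].

(** Either the set is empty and the value is +oo, or the minimum is attained. *)
Lemma leastP (A : set nat) :
  (least A = +oo%E :> \bar R /\ forall k, ~ A k) \/
  exists m, [/\ A m, forall k, A k -> (m <= k)%N & least A = m%:R%:E :> \bar R].
Proof.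
have [[k Ak]|nA] := pselect (exists k, A k); last first.
  left; split=> [|k Ak]; last by apply: nA; exists k.
  rewrite /least -[RHS](@ereal_inf0 R); congr ereal_inf; apply/seteqP; split=> // x [k Ak _].
  by exfalso; apply: nA; exists k.
right; have exA : exists k, `[< A k >] by exists k; apply/asboolP.
case: (ex_minnP exA) => m /asboolP Am min; exists m.
have min' j : A j -> (m <= j)%N by move=> Aj; apply: min; apply/asboolP.
split=> //; apply/eqP; rewrite eq_le; apply/andP; split.
  by apply: ereal_inf_lbound; exists m.
by apply: le_ereal_inf_tmp => _ [j Aj <-]; rewrite lee_fin ler_nat min'.
Qed.

Section OrderSmooth.
Context {V : normedModType C}.
Implicit Types (u : V -> R).

Lemma order_smooth_ge u m :
  (forall j v, (j < m)%N -> taylor_part j u v = 0) -> (m%:R%:E <= order_smooth u)%E.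
Proof.
move=> H; rewrite /order_smooth; have [[-> _]|[k [[v kv] _ ->]]] := @leastP [set j | exists v, taylor_part j u v != 0]; first exact: leey.
rewrite lee_fin ler_nat leqNgt; apply/negP => km.
by move: kv; rewrite H // eqxx.
Qed.

Lemma order_smooth_gt u m : (m%:R%:E < order_smooth u)%E ->
  forall j v, (j <= m)%N -> taylor_part j u v = 0.
Proof.
move=> H j v jm; apply/eqP; apply: contraPT H => jv; apply/negP; rewrite -leNgt.
apply: (@le_trans _ _ (j%:R%:E)); last by rewrite lee_fin ler_nat.
by apply: ereal_inf_lbound; exists j => //; exists v.
Qed.

Lemma order_smooth_eq u m : (forall j v, (j < m)%N -> taylor_part j u v = 0) ->
  (exists v, taylor_part m u v != 0) -> order_smooth u = m%:R%:E.
Proof.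
move=> H [v mv]; apply/eqP; rewrite eq_le order_smooth_ge // andbT.
by apply: ereal_inf_lbound; exists m => //; exists v.
Qed.

Lemma order_smooth_lt u m :
  (forall j v, (j < m)%N -> taylor_part j u v = 0) \/
  exists2 j, (j < m)%N & (forall i v, (i < j)%N -> taylor_part i u v = 0) /\
    exists v, taylor_part j u v != 0.
Proof.
have [[_ H]|[k [[v kv] min _]]] := @leastP [set m | exists v, taylor_part m u v != 0].
  left=> j v _; apply/eqP; apply/negPn/negP => jv; by apply: (H j); exists v.
have low i w : (i < k)%N -> taylor_part i u w = 0.
  move=> ik; apply/eqP; apply: contraTT ik => iw; rewrite -leqNgt; apply: min; by exists w.
have [km|mk] := ltnP k m; first by right; exists k => //; split=> //; exists v.
by left=> j w jm; apply: low; exact: leq_trans mk.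
Qed.

End OrderSmooth.

Lemma taylor_partE (u : C -> R) j v :
  taylor_part j u v = derive1n j (fun s : R => u (s%:C * v)) 0 / j`!%:R.
Proof. by []. Qed.

(** Vanishing of Taylor parts is exchanged for growth conditions along real lines,
    which behave well under products and perturbations. *)
Lemma Cinf_lines_vanish (u : C -> R) m : (forall v, Cinf (fun s : R => u (s%:C * v))) ->
  (forall v, bigOR m (fun s : R => u (s%:C * v))) <->
  (forall j v, (j < m)%N -> taylor_part j u v = 0).
Proof.
move=> Cu; split=> [H j v jm | H v]; first exact: Cinf_bigOR (Cu v) (H v) j jm.
apply: bigOR_eqnear (Cinf_taylor m (Cu v)); exists 1 => // s _.
by rewrite big1 ?subr0 // => j _; have := H j v (ltn_ord j); rewrite taylor_partE => ->; rewrite mul0r.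
Qed.

End Orders.

Section SmoothAlongCurves.
Context {R : realType} {n : nat}.
Local Notation C := R[i].
Local Notation Cn := 'rV[C]_n.

Definition CinfC (F : R -> C) : Prop := Cinf (fun s => Re (F s)) /\ Cinf (fun s => Im (F s)).

Lemma Cinf_ext (f g : R -> R) : (forall s, f s = g s) -> Cinf f -> Cinf g.
Proof. by move=> E; congr Cinf; apply/funext. Qed.

Lemma CinfC_cst c : CinfC (fun=> c).
Proof. by split=> m; exact: Cm_cst. Qed.

Lemma CinfCM F G : CinfC F -> CinfC G -> CinfC (fun s => F s * G s).
Proof.
move=> [F1 F2] [G1 G2]; split.
  apply: (@Cinf_ext (fun s => Re (F s) * Re (G s) + -1 * (Im (F s) * Im (G s)))).
    by move=> s; rewrite Re_mulc mulN1r.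
  by move=> m; apply: CmD; [|apply: (CmM (Cm_cst _ _))]; apply: CmM; auto.
apply: (@Cinf_ext (fun s => Re (F s) * Im (G s) + Im (F s) * Re (G s))).
  by move=> s; rewrite Im_mulc.
by move=> m; apply: CmD; apply: CmM; auto.
Qed.

Lemma CinfCD F G : CinfC F -> CinfC G -> CinfC (fun s => F s + G s).
Proof.
move=> [F1 F2] [G1 G2]; split.
  apply: (@Cinf_ext (fun s => Re (F s) + Re (G s))); first by move=> s; rewrite raddfD.
  by move=> m; apply: CmD; auto.
apply: (@Cinf_ext (fun s => Im (F s) + Im (G s))); first by move=> s; rewrite raddfD.
by move=> m; apply: CmD; auto.
Qed.

Lemma CinfC_conj F : CinfC F -> CinfC (fun s => conjc (F s)).
Proof.
move=> [F1 F2]; split.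
  by apply: Cinf_ext F1 => s; case: (F s).
apply: (@Cinf_ext (fun s => -1 * Im (F s))); first by move=> s; case: (F s) => a b /=; ring.
by move=> m; apply: (CmM (Cm_cst _ _)).
Qed.

Lemma CinfC_ext (F G : R -> C) : (forall s, F s = G s) -> CinfC F -> CinfC G.
Proof. by move=> E; congr CinfC; apply/funext. Qed.

Lemma CinfC_X F k : CinfC F -> CinfC (fun s => F s ^+ k).
Proof.
move=> H; elim: k => [|k IH]; first exact: CinfC_cst.
by apply: CinfC_ext (CinfCM H IH) => s; rewrite exprS.
Qed.

Lemma CinfC_prod (I : Type) (r : seq I) (F : I -> R -> C) :
  (forall i, CinfC (F i)) -> CinfC (fun s => \prod_(i <- r) F i s).
Proof.
move=> H; elim: r => [|i r IH]; first by apply: CinfC_ext (CinfC_cst 1) => s; rewrite big_nil.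
by apply: CinfC_ext (CinfCM (H i) IH) => s; rewrite big_cons.
Qed.

Lemma CinfC_sum (I : Type) (r : seq I) (F : I -> R -> C) :
  (forall i, CinfC (F i)) -> CinfC (fun s => \sum_(i <- r) F i s).
Proof.
move=> H; elim: r => [|i r IH]; first by apply: CinfC_ext (CinfC_cst 0) => s; rewrite big_nil.
by apply: CinfC_ext (CinfCD (H i) IH) => s; rewrite big_cons.
Qed.

Lemma CinfC_hol (F : C -> C) v : hol F -> CinfC (fun s : R => F (s%:C * v)).
Proof.
move=> hF; split=> m.
  apply: Cm_eqnear (Cm_hol_line m 1 v hF); exists 1 => // s _.
  by rewrite mul1r.
apply: Cm_eqnear (Cm_hol_line m (- 'i%C) v hF); exists 1 => // s _.
by case: (F _) => a c /=; ring.
Qed.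

Lemma Cinf_zzbar (g : mpoly (n + n) C) (z : C -> Cn) v : based_curve z ->
  Cinf (fun s : R => Re (zzbar_eval g (z (s%:C * v)))).
Proof.
move=> [_ /holomorphic_compP hz].
suff [] : CinfC (fun s : R => zzbar_eval g (z (s%:C * v))) by [].
apply: (CinfC_ext (fun s => esym (zzbar_evalE g (z (s%:C * v))))).
apply: CinfC_sum => m; apply: CinfCM; first apply: CinfCM; first exact: CinfC_cst.
  by apply: CinfC_prod => j; apply: CinfC_X; exact: (CinfC_hol v (hz j)).
by apply: CinfC_conj; apply: CinfC_prod => j; apply: CinfC_X; exact: (CinfC_hol v (hz j)).
Qed.

Lemma curve_bigO1 (z : C -> Cn) : based_curve z ->
  exists2 B : R, 0 < B & near0 (fun t => t != 0 -> vlt (z t) (B * modc t)).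
Proof.
move=> [z0 /holomorphic_compP hz].
have /choice [b Hb] : forall j, exists b : R, near0 (fun t => modc (coordf z j t) <= b * modc t).
  move=> j; have [b Hb] := hol_taylor 1 (hz j); exists b; apply: near0_imp Hb => t.
  rewrite expr1 /tpoly horner_poly big_ord1 /= fact0 divr1 expr0 mulr1.
  by rewrite /coordf z0 mxE subr0.
have S0 : 0 <= \sum_j `|b j| by rewrite sumr_ge0.
exists (1 + \sum_j `|b j|); first by rewrite ltr_pwDl.
apply: near0_imp (near0_forall Hb) => t H t0 j.
rewrite (le_lt_trans (H j)) // ltr_pM2r ?modc_gt0 //.
rewrite (le_lt_trans (ler_norm _)) // (bigD1 j) //= addrCA ltrDl ltr_pwDl //.
by rewrite sumr_ge0.
Qed.

(** Taylor's formula at z(t), a point of size O(t). *)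
Lemma jet_cong k (r : Cn -> R) (z : C -> Cn) : smooth_germ r -> based_curve z ->
  bigOC k.+1 (fun t => (r (z t))%:C - (jet k r (z t))%:C).
Proof.
move=> /smooth_germP [rho rho0 Hr] bz.
have [B [d [d0 H]]] := smooth_taylor k.+1 rho0 Hr.
have [b b0 Hb] := curve_bigO1 bz.
exists (B * b ^+ k.+1).
have tb : near0 (fun t : C => b * modc t <= d).
  exists (d / b); first by rewrite divr_gt0.
  by move=> t; rewrite ltr_pdivlMr // mulrC => /ltW.
apply: near0_imp (near0_and Hb tb) => t [Ht td].
rewrite -rmorphB modcR; have [t0|t0] := eqVneq t 0; last first.
  by rewrite (le_trans (H _ _ td (Ht t0))) // exprMn mulrA.
have [z0 _] := bz; rewrite t0 z0 modc0 expr0n mulr0 /jet big_ord_recl taylor_part0 big1 ?addr0.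
  by rewrite subrr normr0.
move=> j _; rewrite -(scale0r 0) -(rmorph0 (real_complex R)).
by rewrite (taylor_part_scale _ _ _ (fun y => Cinf_ray y rho0 Hr)) expr0n mul0r.
Qed.

(** The cofactor is bounded along the curve. *)
Lemma ideal_vanish (r h a : Cn -> R) (z : C -> Cn) m :
  smooth_germ r -> smooth_germ h -> smooth_germ a -> based_curve z ->
  (\forall x \near nbhs (0 : Cn), h x = a x * r x) ->
  (forall j v, (j < m)%N -> taylor_part j (r \o z) v = 0) ->
  forall j v, (j < m)%N -> taylor_part j (h \o z) v = 0.
Proof.
move=> sr sh sa bz /nbhs0_nearV [e e0 He].
have Cr v := Cinf_curve v sr bz; have Ch v := Cinf_curve v sh bz.
have Ca v := Cinf_curve v sa bz.
move/(Cinf_lines_vanish m Cr) => Hr; apply/(Cinf_lines_vanish m Ch) => v.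
have [A HA] := Cinf_taylor 0 (Ca v); have [B HB] := Hr v; exists (A * B).
apply: near0R_imp (near0R_and (near0R_and HA HB) (near0_line v (curve_near bz e0))).
move=> s [[+ b] zs]; rewrite big_ord0 subr0 expr0 mulr1 => a0.
by rewrite /= He // normrM -mulrA ler_pM.
Qed.

End SmoothAlongCurves.

(** * Singular and regular orders of contact *)

Section TaylorOfCurves.
Context {R : realType} {n : nat}.
Local Notation C := R[i].
Local Notation Cn := 'rV[C]_n.
Implicit Types (h : mpoly n C) (g : mpoly (n + n) C) (P : 'I_n -> {poly C}).

Definition curve_tpoly (z : C -> Cn) m (j : 'I_n) : {poly C} := tpoly (coordf z j) m.

Lemma curve_tpoly_coef z m j l : holomorphic_germ z -> (l < m)%N ->
  (curve_tpoly z m j)`_l = derive1n l z 0 0 j / l`!%:R.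
Proof.
move=> hz lm; rewrite coef_poly lm; congr (_ / _).
by have /near0_here /(_ j) := derive1n_comp l hz.
Qed.

Lemma curve_tpoly_coef0 z m j : based_curve z -> (curve_tpoly z m.+1 j)`_0 = 0.
Proof. by move=> [z0 _]; rewrite coef_poly /= fact0 divr1 /coordf z0 mxE. Qed.

Lemma curve_cong z m : holomorphic_germ z ->
  forall j, cong m (coordf z j) (horner (curve_tpoly z m j)).
Proof. by move=> /holomorphic_compP hz j; exact: cong_taylor. Qed.

(** The triples (c, A, B) stand for the summands c A(t) conj(B(t)) of 2 Re h + g
    along P. *)
Definition jet_terms h g (P : 'I_n -> {poly C}) : seq (C * {poly C} * {poly C}) :=
  (1, evalp h P, 1) :: (1, 1, evalp h P) ::
  [seq (mcoeff m g, holp P m, antip P m) | m <- msupp g].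

Definition term_c (x : C * {poly C} * {poly C}) := x.1.1.
Definition term_h (x : C * {poly C} * {poly C}) := x.1.2.
Definition term_a (x : C * {poly C} * {poly C}) := x.2.

Lemma jet_terms_val h g P t : bival (jet_terms h g P) term_c term_h term_a t =
  (evalp h P).[t] + conjc (evalp h P).[t] + zzval g P t.
Proof.
rewrite /bival /jet_terms !big_cons big_map /term_c /term_h /term_a /=.
by rewrite !hornerC conjc1 !mul1r mulr1 addrA.
Qed.

Lemma jet_terms_coef h g P a b : bicoef (jet_terms h g P) term_c term_h term_a a b =
  (evalp h P)`_a * conjc (1 : {poly C})`_b + (1 : {poly C})`_a * conjc (evalp h P)`_b
  + zzcoef g P a b.
Proof.
by rewrite /bicoef /jet_terms !big_cons big_map /term_c /term_h /term_a /= !mul1r addrA.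
Qed.

Lemma twiceRe (w : C) : (2 * Re w)%:C = w + conjc w.
Proof. by case: w => a b; apply/eqP; rewrite eq_complex /=; apply/andP; split; apply/eqP; ring. Qed.

Lemma jet_pullback k (r : Cn -> R) h g z : smooth_germ r -> jet_decomposition k r h g ->
  based_curve z ->
  bigOC k.+1 (fun t => (r (z t))%:C - bival (jet_terms h g (curve_tpoly z k.+1)) term_c term_h term_a t).
Proof.
move=> sr [jd _ _ _] bz; have [_ hz] := bz.
have ch := heval_cong h (curve_cong k.+1 hz).
have [c1 _ _] := congD (congD ch (cong_conj ch)) (zzbar_cong g (curve_cong k.+1 hz)).
apply: bigO_ext (bigOD (jet_cong k sr bz) c1) => t.
by rewrite jet_terms_val jd twiceRe; ring.
Qed.

Lemma zzbar_real k (r : Cn -> R) h g x : jet_decomposition k r h g ->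
  zzbar_eval g x = (Re (zzbar_eval g x))%:C.
Proof.
move=> [jd _ _ _]; have -> : zzbar_eval g x = (jet k r x - 2 * Re (heval h x))%:C.
  by rewrite rmorphB /= jd; ring.
by [].
Qed.

Lemma zzcoef_mixed0 g P a b : mixed g -> (forall j, (P j)`_0 = 0) -> (a * b)%N = 0%N ->
  zzcoef g P a b = 0.
Proof.
move=> mg P0 ab; rewrite /zzcoef /bicoef big_seq big1 // => m mm.
have [A0 B0] := mixed_coef0 mg P0 mm.
move/eqP: ab; rewrite muln_eq0 => /orP[/eqP ->|/eqP ->].
  by rewrite A0 mulr0 mul0r.
by rewrite B0 conjc0 mulr0.
Qed.

Lemma evalp_coef0 h P : heval h 0 = 0 -> (forall j, (P j)`_0 = 0) -> (evalp h P)`_0 = 0.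
Proof.
move=> h0 P0; rewrite -horner_coef0 evalp_horner -[RHS]h0; congr heval.
by apply/rowP => j; rewrite !mxE horner_coef0 P0.
Qed.

(** Coefficients of bidegree (a, 0) come only from h, as g is mixed and z(0) = 0;
    this disposes of h, and what remains is g. *)
Lemma high_contact k (r : Cn -> R) h g z N : smooth_germ r -> jet_decomposition k r h g ->
  based_curve z -> (N <= k.+1)%N ->
  (forall j v, (j < N)%N -> taylor_part j (r \o z) v = 0) ->
  (forall l, (l < N)%N -> (evalp h (curve_tpoly z k.+1))`_l = 0) /\
  (forall a b, (a + b < N)%N -> zzcoef g (curve_tpoly z k.+1) a b = 0).
Proof.
move=> sr jd bz Nk van; set P := curve_tpoly z k.+1.
have [_ h0 _ mg] := jd.
have P0 j : (P j)`_0 = 0 by exact: curve_tpoly_coef0.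
have L : bigO_lines N (bival (jet_terms h g P) term_c term_h term_a).
  have L1 : bigO_lines N (fun t => - ((r (z t))%:C - bival (jet_terms h g P) term_c term_h term_a t)).
    apply: bigO_lines_of; have := bigOM (bigO_cst (-1 : C)) (bigOW Nk (jet_pullback sr jd bz)).
    by apply: bigO_ext => t; rewrite mulN1r.
  have L2 : bigO_lines N (fun t => (r (z t))%:C).
    move=> v; have /(Cinf_lines_vanish N (fun v => Cinf_curve v sr bz)) H := van.
    have [B HB] := H v; exists B; apply: near0R_imp HB => s; by rewrite modcR.
  by apply: bigO_lines_ext (bigO_linesD L2 L1) => t; rewrite opprB addrCA subrr addr0.
have co := bival_uniq L.
have hl l : (l < N)%N -> (evalp h P)`_l = 0.
  case: l => [|l] lN; first exact: evalp_coef0.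
  have := co l.+1 0%N; rewrite addn0 jet_terms_coef zzcoef_mixed0 ?muln0 // !coef1.
  by rewrite conjc_nat mulr1 mul0r !addr0; exact.
split=> // a b ab.
have := co a b ab; rewrite jet_terms_coef hl ?(leq_ltn_trans _ ab) ?leq_addr //.
rewrite mul0r add0r [(evalp h P)`_b]hl ?(leq_ltn_trans _ ab) ?leq_addl //.
by rewrite conjc0 mulr0 add0r.
Qed.

End TaylorOfCurves.

Section RegularType.
Context {R : realType} {n : nat}.
Local Notation C := R[i].
Local Notation Cn := 'rV[C]_n.

Lemma order_curve_eq (z : C -> Cn) m : (forall j, (j < m)%N -> derive1n j z 0 = 0) ->
  derive1n m z 0 != 0 -> order_curve z = m%:R%:E.
Proof.
move=> H dm; rewrite /order_curve.
have [[_ E]|[k [kz min ->]]] := @leastP R [set j | derive1n j z 0 != 0].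
  by exfalso; apply: (E m).
have km : (k <= m)%N by apply: min.
have -> // : k = m; apply/eqP; rewrite eqn_leq km leqNgt; apply/negP => lt.
by move: kz => /=; rewrite H // eqxx.
Qed.

(** The curve phi o w osculates z_p t + z_2p t^2 to order two inside {h = 0}, and the
    coefficient of |t|^(2i) in g along it, for i <= 2, is that of |t|^(2ip) along z,
    which vanishes. *)
Lemma regular_shadow k (r : Cn -> R) h g phi psi (z : C -> Cn) p :
  smooth_germ r -> jet_decomposition k r h g -> local_coordinates h phi psi ->
  based_curve z -> (0 < p)%N -> (4 * p <= k)%N -> (4 <= k)%N ->
  (forall j, (j < p)%N -> derive1n j z 0 = 0) -> derive1n p z 0 != 0 ->
  (forall j v, (j < (4 * p).+1)%N -> taylor_part j (r \o z) v = 0) ->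
  exists w : C -> 'rV[C]_n.-1, [/\ based_curve w, regular_curves (phi \o w) &
    forall i, (i <= 2)%N -> zzcoef g (curve_tpoly (phi \o w) k.+1) i i = 0].
Proof.
move=> sr jd lc bz p0 pk k4 zlow zp van.
have pk' : ((4 * p).+1 <= k.+1)%N by [].
have [hl zz] := high_contact sr jd bz pk' van.
set P := curve_tpoly z k.+1 in hl zz.
have [_ hz] := bz.
have P0 j : (P j)`_0 = 0 by exact: curve_tpoly_coef0.
have lep l : (l <= 4 * p)%N -> (l < k.+1)%N by move=> lp; rewrite ltnS (leq_trans lp).
have p4 : (p <= 4 * p)%N by rewrite leq_pmull.
have pp4 : (p + p <= 4 * p)%N by rewrite addnn -mul2n leq_mul2r orbT.
have Plow j l : (l < p)%N -> (P j)`_l = 0.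
  move=> lp; rewrite curve_tpoly_coef ?zlow ?mxE ?mul0r // lep //.
  exact: leq_trans (ltnW lp) p4.
(* the regular curve z_p t + z_2p t^2 *)
pose Q j : {poly C} := (P j)`_p *: 'X + (P j)`_(p + p) *: 'X^2.
have QE j l : (Q j)`_l = (P j)`_p * (l == 1)%:R + (P j)`_(p + p) * (l == 2)%:R.
  by rewrite coefD !coefZ coefX coefXn.
have ramQ j : ramified p (P j) (Q j).
  split; rewrite ?QE /= ?mulr0 ?mulr1 ?addr0 ?add0r ?P0 //.
  by move=> l /andP[_ lp]; exact: Plow.
have Q0 j : (Q j)`_0 = 0 by rewrite QE /= !mulr0 addr0.
have [_ h0 [i dh] mg] := jd.
have [h0' h1' h2' _] := evalp_ramified h p0 ramQ.
have hQ l : (l < 3)%N -> (evalp h Q)`_l = 0.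
  case: l => [|[|[|//]]] _; rewrite -?h0' -?h1' -?h2' hl //; rewrite ltnS //.
have close := retract_close lc Q0 dh (isT : (0 < 3)%N) hQ.
have [phi0 hphi hpsi _ _] := lc.
have bw : based_curve (psi \o pcurve Q).
  by apply: based_comp hpsi (based_pcurve Q0); exact: psi0 lc.
have bG : based_curve (phi \o (psi \o pcurve Q)) by exact: based_comp phi0 hphi bw.
set G := phi \o (psi \o pcurve Q) in bG.
have [G0 hG] := bG.
(* the retraction preserves the terms of degree at most two *)
have GQ j l : (l < 3)%N -> (curve_tpoly G k.+1 j)`_l = (Q j)`_l.
  move=> l3; apply/eqP; rewrite -subr_eq0 -coefB; apply/eqP.
  have [c1 _ _] := curve_cong k.+1 hG j.
  have k3 : (3 <= k.+1)%N by rewrite ltnS (leq_trans _ k4).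
  have [B [e e0 HB]] := bigOD (bigOM (bigO_cst (-1 : C)) (bigOW k3 c1)) (close j).
  apply: (@poly_bigO _ _ 3 B e e0) l3 => s /andP[s0 se].
  have := HB s%:C; rewrite modcR gtr0_norm // => /(_ se); apply: le_trans.
  rewrite le_eqVlt; apply/orP; left; apply/eqP; congr modc.
  by rewrite hornerD hornerN /G mulN1r opprB addrA subrK.
have ramG j : ramified p (P j) (curve_tpoly G k.+1 j).
  have [a0 a1 a2 a3] := ramQ j; split=> //; by rewrite GQ.
exists (psi \o pcurve Q); split=> //.
  have [j zpj] : exists j, derive1n p z 0 0 j != 0.
    apply/not_existsP => H; move/negP: zp; apply; apply/eqP/rowP => j; rewrite mxE.
    by apply/eqP/negPn/negP => E; apply: (H j).
  have T1 : (curve_tpoly G k.+1 j)`_1 != 0.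
    rewrite GQ // QE /= mulr0 addr0 mulr1 curve_tpoly_coef ?lep //.
    by rewrite mulf_neq0 // invr_eq0 pnatr_eq0 -lt0n fact_gt0.
  split.
    split=> // /nbhs0_near0 Gz.
    have [c1 _ _] := curve_cong k.+1 hG j.
    have k2 : (2 <= k.+1)%N by rewrite ltnS (leq_trans _ k4).
    have [B [e e0 HB]] : bigOC 2 (horner (curve_tpoly G k.+1 j)).
      have := bigOM (bigO_cst (-1 : C)) (bigOW k2 c1); apply: bigO_eqnear.
      apply: near0_imp Gz => t Gt.
      have Gt0 : G t = 0 by exact: Gt.
      by rewrite /coordf Gt0 mxE sub0r mulN1r opprK.
    move/negP: T1; apply; apply/eqP; apply: (@poly_bigO _ _ 2 B e e0) => // s /andP[s0 se].
    by have := HB s%:C; rewrite modcR gtr0_norm // => /(_ se).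
  apply: (@order_curve_eq G 1) => [l|]; first by case: l.
  apply: contraNneq T1 => E; rewrite curve_tpoly_coef // ?E ?mxE ?mul0r //.
  by rewrite ltnS (leq_trans _ k4).
move=> l l2; rewrite -(zzcoef_ramified g p0 ramG l2 l2).
case: l l2 => [|l] l2; first by apply: zzcoef_mixed0; rewrite ?muln0.
apply: zz; rewrite ltnS addnn -mul2n mulnCA -[X in (_ <= X)%N]mulnC leq_mul2l.
have -> : (2 * l.+1 <= 4)%N by exact: (leq_mul (leqnn 2) l2).
by rewrite orbT.
Qed.


Lemma jet_lines (u : C -> R) m v : (forall v, Cinf (fun s : R => u (s%:C * v))) ->
  bigOR m.+1 (fun s => u (s%:C * v) - jet m u (s%:C * v)).
Proof.
move=> Cu; apply: bigOR_eqnear (Cinf_taylor m.+1 (Cu v)); exists 1 => // s _.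
congr (_ - _); apply: eq_bigr => j _.
by rewrite (taylor_part_scale _ _ _ Cu) mulrC.
Qed.

(** On {h = 0} the k-jet of r is g, so r and g have the same order along the curve, and
    the coefficient singled out by property PS is read off from any expansion of
    g. *)
Lemma PS_positive k (r : Cn -> R) h g phi psi w m : smooth_germ r ->
  jet_decomposition k r h g -> local_coordinates h phi psi ->
  PS_function (fun w => Re (zzbar_eval g (phi w))) ->
  based_curve w -> (m <= k)%N -> order_smooth (r \o (phi \o w)) = m%:R%:E ->
  exists2 l, m = l.*2 & 0 < zzcoef g (curve_tpoly (phi \o w) k.+1) l l.
Proof.
move=> sr jd lc PS bw mk om; pose u t := Re (zzbar_eval g (phi (w t))).
have [phi0 hphi _ _ _] := lc.
have bG := based_comp phi0 hphi bw; set G := phi \o w in bG om *.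
have Cu v : Cinf (fun s : R => u (s%:C * v)) := Cinf_zzbar g v bG.
have Cr v : Cinf (fun s : R => r (G (s%:C * v))) := Cinf_curve v sr bG.
have [e e0 He] := heval_phi lc.
have diff : bigOC k.+1 (fun t => (r (G t))%:C - (u t)%:C).
  apply: bigO_eqnear (jet_cong k sr bG); apply: near0_imp (curve_near bw e0) => t wt.
  have [jd' _ _ _] := jd; rewrite jd' (He _ wt) mulr0 rmorph0 add0r.
  by rewrite (zzbar_real _ jd).
have diffl v : bigOR k.+1 (fun s : R => r (G (s%:C * v)) - u (s%:C * v)).
  have [B HB] := bigO_lines_of diff v; exists B; apply: near0R_imp HB => s.
  by rewrite -rmorphB modcR.
have same j v : (j <= k)%N -> taylor_part j u v = taylor_part j (r \o G) v.
  move=> jk; rewrite !taylor_partE; apply/esym.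
  apply: (@Cinf_coef _ _ k.+1 (fun j => taylor_part j u v) (Cr v)) => //.
  apply: bigOR_eqnear (bigORD (diffl v) (Cinf_taylor k.+1 (Cu v))); exists 1 => // s _.
  by rewrite /= addrA subrK.
have ou : order_smooth u = m%:R%:E.
  have [H|[j jm [lo [v jv]]]] := order_smooth_lt (r \o G) m.+1.
    have : ((m.+1)%:R%:E <= order_smooth (r \o G))%E by exact: order_smooth_ge.
    by rewrite om lee_fin ler_nat ltnn.
  have E : order_smooth (r \o G) = j%:R%:E by apply: order_smooth_eq => //; exists v.
  have jmE : j = m by move: E; rewrite om => -[] /eqP; rewrite eqr_nat => /eqP.
  subst j; apply: order_smooth_eq; last by exists v; rewrite same.
  by move=> i v' im; rewrite same ?lo // (leq_trans (ltnW im)).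
have [l [ml [c tc cl]]] := PS w bw m ou.
exists l => //; have -> // : zzcoef g (curve_tpoly G k.+1) l l = c l l.
have [_ hG] := bG.
have lm : (l < m.+1)%N by rewrite ml -addnn ltnS leq_addr.
pose ab := [seq x : 'I_m.+1 * 'I_m.+1 <- index_enum _ | (x.1 + x.2 <= m)%N].
(* the difference of the two expansions of g along the curve *)
pose T : seq (C * {poly C} * {poly C}) :=
  [seq (c (nat_of_ord x.1) (nat_of_ord x.2), 'X^(x.1), 'X^(x.2)) | x <- ab] ++
  [seq (- mcoeff q g, holp (curve_tpoly G k.+1) q, antip (curve_tpoly G k.+1) q) | q <- msupp g].
have TV t : bival T term_c term_h term_a t = (jet m u t)%:C - zzval g (curve_tpoly G k.+1) t.
  rewrite /bival /T big_cat big_map big_map /= /term_c /term_h /term_a /=; congr (_ + _).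
    rewrite tc /ab big_filter pair_big_dep /=; apply: eq_bigr => x _.
    by rewrite !hornerXn conjcX.
  by rewrite /zzval /bival -sumrN; apply: eq_bigr => q _; rewrite !mulNr.
have L : bigO_lines m.+1 (bival T term_c term_h term_a).
  have mk1 : (m.+1 <= k.+1)%N by [].
  have [z1 _ _] := zzbar_cong g (curve_cong k.+1 hG).
  have L1 := bigO_lines_of (bigOW mk1 z1).
  have L2 : bigO_lines m.+1 (fun t => (jet m u t)%:C - (u t)%:C).
    move=> v; have [B HB] := jet_lines m v Cu; exists B; apply: near0R_imp HB => s.
    by rewrite -rmorphB modcR distrC.
  apply: bigO_lines_ext (bigO_linesD L2 L1) => t.
  rewrite TV (zzbar_real _ jd) -/(u t).
  by rewrite addrA subrK.
have llm : (l + l < m.+1)%N by rewrite ml -addnn.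
have := bival_uniq L llm.
rewrite /bicoef /T big_cat big_map big_map /= /term_c /term_h /term_a /=.
have -> : \sum_(q <- msupp g) - mcoeff q g * (holp (curve_tpoly G k.+1) q)`_l *
    conjc (antip (curve_tpoly G k.+1) q)`_l = - zzcoef g (curve_tpoly G k.+1) l l.
  by rewrite /zzcoef /bicoef -sumrN; apply: eq_bigr => q _; rewrite !mulNr.
move/eqP; rewrite subr_eq0 => /eqP <-.
pose lo : 'I_m.+1 := Ordinal lm.
rewrite /ab big_filter (bigD1 (lo, lo)) /=; last by rewrite ml -addnn.
rewrite !coefXn eqxx conjc_nat !mulr1 big1 ?addr0 // => -[x y] /= /andP[_ xy].
have [xl|xl] := eqVneq (l : nat) x; last by rewrite coefXn (negbTE xl) mulr0 mul0r.
have [yl|yl] := eqVneq (l : nat) y; last by rewrite [X in conjc X]coefXn (negbTE yl) conjc0 mulr0.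
by case/negP: xy; rewrite xpair_eqE -!val_eqE /= -xl -yl !eqxx.
Qed.

End RegularType.

Theorem theorem1p1 (R : realType) (n : nat) (M : set 'rV[R[i]]_n)
    (M_hyp : real_hypersurface_germ M) (M_PS : PS_hypersurface M) :
  Delta1_reg (vanishing_ideal M) = (4%:R)%:E ->
  Delta1 (vanishing_ideal M) = (4%:R)%:E.
Proof.
move=> reg4; have [k0 _ PS] := M_PS.
apply/eqP; rewrite eq_le; apply/andP; split; last first.
  rewrite -reg4; apply: ge_ereal_sup => _ [z [cz oz] <-].
  apply: ereal_sup_ubound; exists z => //; rewrite oz.
  congr ereal_inf; apply/seteqP; split=> x [h Jh <-]; exists h => //;
    by rewrite inver oner_eq0 invr1 mule1.
apply: ge_ereal_sup => _ [z cz <-]; rewrite leNgt; apply/negP => lt4.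
have inJ r : vanishing_ideal M r ->
    ((4%:R)%:E < order_smooth (r \o z) / order_curve z)%E.
  move=> Jr; apply: lt_le_trans lt4 _; apply: ereal_inf_lbound.
  by exists r.
have [bz nz] := cz.
have [[oz _]|[p [/= zp min oz]]] := @leastP R [set j | derive1n j z 0 != 0].
  have [r [h [g [[Jr _] _ _]]]] := PS k0 (leqnn k0).
  have := inJ r Jr; rewrite /order_curve oz invey mule0 lte_fin.
  by rewrite ltNge ler0n.
have p0 : (0 < p)%N.
  by rewrite lt0n; apply: contraNneq zp => p0; have [z0 _] := bz; rewrite p0 /= z0.
have zlow j : (j < p)%N -> derive1n j z 0 = 0.
  by move=> jp; apply/eqP; apply: contraTT jp => /min; rewrite -leqNgt.
(* the jet must see all terms that decide contact greater than 4p *)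
pose k := maxn k0 (4 * p).
have [r [h [g [[Jr defr] jd [phi [psi lc PSG]]]]]] := PS k (leq_maxl _ _).
have [sr _] := Jr.
have pk : (4 * p <= k)%N by exact: leq_maxr.
have k4 : (4 <= k)%N by rewrite (leq_trans _ pk) // leq_pmulr.
have van j v : (j < (4 * p).+1)%N -> taylor_part j (r \o z) v = 0.
  move=> jp; apply: (@order_smooth_gt _ _ _ (4 * p)) => //.
  have := inJ r Jr; rewrite /order_curve oz inver pnatr_eq0 gtn_eqF //.
  by rewrite lte_pdivlMr ?ltr0n // -EFinM -natrM.
have [w [bw rw zero]] := regular_shadow sr jd lc bz p0 pk k4 zlow zp van.
have bG : based_curve (phi \o w) by have [[]] := rw.
have [all0|[j j5 [low nonz]]] := order_smooth_lt (r \o (phi \o w)) 5.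
  have : ((5%:R)%:E <= (4%:R)%:E :> \bar R)%E.
    rewrite -reg4; apply: (@le_trans _ _ (ereal_inf [set order_smooth (h' \o (phi \o w))
        | h' in vanishing_ideal M])).
      apply: le_ereal_inf_tmp => _ [h' Jh' <-]; apply: order_smooth_ge.
      have [a sa hE] := defr h' Jh'; have [sh _] := Jh'.
      exact: ideal_vanish sr sh sa bG hE all0.
    by apply: ereal_sup_ubound; exists (phi \o w).
  by rewrite lee_fin ler_nat.
have oj : order_smooth (r \o (phi \o w)) = j%:R%:E by exact: order_smooth_eq.
have jk : (j <= k)%N by rewrite (leq_trans _ k4).
have [l jl] := PS_positive sr jd lc PSG bw jk oj.
rewrite zero ?ltxx //.
by rewrite -leq_double -jl.
Qed.
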